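(* Let $(K,v)$ be a valued field, fix any extension of $v$ to the algebraic closure $\tilde K$, and let $(K^r,v)$ be the absolute ramification field of $(K,v)$ with respect to this extension. Then $(K^r,v)$ is a gdr field if and only if $(K,v)$ is a gdr field, and $(K^r,v)$ is a semitame field if and only if $(K,v)$ is a semitame field.
   Context: The absolute ramification field $(K^r,v)$ of $(K,v)$ (w.r.t. a fixed extension of $v$ to $\tilde K$) is the ramification field of the normal extension $(K^{sep}|K,v)$, $K^{sep}$ the separable-algebraic closure. For a valued field $(F,u)$ with value group $uF$, residue field $Fu$, completion $\hat F$ with valuation ring $\mathcal{O}_{\hat F}$: (DRvr): if $\operatorname{char}Fu=p>0$, then $x\mapsto x^p$ is surjective on $\mathcal{O}_{\hat F}/p\mathcal{O}_{\hat F}$; (DRvp): if $\operatorname{char}Fu=p>0$, then $up$ is not the smallest positive element of $uF$ ($up=\infty$ if $\operatorname{char}F=p$); (DRst): if $\operatorname{char}Fu=p>0$, then $uF$ is $p$-divisible. Gdr field: (DRvr) and (DRvp). Semitame field: (DRvr) and (DRst). *)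

(* Defs.v *)
From HB Require Import structures.
From mathcomp Require Import all_boot all_order all_algebra all_field.
Set Implicit Arguments. Unset Strict Implicit. Unset Printing Implicit Defensive.
Import GRing.Theory.
Local Open Scope ring_scope.

(* A (Krull) valuation on a field F is given by its valuation ring O. *)
Definition valuation_ring (F : fieldType) (O : F -> Prop) : Prop :=
  [/\ O 0, O 1,
      (forall x y, O x -> O y -> O (x - y)),
      (forall x y, O x -> O y -> O (x * y)) &
      (forall x, x != 0 -> O x \/ O x^-1)].

(* vle O x y  <->  v x <= v y ;  vlt O x y <-> v x < v y  (v 0 = infinity) *)
Definition vle (F : fieldType) (O : F -> Prop) (x y : F) : Prop :=
  y = 0 \/ (x <> 0 /\ O (y / x)).
Definition vlt (F : fieldType) (O : F -> Prop) (x y : F) : Prop :=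
  vle O x y /\ ~ vle O y x.

Definition residue_char (F : fieldType) (O : F -> Prop) (p : nat) : Prop :=
  prime p /\ vlt O 1 (p%:R).

Definition is_filter (E : Type) (Fl : (E -> Prop) -> Prop) : Prop :=
  [/\ Fl (fun _ => True), ~ Fl (fun _ => False),
      (forall A B, Fl A -> Fl B -> Fl (fun x => A x /\ B x)) &
      (forall A B : E -> Prop, (forall x, A x -> B x) -> Fl A -> Fl B)].

Definition vcauchy (E : fieldType) (OE : E -> Prop) (Fl : (E -> Prop) -> Prop) :=
  forall c : E, c != 0 ->
    exists A, Fl A /\ forall x y, A x -> A y -> vlt OE c (x - y).

Definition vconverges (E : fieldType) (OE : E -> Prop) (Fl : (E -> Prop) -> Prop)
  (l : E) := forall c : E, c != 0 -> Fl (fun x => vlt OE c (x - l)).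

Definition vcomplete (E : fieldType) (OE : E -> Prop) : Prop :=
  forall Fl, is_filter Fl -> vcauchy OE Fl -> exists l, vconverges OE Fl l.

(* We treat a valued field given as a subfield S of a field L, with valuation
   ring (O restricted to S).  A whole field K is the case S = everything. *)

Definition is_completion (L : fieldType) (O S : L -> Prop)
  (E : fieldType) (OE : E -> Prop) (j : L -> E) : Prop :=
  valuation_ring OE /\
  j 1 = 1 /\
  (forall x y, S x -> S y -> j (x + y) = j x + j y) /\
  (forall x y, S x -> S y -> j (x * y) = j x * j y) /\
  (forall x, S x -> (OE (j x) <-> O x)) /\
  (forall e c : E, c != 0 -> exists s, S s /\ vlt OE c (e - j s)) /\
  vcomplete OE.

Definition DRvr (L : fieldType) (O S : L -> Prop) : Prop :=
  forall p, residue_char O p ->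
  forall (E : fieldType) (OE : E -> Prop) (j : L -> E), is_completion O S OE j ->
  forall a, OE a -> exists b, OE b /\ exists d, OE d /\ a - b ^+ p = p%:R * d.

(* (DRvp) : v p is not the smallest positive element of the value group
   (v p = infinity when p = 0 in the field) *)
Definition DRvp (L : fieldType) (O S : L -> Prop) : Prop :=
  forall p, residue_char O p ->
    (p%:R = 0 :> L) \/ exists x, S x /\ vlt O 1 x /\ vlt O x (p%:R).

(* (DRst) : the value group of S is p-divisible *)
Definition DRst (L : fieldType) (O S : L -> Prop) : Prop :=
  forall p, residue_char O p ->
  forall x, S x -> x != 0 ->
    exists y, [/\ S y, y != 0, O (x / y ^+ p) & O (y ^+ p / x)].

Definition gdr_in (L : fieldType) (O S : L -> Prop) : Prop := DRvr O S /\ DRvp O S.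
Definition semitame_in (L : fieldType) (O S : L -> Prop) : Prop := DRvr O S /\ DRst O S.

Definition algebraic_over (K : fieldType) (L : fieldType) (iota : {rmorphism K -> L}) :=
  forall x : L, exists p : {poly K}, p != 0 /\ root (map_poly iota p) x.

Definition separable_over (K L : fieldType) (iota : {rmorphism K -> L}) (x : L) :=
  exists p : {poly K}, [/\ p != 0, separable_poly p & root (map_poly iota p) x].

Definition K_aut (K L : fieldType) (iota : {rmorphism K -> L}) (s : {rmorphism L -> L}) :=
  bijective s /\ forall a, s (iota a) = iota a.

Definition in_ram_group (K L : fieldType) (iota : {rmorphism K -> L}) (OL : L -> Prop)
  (s : {rmorphism L -> L}) :=
  K_aut iota s /\
  forall b, separable_over iota b -> b != 0 -> vlt OL b (s b - b).

Definition ram_field (K L : fieldType) (iota : {rmorphism K -> L}) (OL : L -> Prop) :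
  L -> Prop :=
  fun x => separable_over iota x /\
    forall s : {rmorphism L -> L}, in_ram_group iota OL s -> s x = x.

(* Main.v *)
From HB Require Import structures.
From mathcomp Require Import all_boot all_order all_algebra all_field ring.
From mathcomp Require Import boolp classical_sets functions.
Require Import Defs.
Set Implicit Arguments. Unset Strict Implicit. Unset Printing Implicit Defensive.
Import GRing.Theory.
Local Open Scope ring_scope.

(* Put K^r for the ramification field and M for the maximal ideal of O. Condition (DRvr)
   for a subfield S can be tested in S itself, without its completion: every integral
   element of S is a p-th power of S modulo p O + c M, for each nonzero c in O. The gdr
   and semitame conditions then transfer, in both directions, along two kinds of
   extensions S(b) / S:
   - if O_S(b) is a localization of O_S[X] / (f) where f' is invertible, because the
     relative Frobenius of an etale algebra is an isomorphism;
   - if b^n is in S, with n prime to p the order of the value of b modulo the values of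
     S, because 1, b, ..., b^(n-1) is then a valuation basis of S(b) over S.
   Let T be maximal among the fields between K and K^r to which the conditions transfer.
   Every element b generating such an extension of T lies in K^r, hence in T. So the
   residue field of T is separably closed in that of L, and the values of L modulo those
   of T are p-power torsion. This forces v (s b - b) > v b for every automorphism s over
   T and every nonzero separable b: s is in the ramification group, and T = K^r. *)

(** * Order by value *)

Record vring (F : fieldType) :=
  VRing {vring_pred :> F -> Prop; vringP : valuation_ring vring_pred}.

Definition lev (F : fieldType) (O : vring F) (x y : F) : bool := `[< vle O x y >].
Definition ltv (F : fieldType) (O : vring F) (x y : F) : bool := ~~ lev O y x.
Definition eqv (F : fieldType) (O : vring F) (x y : F) : bool := lev O x y && lev O y x.
Definition maxv (F : fieldType) (O : vring F) (x y : F) : F := if lev O x y then y else x.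

Reserved Notation "x <=v y" (at level 70, y at next level).
Reserved Notation "x <v y" (at level 70, y at next level).
Reserved Notation "x =v y" (at level 70, y at next level).

Section ValuationOrder.
Variables (F : fieldType) (O : vring F).
Local Notation "x <=v y" := (lev O x y).
Local Notation "x <v y" := (ltv O x y).
Local Notation "x =v y" := (eqv O x y).
Implicit Types x y z c : F.

Lemma vring0 : O 0. Proof. by case: (vringP O). Qed.
Lemma vring1 : O 1. Proof. by case: (vringP O). Qed.
Lemma vringB x y : O x -> O y -> O (x - y).
Proof. by case: (vringP O) => _ _ + _ _; apply. Qed.
Lemma vringN x : O x -> O (- x). Proof. by rewrite -sub0r; apply/vringB/vring0. Qed.
Lemma vringD x y : O x -> O y -> O (x + y).
Proof. by move=> hx hy; rewrite -[y]opprK; apply/vringB/vringN. Qed.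
Lemma vringM x y : O x -> O y -> O (x * y).
Proof. by case: (vringP O) => _ _ _ + _; apply. Qed.
Lemma vringV x : x != 0 -> O x \/ O x^-1.
Proof. by case: (vringP O) => _ _ _ _; apply. Qed.

Lemma levP x y : reflect (exists2 t, O t & y = x * t) (x <=v y).
Proof.
apply: (iffP (asboolP _)) => [[->|[/eqP x0 Ot]]|[t Ot ->]].
- by exists 0; [exact: vring0 | rewrite mulr0].
- by exists (y / x) => //; rewrite mulrC divfK.
have [->|x0] := eqVneq x 0; first by left; rewrite mul0r.
by right; split; [exact/eqP | rewrite mulrC mulKf].
Qed.

Lemma vltP x y : vlt O x y <-> x <v y.
Proof.
rewrite /vlt /ltv; split=> [[_ h]|/asboolPn h]; first exact/asboolPn.
split=> //; apply: contrapT => h'; apply: h.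
have [->|x0] := eqVneq x 0; first by left.
have y0 : y != 0 by apply/eqP => y0; apply: h'; left.
right; split; first exact/eqP.
have [//|] := vringV (mulf_neq0 x0 (invr_neq0 y0)).
by rewrite invf_div => Oyx; case: h'; right; split=> //; apply/eqP.
Qed.

Lemma lev1 x : (1 <=v x) <-> O x.
Proof.
split; first by case/levP => t Ot ->; rewrite mul1r.
by move=> h; apply/levP; exists x; rewrite ?mul1r.
Qed.

Lemma lev_refl x : x <=v x.
Proof. by apply/levP; exists 1; [exact: vring1 | rewrite mulr1]. Qed.
Hint Resolve lev_refl : core.

Lemma lev_trans y x z : x <=v y -> y <=v z -> x <=v z.
Proof.
by move=> /levP[t Ot ->] /levP[u Ou ->]; apply/levP; exists (t * u);
  [exact: vringM | rewrite mulrA].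
Qed.

Lemma ltvW x y : x <v y -> x <=v y.
Proof. by move/vltP=> [h _]; apply/asboolP. Qed.

Lemma ltvNge x y : (x <v y) = ~~ (y <=v x). Proof. by []. Qed.
Lemma levNgt x y : (x <=v y) = ~~ (y <v x). Proof. by rewrite /ltv negbK. Qed.

Lemma lev_total x y : (x <=v y) || (y <=v x).
Proof. by case: (boolP (x <=v y)) => //= /ltvW. Qed.

Lemma lev_lt_trans y x z : x <=v y -> y <v z -> x <v z.
Proof. by move=> h; apply: contra => h'; apply: lev_trans h' h. Qed.
Lemma ltv_le_trans y x z : x <v y -> y <=v z -> x <v z.
Proof. by move=> xy yz; apply: contra xy => h; apply: lev_trans yz h. Qed.
Lemma ltvv x : (x <v x) = false. Proof. by rewrite /ltv lev_refl. Qed.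

Lemma levr0 x : x <=v 0.
Proof. by apply/levP; exists 0; [exact: vring0 | rewrite mulr0]. Qed.
Hint Resolve levr0 : core.
Lemma lev0r x : (0 <=v x) = (x == 0).
Proof.
apply/levP/eqP => [[t _ ->]|->]; first by rewrite mul0r.
by exists 0; [exact: vring0 | rewrite mulr0].
Qed.
Lemma ltvr0 x : (x <v 0) = (x != 0). Proof. by rewrite /ltv lev0r. Qed.
Lemma ltv_neq0 x y : x <v y -> x != 0.
Proof. by apply: contraTneq => ->; rewrite /ltv levr0. Qed.

Lemma lev_maxl x y : x <=v maxv O x y.
Proof. by rewrite /maxv; case: ifP. Qed.
Lemma lev_maxr x y : y <=v maxv O x y.
Proof. by rewrite /maxv; case: ifP => // /negbT/ltvW. Qed.
Lemma maxv_neq0 x y : x != 0 -> y != 0 -> maxv O x y != 0.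
Proof. by rewrite /maxv; case: ifP. Qed.

Lemma levN x y : (x <=v - y) = (x <=v y).
Proof.
have h z : x <=v z -> x <=v - z.
  by case/levP => t Ot ->; apply/levP; exists (- t); [exact: vringN | rewrite mulrN].
by apply/idP/idP => [/h|/h //]; rewrite opprK.
Qed.
Lemma levNl x y : (- x <=v y) = (x <=v y).
Proof.
have h z : z <=v y -> - z <=v y.
  by case/levP => t Ot ->; apply/levP; exists (- t); [exact: vringN | rewrite mulrNN].
by apply/idP/idP => [/h|/h //]; rewrite opprK.
Qed.
Lemma ltvN x y : (x <v - y) = (x <v y). Proof. by rewrite /ltv levNl. Qed.

Lemma levD c x y : c <=v x -> c <=v y -> c <=v x + y.
Proof.
move=> /levP[t Ot ->] /levP[u Ou ->]; apply/levP; exists (t + u); first exact: vringD.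
by rewrite mulrDr.
Qed.
Lemma levB c x y : c <=v x -> c <=v y -> c <=v x - y.
Proof. by move=> hx hy; apply: levD; rewrite ?levN. Qed.

Lemma ltvD c x y : c <v x -> c <v y -> c <v x + y.
Proof.
move=> hx hy; have [h|h] := orP (lev_total x y).
  by apply: ltv_le_trans hx _; apply: levD.
by apply: ltv_le_trans hy _; apply: levD.
Qed.
Lemma ltvB c x y : c <v x -> c <v y -> c <v x - y.
Proof. by move=> hx hy; apply: ltvD; rewrite ?ltvN. Qed.

Lemma lev_sum (I : Type) (r : seq I) (P : pred I) (G : I -> F) c :
  (forall i, P i -> c <=v G i) -> c <=v \sum_(i <- r | P i) G i.
Proof. by move=> h; elim/big_ind: _ => // x y; exact: levD. Qed.
Lemma ltv_sum (I : Type) (r : seq I) (P : pred I) (G : I -> F) c :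
  c != 0 -> (forall i, P i -> c <v G i) -> c <v \sum_(i <- r | P i) G i.
Proof. by move=> c0 h; elim/big_ind: _ => // [|x y]; [rewrite ltvr0 | exact: ltvD]. Qed.

Lemma levM a b c d : a <=v b -> c <=v d -> a * c <=v b * d.
Proof.
move=> /levP[t Ot ->] /levP[u Ou ->]; apply/levP; exists (t * u); first exact: vringM.
by rewrite mulrACA.
Qed.
Lemma levM2l z x y : z != 0 -> (z * x <=v z * y) = (x <=v y).
Proof.
move=> z0; apply/idP/idP => h; last exact: levM.
by have := levM (lev_refl z^-1) h; rewrite !mulKf.
Qed.
Lemma levM2r z x y : z != 0 -> (x * z <=v y * z) = (x <=v y).
Proof. by move=> z0; rewrite ![_ * z]mulrC levM2l. Qed.
Lemma ltvM2l z x y : z != 0 -> (z * x <v z * y) = (x <v y).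
Proof. by move=> z0; rewrite /ltv levM2l. Qed.
Lemma ltvM2r z x y : z != 0 -> (x * z <v y * z) = (x <v y).
Proof. by move=> z0; rewrite /ltv levM2r. Qed.
Lemma ltv_leM a b c d : c != 0 -> a <v b -> c <=v d -> a * c <v b * d.
Proof.
by move=> c0 ab cd; apply: ltv_le_trans (levM (lev_refl b) cd); rewrite ltvM2r.
Qed.
Lemma lev_ltM a b c d : a != 0 -> a <=v b -> c <v d -> a * c <v b * d.
Proof. by move=> a0 ab cd; rewrite [a * _]mulrC [b * _]mulrC; apply: ltv_leM. Qed.
Lemma lev1_div x y : y != 0 -> (1 <=v x / y) = (y <=v x).
Proof. by move=> y0; rewrite -(levM2r _ _ y0) mul1r divfK. Qed.
Lemma ltv1_div x y : y != 0 -> (1 <v x / y) = (y <v x).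
Proof. by move=> y0; rewrite -(ltvM2r _ _ y0) mul1r divfK. Qed.

Lemma levX n x y : x <=v y -> x ^+ n <=v y ^+ n.
Proof. by move=> h; elim: n => // n IH; rewrite !exprS levM. Qed.
Lemma ltvX n x y : (0 < n)%N -> x <v y -> x ^+ n <v y ^+ n.
Proof.
case: n => // n _ h; rewrite !exprS; apply: ltv_leM => //; last exact/levX/ltvW.
by rewrite expf_neq0 // (ltv_neq0 h).
Qed.
Lemma lev_pX2r n x y : (0 < n)%N -> (x ^+ n <=v y ^+ n) = (x <=v y).
Proof.
move=> n0; apply/idP/idP; last exact: levX.
by apply: contraTT; apply: ltvX.
Qed.
Lemma ltv_pX2r n x y : (0 < n)%N -> (x ^+ n <v y ^+ n) = (x <v y).
Proof. by move=> n0; rewrite /ltv lev_pX2r. Qed.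
Lemma lev_pV2 x y : x != 0 -> y != 0 -> (x^-1 <=v y^-1) = (y <=v x).
Proof.
move=> x0 y0; rewrite -(levM2l _ _ (mulf_neq0 x0 y0)) mulrAC mulfV // mul1r.
by rewrite mulfK.
Qed.

Lemma lev1X n x : 1 <=v x -> 1 <=v x ^+ n.
Proof. by move=> h; rewrite -(expr1n _ n) levX. Qed.
Lemma lev1M x y : 1 <=v x -> 1 <=v y -> 1 <=v x * y.
Proof. by rewrite -{3}[1]mul1r; apply: levM. Qed.
Lemma levMr c x y : 1 <=v y -> c <=v x -> c <=v x * y.
Proof. by rewrite -{2}[c]mulr1 => hy hx; apply: levM. Qed.
Lemma levMl c x y : 1 <=v x -> c <=v y -> c <=v x * y.
Proof. by rewrite mulrC; apply: levMr. Qed.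
Lemma ltvMr c x y : 1 <=v y -> c <v x -> c <v x * y.
Proof. by move=> hy hx; apply: ltv_le_trans hx _; apply: levMr. Qed.
Lemma ltvMl c x y : 1 <=v x -> c <v y -> c <v x * y.
Proof. by rewrite mulrC; apply: ltvMr. Qed.
Lemma lev_exprS n x : 1 <=v x -> x <=v x ^+ n.+1.
Proof. by move=> h; rewrite exprS levMr ?lev1X. Qed.
Lemma lev1_nat n : 1 <=v n%:R.
Proof. by elim: n => // n IH; rewrite mulrS levD. Qed.

Lemma eqv_refl x : x =v x. Proof. by rewrite /eqv lev_refl. Qed.
Hint Resolve eqv_refl : core.
Lemma eqv_sym x y : (x =v y) = (y =v x). Proof. by rewrite /eqv andbC. Qed.
Lemma eqv_trans y x z : x =v y -> y =v z -> x =v z.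
Proof.
by move=> /andP[xy yx] /andP[yz zy]; rewrite /eqv (lev_trans xy yz) (lev_trans zy yx).
Qed.
Lemma eqv_le x y : x =v y -> x <=v y. Proof. by case/andP. Qed.
Lemma eqv_ge x y : x =v y -> y <=v x. Proof. by case/andP. Qed.
Lemma eqv_ltl x y z : x =v y -> (x <v z) = (y <v z).
Proof. by case/andP => xy yx; apply/idP/idP; apply: lev_lt_trans. Qed.
Lemma eqv_ltr x y z : x =v y -> (z <v x) = (z <v y).
Proof. by case/andP => xy yx; apply/idP/idP => h; apply: (ltv_le_trans h). Qed.
Lemma eqv_lel x y z : x =v y -> (x <=v z) = (y <=v z).
Proof. by case/andP => xy yx; apply/idP/idP; apply: lev_trans. Qed.
Lemma eqv_ler x y z : x =v y -> (z <=v x) = (z <=v y).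
Proof. by case/andP => xy yx; apply/idP/idP => h; apply: (lev_trans h). Qed.
Lemma eqv_eq0 x y : x =v y -> (x == 0) = (y == 0).
Proof.
by case/andP => xy yx; apply/eqP/eqP => e; apply/eqP; move: xy yx; rewrite e ?lev0r.
Qed.
Lemma eqvM a b c d : a =v b -> c =v d -> a * c =v b * d.
Proof. by case/andP => ? ? /andP[? ?]; rewrite /eqv !levM. Qed.
Lemma eqvX n x y : x =v y -> x ^+ n =v y ^+ n.
Proof. by case/andP => ? ?; rewrite /eqv !levX. Qed.
Lemma eqv_pX2r n x y : (0 < n)%N -> (x ^+ n =v y ^+ n) = (x =v y).
Proof. by move=> n0; rewrite /eqv !lev_pX2r. Qed.
Lemma eqvX_neq0 n x y : (0 < n)%N -> x != 0 -> x =v y ^+ n -> y != 0.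
Proof. by move=> n0 x0 /eqv_eq0; rewrite (negbTE x0) expf_eq0 n0 => /esym/negbT. Qed.
Lemma eqvM2l z x y : z != 0 -> (z * x =v z * y) = (x =v y).
Proof. by move=> z0; rewrite /eqv !levM2l. Qed.
Lemma eqvM2r z x y : z != 0 -> (x * z =v y * z) = (x =v y).
Proof. by move=> z0; rewrite /eqv !levM2r. Qed.
Lemma eqvV x y : x =v y -> x^-1 =v y^-1.
Proof.
move=> h; have [x0|x0] := eqVneq x 0.
  by move: (eqv_eq0 h); rewrite x0 eqxx => /esym/eqP ->.
have y0 : y != 0 by rewrite -(eqv_eq0 h).
by case/andP: h => ? ?; rewrite /eqv !lev_pV2 // andbC; apply/andP.
Qed.
Lemma eqvN x y : (x =v - y) = (x =v y). Proof. by rewrite /eqv levN levNl. Qed.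
Lemma ltv_eqF x y : x <v y -> (x =v y) = false.
Proof. by rewrite /ltv /eqv => /negbTE ->; rewrite andbF. Qed.

Lemma eqv_addr x y : x <v y -> x =v x + y.
Proof.
move=> h; apply/andP; split; first by apply: levD (ltvW h).
rewrite levNgt; apply/negP => hxy.
suff : x <v x by rewrite ltvv.
by rewrite -{2}[x](addrK y); apply: ltvB.
Qed.
Lemma eqv_subl x y : x <v x - y -> x =v y.
Proof.
move=> h; have := @eqv_addr x (- (x - y)); rewrite ltvN => /(_ h).
by rewrite opprB addrC subrK.
Qed.
Lemma eqv_subr x y : x <v y - x -> x =v y.
Proof. by move=> h; apply: eqv_subl; rewrite -opprB ltvN. Qed.

Lemma eqv1M x y : 1 =v x -> 1 =v y -> 1 =v x * y.
Proof. by move=> hx hy; rewrite -[1]mul1r eqvM. Qed.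
Lemma eqv1X n x : 1 =v x -> 1 =v x ^+ n.
Proof. by move=> h; rewrite -(expr1n _ n) eqvX. Qed.
Lemma eqv1_neq0 x : 1 =v x -> x != 0.
Proof. by move/eqv_eq0 <-; rewrite oner_eq0. Qed.
Lemma eqv1V x : 1 =v x -> 1 =v x^-1.
Proof. by move=> h; rewrite -[1]invr1 eqvV. Qed.
Lemma eqv1_div x y : y != 0 -> (1 =v x / y) = (x =v y).
Proof. by move=> y0; rewrite -(eqvM2r _ _ y0) mul1r divfK // eqv_sym. Qed.
Lemma eqv1_prod (I : eqType) (r : seq I) (G : I -> F) :
  (forall i, i \in r -> 1 =v G i) -> 1 =v \prod_(i <- r) G i.
Proof. by move=> h; rewrite big_seq; elim/big_ind: _ => // x y; exact: eqv1M. Qed.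
Lemma eqv1_ltvN x : 1 <=v x -> ~~ (1 <v x) -> 1 =v x.
Proof. by rewrite /eqv /ltv negbK => -> ->. Qed.
Lemma eqv1_close x y : 1 =v x -> 1 <v x - y -> 1 =v y.
Proof.
move=> hx h; apply: (eqv_trans hx); rewrite -[y](subKr x); apply: eqv_addr.
by rewrite ltvN -(eqv_ltl _ hx).
Qed.

Lemma lev_subXX n x y : 1 <=v x -> 1 <=v y -> x - y <=v x ^+ n - y ^+ n.
Proof.
move=> hx hy; rewrite subrXX; apply: levMr => //.
by apply: lev_sum => i _; apply: lev1M; exact: lev1X.
Qed.

Lemma ltv_prod (s t : seq F) : size s = size t -> s != [::] ->
  {in s & t, forall x y, x <v y} -> \prod_(x <- s) x <v \prod_(y <- t) y.
Proof.
elim: s t => [|x s IH] [|y t] //= [est] _ h; rewrite !big_cons.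
have xy : x <v y by apply: h; rewrite mem_head.
have [s0|s0] := eqVneq s [::].
  by move: est; rewrite s0 => /esym/size0nil ->; rewrite !big_nil !mulr1.
have lt : \prod_(i <- s) i <v \prod_(i <- t) i.
  by apply: IH => // u v us vt; apply: h; rewrite inE ?us ?vt orbT.
by apply: ltv_leM => //; [exact: ltv_neq0 lt | exact: ltvW].
Qed.

Lemma ex_minv (g : nat -> F) n : (0 < n)%N ->
  exists2 k, (k < n)%N & forall i, (i < n)%N -> g k <=v g i.
Proof.
case: n => // n _; elim: n => [|n [k hk gk]].
  by exists 0%N => // -[|//] _; exact: lev_refl.
have [h|h] := orP (lev_total (g k) (g n.+1)).
  exists k; first exact: ltnW.
  by move=> i; rewrite ltnS leq_eqVlt => /predU1P[->|/gk].
exists n.+1 => // i; rewrite ltnS leq_eqVlt => /predU1P[->|/gk]; first exact: lev_refl.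
exact: lev_trans.
Qed.

Section ResidueCharacteristic.
Variable p : nat.
Hypothesis p_prime : prime p.

Lemma coprime_eqv1 n : 1 <v p%:R -> coprime n p -> 1 =v n%:R.
Proof.
move=> hp; case: n => [|n] cp.
  by move: cp p_prime; rewrite /coprime gcd0n => /eqP ->.
have [u v e _] := egcdnP p (ltn0Sn n).
rewrite /eqv lev1_nat /= levNgt; apply/negP => h.
have : 1 <v u%:R * n.+1%:R - v%:R * p%:R.
  by apply: ltvB; (apply: ltvMl; first exact: lev1_nat).
by rewrite -!natrM e (eqP cp) natrD addrAC subrr add0r ltvv.
Qed.

Lemma lev_exprDp x y : 1 <=v x -> 1 <=v y -> p%:R <=v (x + y) ^+ p - (x ^+ p + y ^+ p).
Proof.
move=> hx hy; case: p p_prime => [|[|q]] // pq.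
rewrite exprDn big_ord_recl big_ord_recr /= subn0 expr0 mulr1 bin0 mulr1n.
rewrite /bump /= add1n subnn expr0 mul1r binn mulr1n addrA opprD addrACA subrr.
rewrite addr0 addrAC subrr add0r; apply: lev_sum => i _; rewrite /bump /= add1n.
have /dvdnP[k ->] : (q.+2 %| 'C(q.+2, i.+1))%N by rewrite prime_dvd_bin //= ltnS ltn_ord.
rewrite -[_ *+ (_ * _)]mulr_natr natrM mulrA; apply: levMl => //.
by apply: lev1M; [apply: lev1M; exact: lev1X | exact: lev1_nat].
Qed.

Lemma lev_exprp_sum (n : nat) (G : nat -> F) : (forall i, 1 <=v G i) ->
  p%:R <=v (\sum_(i < n) G i) ^+ p - \sum_(i < n) (G i) ^+ p.
Proof.
move=> h; elim: n => [|n IH].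
  by rewrite !big_ord0 expr0n gtn_eqF ?prime_gt0 // subrr levr0.
rewrite !big_ord_recr /=; set s := \sum_(i < n) G i; set t := \sum_(i < n) _.
have -> : (s + G n) ^+ p - (t + G n ^+ p) =
   ((s + G n) ^+ p - (s ^+ p + G n ^+ p)) + (s ^+ p - t) by ring.
by apply: levD => //; apply: lev_exprDp => //; exact: lev_sum.
Qed.

Lemma ltv1_exprp_sub1 k x : 1 <v p%:R -> 1 <=v x -> 1 <v x ^+ (p ^ k) - 1 -> 1 <v x - 1.
Proof.
move=> hp hx; elim: k => [|k IH]; first by rewrite expn0 expr1.
rewrite expnSr exprM => h; apply: IH; move: h; set z := x ^+ (p ^ k) => h.
have hz : 1 <=v z by exact: lev1X.
rewrite -(ltv_pX2r _ _ (prime_gt0 p_prime)) expr1n.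
have := lev_exprDp (levB hz (lev_refl 1)) (lev_refl 1).
rewrite subrK expr1n => h'.
have -> : (z - 1) ^+ p = (z ^+ p - 1) - (z ^+ p - ((z - 1) ^+ p + 1)) by ring.
by apply: ltvB => //; exact: ltv_le_trans h'.
Qed.

Lemma unity_root_eq1 n u : 1 <v p%:R -> coprime n p -> u ^+ n = 1 -> 1 <v u - 1 -> u = 1.
Proof.
move=> hp cp un hu; apply/eqP; rewrite -subr_eq0.
have := subrXX u 1 n; rewrite un expr1n subrr => /esym/eqP; rewrite mulf_eq0 => /orP[//|].
have u1 : 1 <=v u by rewrite -(subrK 1 u) levD ?lev_refl // ltvW.
set s := \sum_(i < n) _; move/eqP => s0.
have : 1 <v n%:R - s.
  have -> : n%:R - s = \sum_(i < n) (1 - u ^+ (n.-1 - i) * 1 ^+ i).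
    by rewrite sumrB sumr_const card_ord.
  apply: ltv_sum => [|i _]; first exact: oner_neq0.
  rewrite expr1n mulr1 -[X in X - _](expr1n _ (n.-1 - i)).
  by apply: ltv_le_trans (lev_subXX _ _ _) => //; rewrite -opprB ltvN.
by rewrite s0 subr0 -(eqv_ltr _ (coprime_eqv1 hp cp)) ltvv.
Qed.

End ResidueCharacteristic.
End ValuationOrder.
#[export] Hint Resolve lev_refl levr0 eqv_refl : core.

Section ValuedMorphism.
Variables (F E : fieldType) (O : vring F) (OE : vring E) (i : {rmorphism F -> E}).
Hypothesis ringE : forall a, OE (i a) <-> O a.

Lemma lev_morph a b : lev OE (i a) (i b) = lev O a b.
Proof.
apply/asboolP/asboolP => -[].
- by move/eqP; rewrite fmorph_eq0 => /eqP ->; left.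
- rewrite -fmorph_div => -[/eqP]; rewrite fmorph_eq0 => /eqP a0 /ringE h.
  by right.
- by move=> ->; left; rewrite rmorph0.
move=> [/eqP a0 h]; right; split; first by apply/eqP; rewrite fmorph_eq0.
by rewrite -fmorph_div; apply/ringE.
Qed.

Lemma ltv_morph a b : ltv OE (i a) (i b) = ltv O a b.
Proof. by rewrite /ltv lev_morph. Qed.
Lemma eqv_morph a b : eqv OE (i a) (i b) = eqv O a b.
Proof. by rewrite /eqv !lev_morph. Qed.

Lemma residue_char_morph p : residue_char OE p <-> residue_char O p.
Proof.
split=> -[p_prime /vltP hp]; split=> //; apply/vltP; move: hp;
  by rewrite -(rmorph_nat i) -(rmorph1 i) ltv_morph.
Qed.

End ValuedMorphism.

(** * Subfields *)

(* R is a field, or L * L for a field L: a subfield of L * L is the graph of an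
   isomorphism between two subfields of L. *)
Record subfieldOf (R : comUnitRingType) := SubfieldOf {
  subfield_pred :> {pred R};
  subfield_closed : divring_closed subfield_pred;
  subfield_unit : {in subfield_pred, forall x, x != 0 -> x \is a GRing.unit} }.
HB.instance Definition _ (R : comUnitRingType) (S : subfieldOf R) :=
  GRing.isDivringClosed.Build R (subfield_pred S) (subfield_closed S).

Definition subfield_type (R : comUnitRingType) (S : subfieldOf R) :=
  {x : R | x \in subfield_pred S}.
HB.instance Definition _ (R : comUnitRingType) (S : subfieldOf R) :=
  SubChoice.on (subfield_type S).
HB.instance Definition _ (R : comUnitRingType) (S : subfieldOf R) :=
  [SubChoice_isSubComUnitRing of subfield_type S by <:].
Fact subfield_type_field (R : comUnitRingType) (S : subfieldOf R) :
  GRing.field_axiom (subfield_type S).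
Proof.
move=> x x0; have : val x \is a GRing.unit.
  apply: subfield_unit; first exact: (valP x).
  by apply: contraNneq x0 => e; apply/eqP/val_inj; rewrite e rmorph0.
by [].
Qed.
HB.instance Definition _ (R : comUnitRingType) (S : subfieldOf R) :=
  GRing.ComUnitRing_isField.Build (subfield_type S) (@subfield_type_field R S).

Definition subfield_val (R : comUnitRingType) (S : subfieldOf R) :
  {rmorphism subfield_type S -> R} := val.

Fact field_unit (L : fieldType) (S : {pred L}) :
  {in S, forall x, x != 0 -> x \is a GRing.unit}.
Proof. by move=> x _; rewrite unitfE. Qed.
Definition subfieldOf_field (L : fieldType) (S : {pred L}) (clS : divring_closed S) :
  subfieldOf L := SubfieldOf clS (@field_unit L S).

Lemma eq_subfieldOf (R : comUnitRingType) (S T : subfieldOf R) : S =i T -> S = T.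
Proof.
case: S T => [S clS uS] [T clT uT] /= ST.
have {}ST : S = T by apply/funext => x; exact: ST.
by case: _ / ST clT uT => clT uT; congr SubfieldOf; exact: Prop_irrelevance.
Qed.

Section Zorn.
Variable R : comUnitRingType.
Implicit Types (C : subfieldOf R -> Prop) (S T U : subfieldOf R).

Definition is_chain C := (exists S, C S) /\
  forall S T, C S -> C T -> {subset S <= T} \/ {subset T <= S}.
Definition is_union C U := forall x, x \in U <-> exists2 S, C S & x \in S.

Lemma is_chain_common C x y : is_chain C -> (exists2 S, C S & x \in S) ->
  (exists2 S, C S & y \in S) -> exists S, [/\ C S, x \in S & y \in S].
Proof.
move=> [_ chC] [S CS xS] [T CT yT].
have [ST|TS] := chC _ _ CS CT; first by exists T; split=> //; exact: ST.
by exists S; split=> //; exact: TS.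
Qed.

Lemma is_union_sub C U S : is_union C U -> C S -> {subset S <= U}.
Proof. by move=> unionU CS x xS; apply/unionU; exists S. Qed.

Lemma exists_union C : is_chain C -> exists U, is_union C U.
Proof.
move=> chC; have [[S0 CS0] _] := chC.
pose U : {pred R} := fun x => `[< exists2 S, C S & x \in S >].
have common x y : x \in U -> y \in U -> exists S, [/\ C S, x \in S & y \in S].
  by move=> /asboolP hx /asboolP hy; exact: is_chain_common.
have clU : divring_closed U.
  split=> [|x y /common xU /xU[S [CS xS yS]]|x y /common xU /xU[S [CS xS yS]]].
  - by apply/asboolP; exists S0 => //; exact: rpred1.
  - by apply/asboolP; exists S => //; exact: rpredB.
  - by apply/asboolP; exists S => //; exact: rpred_div.
have unitU : {in U, forall x, x != 0 -> x \is a GRing.unit}.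
  by move=> x /asboolP[S _ xS]; exact: subfield_unit xS.
by exists (SubfieldOf clU unitU) => x; split=> [/asboolP//|h]; apply/asboolP.
Qed.

Lemma subfield_Zorn (P : subfieldOf R -> Prop) S0 : P S0 ->
  (forall C U, is_chain C -> (forall S, C S -> P S) -> is_union C U -> P U) ->
  exists2 T, P T & forall S, P S -> {subset T <= S} -> {subset S <= T}.
Proof.
move=> PS0 Pchain; pose PX (X : R -> bool) := exists2 S, P S & subfield_pred S = X.
pose le (X Y : {X | PX X}) := `[< forall x, sval X x -> sval Y x >].
have PXS S : P S -> PX (subfield_pred S) by exists S.
have [||A chA|[X [T PT eX]] Xmax] := @ZL_preorder _ (exist PX _ (PXS S0 PS0)) le.
- by move=> X; apply/asboolP.
- by move=> X Y Z /asboolP XY /asboolP YZ; apply/asboolP => x /XY/YZ.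
- have [[X AX]|noA] := lem (exists X, A X); last first.
    by exists (exist PX _ (PXS S0 PS0)) => X AX; case: noA; exists X.
  pose C S := exists2 Y, A Y & subfield_pred S = sval Y.
  have AC Y : A Y -> exists2 S, C S & subfield_pred S = sval Y.
    by move=> AY; have [S PS eS] := svalP Y; exists S => //; exists Y.
  have chC : is_chain C.
    split; first by have [S CS _] := AC X AX; exists S.
    move=> S T [Y AY eS] [Z AZ eT].
    by case: (chA _ _ AY AZ) => /asboolP YZ; [left | right] => x;
      rewrite -!topredE /= eS eT; exact: YZ.
  have [U unionU] := exists_union chC.
  have PU : P U.
    apply: Pchain chC _ unionU => S [Y _ eS]; have [T PT eT] := svalP Y.
    by have -> : S = T by apply: eq_subfieldOf => x; rewrite -!topredE /= eS eT.
  exists (exist PX _ (PXS U PU)) => Y AY; apply/asboolP => x /= Yx.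
  by have [S CS eS] := AC Y AY; apply/unionU; exists S => //; rewrite -topredE /= eS.
exists T => // S PS TS x; pose S' := exist PX _ (PXS S PS).
have /Xmax/asboolP/(_ x) : le (exist PX X (ex_intro2 _ _ T PT eX)) S'.
  by apply/asboolP => y; rewrite /= -eX; exact: TS.
by rewrite /= -eX.
Qed.

End Zorn.

Lemma irredp_coprimep (F : fieldType) (h P : {poly F}) :
  irreducible_poly h -> ~~ (h %| P) -> coprimep h P.
Proof.
move=> h_irr; rewrite coprimep_def; apply: contraNT => gcd1.
by rewrite -(eqp_dvdl _ (h_irr.2 _ gcd1 (dvdp_gcdl h P))) dvdp_gcdr.
Qed.

Section Adjoin.
Variables (T : fieldType) (R : comUnitRingType) (f : {rmorphism T -> R}) (z : R).
Local Notation "P .[z]" := ((map_poly f P).[z]) (at level 2, format "P .[z]").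

Definition adjoin_pred : {pred R} := fun x => `[< exists P : {poly T}, x = P.[z] >].

Lemma adjoin_predP x : reflect (exists P : {poly T}, x = P.[z]) (x \in adjoin_pred).
Proof. exact: asboolP. Qed.

Hypothesis alg_z : exists2 h : {poly T}, irreducible_poly h & h.[z] = 0.

Lemma horner_eq0_or_inv (P : {poly T}) : P.[z] = 0 \/ exists V, V.[z] * P.[z] = 1.
Proof.
have [h h_irr hz0] := alg_z; have [/dvdpP[q ->]|ndvd] := boolP (h %| P).
  by left; rewrite rmorphM hornerM hz0 mulr0.
have /Bezout_eq1_coprimepP[[u v] /= e] := irredp_coprimep h_irr ndvd; right; exists v.
have := congr1 (fun Q => Q.[z]) e.
by rewrite rmorphD !rmorphM rmorph1 hornerD !hornerM hz0 mulr0 add0r hornerC.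
Qed.

Fact adjoin_unit : {in adjoin_pred, forall x, x != 0 -> x \is a GRing.unit}.
Proof.
move=> _ /adjoin_predP[P ->]; have [->|[V e] _] := horner_eq0_or_inv P.
  by rewrite eqxx.
by apply/unitrP; exists V.[z]; rewrite e mulrC e.
Qed.

Fact adjoin_closed : divring_closed adjoin_pred.
Proof.
split=> [|_ _ /adjoin_predP[P ->] /adjoin_predP[Q ->]|_ _ /adjoin_predP[P ->] /adjoin_predP[Q ->]];
  apply/adjoin_predP.
- by exists 1; rewrite rmorph1 hornerC.
- by exists (P - Q); rewrite rmorphB hornerD hornerN.
have [->|[V e]] := horner_eq0_or_inv Q; first by exists 0; rewrite invr0 mulr0 rmorph0 hornerC.
exists (P * V); rewrite rmorphM hornerM; congr (_ * _).
have uQ : Q.[z] \is a GRing.unit by apply/unitrP; exists V.[z]; rewrite e mulrC e.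
by apply: (mulIr uQ); rewrite mulVr.
Qed.

Definition adjoin : subfieldOf R := SubfieldOf adjoin_closed adjoin_unit.

Lemma adjoin_val a : f a \in adjoin.
Proof. by apply/adjoin_predP; exists a%:P; rewrite map_polyC hornerC. Qed.
Lemma mem_adjoin : z \in adjoin.
Proof. by apply/adjoin_predP; exists 'X; rewrite map_polyX hornerX. Qed.

End Adjoin.

Lemma exists_irreducible_monic (F : fieldType) (L : closedFieldType) (f : {rmorphism F -> L}) x :
  algebraicOver f x ->
  exists h, [/\ h \is monic, root (map_poly f h) x & irreducible_poly h].
Proof.
move/integral_algebraic; case/minPoly_decidable_closure=> [y|h hP]; last by exists h.
exact: pselect.
Qed.

Lemma exists_irreducible (F : fieldType) (L : closedFieldType) (f : {rmorphism F -> L}) x :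
  algebraicOver f x -> exists2 h, irreducible_poly h & (map_poly f h).[x] = 0.
Proof. by case/exists_irreducible_monic => h [_ /rootP rh h_irr]; exists h. Qed.

Section PolyOverSubring.
Variables (R : nzRingType) (A : {pred R}) (U : subNzRingType A).

Lemma polyOver_lift (P : {poly R}) :
  P \is a polyOver A -> exists Q : {poly U}, map_poly val Q = P.
Proof.
move=> PA; exists (\poly_(i < size P) (insubd (0 : U) P`_i)).
apply/polyP => i; rewrite coef_map coef_poly; case: ltnP => hi /=.
  by rewrite val_insubd ifT //; exact: (all_nthP 0 PA).
by rewrite nth_default ?rmorph0.
Qed.

Lemma polyOver_val (Q : {poly U}) : map_poly val Q \is a polyOver A.
Proof. by apply/(all_nthP 0) => i _; rewrite coef_map; exact: (valP Q`_i). Qed.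

Lemma polyOver_division (f P : {poly R}) :
  f \is monic -> f \is a polyOver A -> P \is a polyOver A ->
  exists q r, [/\ q \is a polyOver A, r \is a polyOver A, P = q * f + r & (size r < size f)%N].
Proof.
move=> + /polyOver_lift[f0 ef] /polyOver_lift[P0 eP]; rewrite -ef -eP => fm.
have f0m : f0 \is monic.
  rewrite monicE; apply/eqP/val_inj; rewrite rmorph1.
  by rewrite -(monicP fm) !lead_coefE size_map_inj_poly ?coef_map ?rmorph0 //; exact: val_inj.
exists (map_poly val (Pdiv.Ring.rdivp P0 f0)), (map_poly val (Pdiv.Ring.rmodp P0 f0)).
split; rewrite ?polyOver_val //.
  by rewrite {1}(Pdiv.RingMonic.rdivp_eq f0m P0) rmorphD rmorphM.
rewrite !size_map_inj_poly ?rmorph0 //; try exact: val_inj.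
by rewrite Pdiv.Ring.ltn_rmodpN0 ?monic_neq0.
Qed.

End PolyOverSubring.

(** * Extension of automorphisms *)

Definition is_minpoly (L : fieldType) (S : subfieldOf L) (x : L) (h : {poly L}) :=
  [/\ h \is monic, h \is a polyOver S, root h x &
      forall P, P \is a polyOver S -> root P x -> h %| P].

Lemma exists_minpoly (L : closedFieldType) (S : subfieldOf L) (x : L) :
  algebraicOver (subfield_val S) x -> exists h, is_minpoly S x h.
Proof.
move=> /exists_irreducible_monic[h [hm rh h_irr]]; exists (map_poly (subfield_val S) h).
split=> [||//|P PS]; [by rewrite map_monic | exact: polyOver_val |].
have [Q <-] := polyOver_lift (subfield_type S) PS => rQ; rewrite dvdp_map.
apply: contraLR rQ => /(irredp_coprimep h_irr); rewrite -(coprimep_map (subfield_val S)).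
by move/coprimep_root/(_ rh).
Qed.

Section Fixing.
Variables (L : fieldType) (S : subfieldOf L) (s : {rmorphism L -> L}).
Hypothesis sS : {in S, s =1 id}.

Lemma polyOver_fixed (P : {poly L}) : P \is a polyOver S -> map_poly s P = P.
Proof. by move=> /polyOverP PS; apply/polyP => i; rewrite coef_map; exact: sS. Qed.

Lemma root_fixed (P : {poly L}) x : P \is a polyOver S -> root P (s x) = root P x.
Proof. by move=> PS; rewrite -{1}(polyOver_fixed PS) fmorph_root. Qed.

End Fixing.

Definition diag (R : Type) (x : R) : R * R := (x, x).
Fact diag_zmod_morphism (R : nzRingType) : zmod_morphism (@diag R). Proof. by []. Qed.
Fact diag_monoid_morphism (R : nzRingType) : monoid_morphism (@diag R). Proof. by []. Qed.
HB.instance Definition _ (R : nzRingType) :=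
  GRing.isZmodMorphism.Build R (R * R)%type (@diag R) (@diag_zmod_morphism R).
HB.instance Definition _ (R : nzRingType) :=
  GRing.isMonoidMorphism.Build R (R * R)%type (@diag R) (@diag_monoid_morphism R).

Lemma horner_pair (R : comNzRingType) (P : {poly R * R}) (z : R * R) :
  P.[z] = ((map_poly fst P).[z.1], (map_poly snd P).[z.2]).
Proof. by rewrite !horner_map -surjective_pairing. Qed.

Section GraphSubfields.
Variables (L : closedFieldType) (G : subfieldOf (L * L)%type).
Let f1 : {rmorphism subfield_type G -> L} := fst \o subfield_val G.
Let f2 : {rmorphism subfield_type G -> L} := snd \o subfield_val G.

Lemma graph_functional y y1 y2 : (y, y1) \in G -> (y, y2) \in G -> y1 = y2.
Proof.
move=> Gy1 Gy2; apply/eqP; rewrite -subr_eq0; apply: contraT => d0.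
have /subfield_unit/implyP := rpredB Gy1 Gy2.
rewrite -[_ \is a _]/((y - y \is a GRing.unit) && (y1 - y2 \is a GRing.unit)).
by rewrite subrr unitr0 /= implybF negbK -pair_eqE /= (negbTE d0) andbF.
Qed.

Lemma maximal_graph_total y : algebraicOver f1 y ->
  (forall H : subfieldOf (L * L)%type, {subset G <= H} -> {subset H <= G}) ->
  exists y', (y, y') \in G.
Proof.
move=> /exists_irreducible[h h_irr rh] Gmax.
have [y' /rootP ry'] : exists y', root (map_poly f2 h) y'.
  by apply/closed_rootP; rewrite size_map_poly; case: h_irr => /gtn_eqF ->.
have alg_z : exists2 h, irreducible_poly h & (map_poly (subfield_val G) h).[(y, y')] = 0.
  by exists h => //; rewrite horner_pair -!map_poly_comp rh ry'.
exists y'; apply: (Gmax (adjoin alg_z)); last exact: mem_adjoin.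
by move=> z Gz; exact: (adjoin_val alg_z (Sub z Gz)).
Qed.

Lemma total_graph_morphism : (forall y, exists y', (y, y') \in G) ->
  exists s : {rmorphism L -> L}, forall y, (y, s y) \in G.
Proof.
case/choice => s sG.
have s_zmod : zmod_morphism s.
  by move=> u v; apply: (graph_functional (sG (u - v))); exact: rpredB (sG u) (sG v).
have s_monoid : monoid_morphism s.
  split=> [|u v]; first by apply: (graph_functional (sG 1)); exact: rpred1.
  by apply: (graph_functional (sG (u * v))); exact: rpredM (sG u) (sG v).
by exists (HB.pack_for {rmorphism L -> L} s (GRing.isZmodMorphism.Build _ _ s s_zmod)
  (GRing.isMonoidMorphism.Build _ _ s s_monoid)).
Qed.

End GraphSubfields.

Section AlgebraicClosure.
Variables (L : closedFieldType) (S : subfieldOf L).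
Hypothesis algS : forall x, algebraicOver (subfield_val S) x.

Lemma extend_aut (x x' : L) (h : {poly L}) : is_minpoly S x h -> root h x' ->
  exists s : {rmorphism L -> L}, {in S, s =1 id} /\ s x = x'.
Proof.
move=> [_ _ _ hmin] rh'; have [g g_irr /rootP rg] := exists_irreducible (algS x).
have rg' : root (map_poly (subfield_val S) g) x'.
  have /dvdpP[q ->] := hmin _ (polyOver_val _) rg.
  by rewrite rootM rh' orbT.
pose f : {rmorphism subfield_type S -> L * L} := @diag L \o subfield_val S.
have alg_z : exists2 g, irreducible_poly g & (map_poly f g).[(x, x')] = 0.
  by exists g => //; rewrite horner_pair -!map_poly_comp (rootP rg) (rootP rg').
pose G0 := adjoin alg_z.
have [//|C U [[V CV] _] CG0 unionU|G G0G Gmax] :=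
    @subfield_Zorn _ (fun G => {subset G0 <= G}) G0.
  by move=> z /(CG0 V CV); exact: is_union_sub unionU CV z.
have SG y : y \in S -> (y, y) \in G.
  by move=> yS; apply: G0G; exact: (adjoin_val alg_z (Sub y yS)).
have algG y : algebraicOver (fst \o subfield_val G) y.
  have [P P0 rP] := algS y; pose D := map_poly f P.
  have /(polyOver_lift (subfield_type G))[Q eQ] : D \is a polyOver G.
    by apply/polyOverP => i; rewrite coef_map; exact/SG/(valP P`_i).
  have eP : map_poly fst (map_poly (subfield_val G) Q) = map_poly (subfield_val S) P.
    by rewrite eQ -map_poly_comp.
  exists Q; last by rewrite map_poly_comp eP.
  by apply: contraNneq P0 => Q0; move: eP; rewrite Q0 !rmorph0 => /esym/eqP; rewrite map_poly_eq0.
have [|s sG] := @total_graph_morphism L G.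
  move=> y; apply: maximal_graph_total (algG y) _ => H GH z.
  by apply: Gmax => // w /G0G/GH.
exists s; split=> [y /SG|]; first exact: graph_functional (sG y).
by apply: (graph_functional (sG x)); apply: G0G; exact: mem_adjoin.
Qed.

Lemma fixing_bijective (s : {rmorphism L -> L}) : {in S, s =1 id} -> bijective s.
Proof.
move=> sS; have surj y : exists z, s z = y.
  have [P P0 rP] := algS y; set Q := map_poly _ P in rP.
  have QS : Q \is a polyOver S by exact: polyOver_val.
  have [rs ers] := closed_field_poly_normal Q.
  have mem_rs z : (z \in undup rs) = root Q z.
    by rewrite mem_undup ers rootZ ?root_prod_XsubC // lead_coef_eq0 map_poly_eq0.
  have s_rs : {subset map s (undup rs) <= undup rs}.
    by move=> _ /mapP[z + ->]; rewrite !mem_rs (root_fixed sS).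
  have uniq_s : uniq (map s (undup rs)) by rewrite (map_inj_uniq (fmorph_inj s)) undup_uniq.
  have [|_ eq_rs] := uniq_min_size uniq_s s_rs; first by rewrite size_map.
  by move: rP; rewrite -mem_rs -eq_rs => /mapP[z _ ->]; exists z.
have [t tK] := choice surj; exists t => [z|//].
by apply: (fmorph_inj s); rewrite tK.
Qed.

End AlgebraicClosure.

(** * Separable elements *)

Section SeparableElements.
Variables (F : fieldType) (L : closedFieldType) (iota : {rmorphism F -> L}).

Lemma separable_over_algebraic x : separable_over iota x -> algebraicOver iota x.
Proof. by case=> P [P0 _ rP]; exists P. Qed.

Lemma finite_subextension (zs : seq L) : {in zs, forall z, algebraicOver iota z} ->
  exists (E : fieldExtType F) (nu : {rmorphism E -> L}),
    (forall a, nu a%:A = iota a) /\ {in zs, forall z, exists e, nu e = z}.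
Proof.
elim: zs => [|z zs IH] alg.
  by exists F^o, iota; split=> // a; rewrite /GRing.scale /= mulr1.
have [|E [nu [nuF nu_zs]]] := IH; first by move=> w wzs; apply: alg; rewrite inE wzs orbT.
have [|h [hm rh h_irr]] := @exists_irreducible_monic _ _ nu z.
  have [P P0 rP] := alg z (mem_head _ _).
  exists (map_poly (in_alg E) P); first by rewrite map_poly_eq0.
  by rewrite -map_poly_comp (eq_map_poly (g := iota)).
pose E1 : fieldExtType E := SubFieldExtType rh h_irr.
have inj_base (e : E) : subfx_inj (e%:A : E1) = nu e := subfx_inj_base rh (monic_neq0 hm) e.
exists (baseFieldType E1), (subfx_inj : {rmorphism E1 -> L}); split=> [a|w].
  by rewrite baseField_scaleE -nuF; exact: inj_base.
rewrite inE => /predU1P[->|/nu_zs[e <-]]; last by exists (e%:A : E1); exact: inj_base.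
by exists (subfx_root nu z h); exact: (subfx_inj_root rh (monic_neq0 hm)).
Qed.

Lemma separable_over_nu (E : fieldExtType F) (nu : {rmorphism E -> L}) :
  (forall a, nu a%:A = iota a) ->
  forall e, separable_over iota (nu e) <-> separable_element 1%AS e.
Proof.
move=> nuF e; have iE (P : {poly F}) : map_poly iota P = map_poly nu (map_poly (in_alg E) P).
  by rewrite -map_poly_comp; apply: eq_map_poly => a /=; rewrite nuF.
split=> [[P [P0 sP rP]]|/separable_elementP[f [f1 rf sf]]].
  apply/separable_elementP; exists (map_poly (in_alg E) P); split.
  - by apply/polyOver1P; exists P.
  - by move: rP; rewrite iE fmorph_root.
  - by rewrite separable_map.
have /polyOver1P[P eP] := f1; exists P; split.
- by move: (separable_poly_neq0 sf); rewrite eP map_poly_eq0.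
- by rewrite -(separable_map (in_alg E)) -eP.
- by rewrite iE -eP fmorph_root.
Qed.

Lemma separable_subextension (zs : seq L) w : {in zs, forall z, separable_over iota z} ->
  algebraicOver iota w ->
  exists (E : fieldExtType F) (nu : {rmorphism E -> L}) (es : seq E) (e : E),
   [/\ (forall a, nu a%:A = iota a), map nu es = zs, nu e = w &
      separable 1%AS <<1%AS & es>>%AS].
Proof.
move=> sep_zs alg_w; have [|E [nu [nuF nu_pre]]] := @finite_subextension (w :: zs).
  by move=> z; rewrite inE => /predU1P[->|/sep_zs/separable_over_algebraic].
have [e ew] : exists e, nu e = w by apply: nu_pre; rewrite mem_head.
have [es es_zs] : exists es, map nu es = zs.
  have {}nu_pre : {in zs, forall z, exists e, nu e = z}.
    by move=> z z_zs; apply: nu_pre; rewrite inE z_zs orbT.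
  elim: zs nu_pre {sep_zs} => [|z zs IH] nu_pre; first by exists [::].
  have [e1 e1z] := nu_pre z (mem_head _ _).
  have [|es eszs] := IH; first by move=> u u_zs; apply: nu_pre; rewrite inE u_zs orbT.
  by exists (e1 :: es); rewrite /= e1z eszs.
exists E, nu, es, e; split=> //; apply: separable_Fadjoin_seq; apply/allP => e1 e1_es.
by apply/(separable_over_nu nuF)/sep_zs; rewrite -es_zs map_f.
Qed.

Lemma separable_over_im a : separable_over iota (iota a).
Proof.
exists ('X - a%:P); rewrite polyXsubC_eq0 rmorphB /= map_polyX map_polyC root_XsubC eqxx.
by split=> //; rewrite unlock !derivCE coprimep1.
Qed.

Fact separable_over_closed : divring_closed [pred x : L | `[< separable_over iota x >]].
Proof.
have pair x y : separable_over iota x -> separable_over iota y ->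
    separable_over iota (x - y) /\ separable_over iota (x / y).
  move=> sx sy; have [||E [nu [es [_ [nuF es_xy _ /separableP sep_es]]]]] :=
      @separable_subextension [:: x; y] (iota 0).
  - by move=> z; rewrite !inE => /orP[]/eqP->.
  - exact/separable_over_algebraic/separable_over_im.
  case: es es_xy sep_es => [|e1 [|e2 [|//]]] //= [<- <-] sep_es.
  have e1E : e1 \in <<1%AS & [:: e1; e2]>>%AS by apply: seqv_sub_adjoin; rewrite mem_head.
  have e2E : e2 \in <<1%AS & [:: e1; e2]>>%AS.
    by apply: seqv_sub_adjoin; rewrite !inE eqxx orbT.
  rewrite -rmorphB -fmorph_div; split; apply/(separable_over_nu nuF)/sep_es.
    exact: rpredB.
  exact: rpred_div.
split=> [|x y /asboolP sx /asboolP sy|x y /asboolP sx /asboolP sy]; apply/asboolP.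
- by rewrite -(rmorph1 iota); exact: separable_over_im.
- by case: (pair x y sx sy).
- by case: (pair x y sx sy).
Qed.

Definition sep_field : subfieldOf L := subfieldOf_field separable_over_closed.

Lemma sep_fieldP x : reflect (separable_over iota x) (x \in sep_field).
Proof. exact: asboolP. Qed.

Lemma sep_field_im a : iota a \in sep_field.
Proof. by apply/sep_fieldP; exact: separable_over_im. Qed.

Lemma simple_root_sep_field (P : {poly L}) x :
  P \is a polyOver sep_field -> root P x -> P^`().[x] != 0 -> x \in sep_field.
Proof.
move=> PS rP dP; have P0 : P != 0.
  by apply: contraNneq dP => ->; rewrite deriv0 horner0.
have sepP : {in P : seq L, forall z, separable_over iota z}.
  by move=> z /(nthP 0)[i _ <-]; apply/sep_fieldP; exact: (polyOverP PS).
have alg_x : algebraicOver iota x.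
  apply/integral_algebraic/(integral_root P0 rP) => z /sepP.
  by move/separable_over_algebraic/integral_algebraic.
have [E [nu [es [e [nuF es_P ex sep_es]]]]] := separable_subextension sepP alg_x.
have eP : map_poly nu (Poly es) = P.
  by rewrite -[P in RHS]polyseqK -es_P map_Poly_id0 ?rmorph0.
have PE : Poly es \is a polyOver <<1%AS & es>>%AS.
  apply/polyOverP => i; rewrite coef_Poly; have [hi|hi] := ltnP i (size es).
    by apply: seqv_sub_adjoin; exact: mem_nth.
  by rewrite nth_default // rpred0.
have sep_e : separable_element <<1%AS & es>>%AS e.
  have := separable_root_der <<1%AS & es>>%AS e; case: separable_element => //= r.
  have re : root (Poly es) e by rewrite -(fmorph_root nu) eP ex.
  have /dvdpP[q eq] := minPoly_dvdp PE re.
  case/eqP: dP; rewrite -eP -ex deriv_map horner_map eq derivM hornerD !hornerM.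
  by rewrite (rootP r) (rootP (root_minPoly _ _)) !mulr0 addr0 rmorph0.
apply/sep_fieldP; rewrite -ex; apply/(separable_over_nu nuF).
move: sep_e; rewrite adjoin_separable_eq => /(separable_trans sep_es)/separableP; apply.
exact: memv_adjoin.
Qed.

End SeparableElements.

(** * Relative Frobenius *)

Lemma natr_pchar_inv (R : comNzRingType) p (k : nat) : p \in [pchar R] -> ~~ (p %| k)%N ->
  exists u : R, k%:R * u = 1.
Proof.
move=> charR; have p_prime := pcharf_prime charR.
case: k => [|k]; first by rewrite dvdn0.
rewrite -prime_coprime // coprime_sym => cop; have [u v e _] := egcdnP p (ltn0Sn k).
exists u%:R; rewrite -natrM mulnC e (eqP cop) natrD natrM (pcharf0 charR) mulr0 add0r.
by [].
Qed.

Section RelativeFrobenius.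
Variables (R : comNzRingType) (p : nat).
Hypothesis charR : p \in [pchar R].
Let p_prime : prime p := pcharf_prime charR.
Let p_gt0 : (0 < p)%N := prime_gt0 p_prime.
Let sigma := pFrobenius_aut charR.
Let charRX : p \in [pchar {poly R}] := rmorph_pchar (@polyC R) charR.

Lemma prime_ndvd_ffact k : ~~ (p %| (p.-1 + k * p) ^_ p.-1)%N.
Proof.
rewrite ffact_prod; elim/big_ind: _ => [|x y hx hy|j _].
- by rewrite dvdn1 gtn_eqF // prime_gt1.
- by rewrite Euclid_dvdM // negb_or hx.
rewrite addnC -addnBA ?(ltnW (ltn_ord j)) // dvdn_addr ?dvdn_mull //.
rewrite gtnNdvd ?subn_gt0 //.
by rewrite -[X in (_ < X)%N](prednK p_gt0) ltnS leq_subr.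
Qed.

Lemma expr_pchar_poly (G : {poly R}) : G ^+ p = map_poly sigma G \Po 'X^p.
Proof.
elim/poly_ind: G => [|G c IH]; first by rewrite rmorph0 comp_poly0 expr0n gtn_eqF.
rewrite -(pFrobenius_autE charRX) rmorphD rmorphM /= !pFrobenius_autE IH.
rewrite rmorphD rmorphM /= map_polyX map_polyC comp_polyD comp_polyM comp_polyX comp_polyC.
by rewrite -polyC_exp.
Qed.

Lemma deriv_comp_Xp (G : {poly R}) : (G \Po 'X^p)^`() = 0.
Proof. by rewrite deriv_comp derivXn -mulr_natr (pcharf0 charRX) !mulr0. Qed.

Lemma deriv_exppM (G H : {poly R}) : (G ^+ p * H)^`() = G ^+ p * H^`().
Proof. by rewrite derivM expr_pchar_poly deriv_comp_Xp mul0r add0r. Qed.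

Lemma derivn_exppM n (G H : {poly R}) : (G ^+ p * H)^`(n) = G ^+ p * H^`(n).
Proof. by elim: n => [|n IH]; rewrite ?derivn0 // !derivnS IH deriv_exppM. Qed.

Lemma derivn_pchar (G : {poly R}) : G^`(p) = 0.
Proof.
apply/polyP => i; rewrite coef_derivn coef0 -mulr_natr.
suff /dvdnP[k ->] : (p %| (p + i) ^_ p)%N by rewrite natrM (pcharf0 charR) !mulr0.
by rewrite -bin_ffact dvdn_mull // dvdn_fact // p_gt0 leqnn.
Qed.

Lemma deriv_eq0_comp_Xp (G : {poly R}) : G^`() = 0 -> exists G0, G = G0 \Po 'X^p.
Proof.
move=> dG; exists (\poly_(i < size G) G`_(i * p)%N); apply/polyP => i.
rewrite coef_comp_poly_Xn //; case: ifP => [/dvdnP[k ->]|/negbT pi].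
  rewrite mulnK // coef_poly; case: ltnP => // hk; rewrite nth_default //.
  by apply: leq_trans hk _; rewrite leq_pmulr.
case: i pi => [|i] pi; first by rewrite dvdn0 in pi.
have := congr1 (fun P : {poly R} => P`_i) dG; rewrite coef_deriv coef0 -mulr_natr.
have [u e] := natr_pchar_inv charR pi; move=> /(congr1 (fun z => z * u)).
by rewrite -mulrA e mulr1 mul0r.
Qed.

Lemma comp_Xp_inj : injective (fun G : {poly R} => G \Po 'X^p).
Proof.
move=> G H e; apply/polyP => i; have := congr1 (fun P : {poly R} => P`_(i * p)%N) e.
by rewrite !coef_comp_poly_Xn // dvdn_mull // mulnK.
Qed.

Lemma exists_primitive (H : {poly R}) : H^`(p.-1) = 0 -> exists H1, H = H1^`().
Proof.
move=> dH; have inv k : exists u : R, ~~ (p %| k)%N -> k%:R * u = 1.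
  by case: (boolP (p %| k)%N) => [_|/(natr_pchar_inv charR)[u e]]; [exists 0 | exists u].
have [iv ivP] := choice inv.
exists (\poly_(i < (size H).+1) (H`_i.-1 * iv i)); apply/polyP => i.
rewrite coef_deriv coef_poly ltnS /=.
have [hi|hi] := ltnP i (size H); last by rewrite nth_default // mul0rn.
rewrite -mulr_natr -mulrA [_ * _%:R]mulrC.
have [/dvdnP[k e]|ni] := boolP (p %| i.+1)%N; last by rewrite ivP // mulr1.
suff -> : H`_i = 0 by rewrite mul0r.
case: k e => // k e.
have ei : i = (p.-1 + k * p)%N by apply: succn_inj; rewrite e -addSn prednK // mulSn.
have := congr1 (fun P : {poly R} => P`_(k * p)%N) dH.
rewrite coef_derivn coef0 -ei -mulr_natr.
have [|u eu] := @natr_pchar_inv _ p (i ^_ p.-1) charR; first by rewrite ei prime_ndvd_ffact.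
by move=> /(congr1 (fun z => z * u)); rewrite -mulrA eu mulr1 mul0r.
Qed.

Lemma derivn_exprM (j : nat) (f H : {poly R}) :
  exists S, (f ^+ j * H)^`(j) = (j`!)%:R * f^`() ^+ j * H + f * S.
Proof.
elim: j H => [|j IH] H; first by exists 0; rewrite derivn0 !mul1r mulr0 addr0.
have [S eS] := IH (j.+1%:R * f^`() * H + f * H^`()).
have dE : (f ^+ j.+1 * H)^`() = f ^+ j * (j.+1%:R * f^`() * H + f * H^`()).
  by rewrite derivM deriv_exp -mulr_natr /= exprS; ring.
exists ((j`!)%:R * f^`() ^+ j * H^`() + S).
by rewrite derivSn dE eS factS natrM [f^`() ^+ j.+1]exprS; ring.
Qed.

Variable f : {poly R}.
Hypothesis f_monic : f \is monic.
Let d := f^`() ^+ p.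
Let f_lreg n : GRing.lreg (f ^+ n) := lregX (monic_lreg f_monic).
Let dE : d = f^`() * f^`() ^+ p.-1. Proof. by rewrite -exprS prednK. Qed.

(* Differentiating d^j Q(X^p) = f^(j+1) w kills the left-hand side and yields f | f' w. *)
Lemma dvd_comp_Xp_expn (Q u : {poly R}) j : Q \Po 'X^p = f * u -> (j < p)%N ->
  exists w, d ^+ j * (Q \Po 'X^p) = f ^+ j.+1 * w.
Proof.
move=> eQ; elim: j => [|j IH] hj; first by exists u; rewrite expr0 mul1r expr1.
have [w ew] := IH (ltnW hj).
have [|v ev] := @natr_pchar_inv _ p j.+1 charRX; first by rewrite gtnNdvd.
have : f ^+ j * (f^`() * w * j.+1%:R) = f ^+ j * (- (f * w^`())).
  have := congr1 (fun P : {poly R} => P^`()) ew.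
  rewrite /d -exprM mulnC exprM deriv_exppM deriv_comp_Xp mulr0.
  rewrite derivM deriv_exp -mulr_natr /= => /esym/eqP; rewrite addr_eq0 => /eqP e.
  transitivity (f^`() * f ^+ j * j.+1%:R * w); first by ring.
  by rewrite e exprSr mulrN mulrA.
move/f_lreg => e; exists (f^`() ^+ p.-1 * (- w^`() * v)).
rewrite exprS -mulrA ew dE [f ^+ j.+2]exprSr.
transitivity (f ^+ j.+1 * f^`() ^+ p.-1 * (f^`() * w * j.+1%:R * v)).
  by rewrite -[f^`() * w * _ * v]mulrA ev; ring.
by rewrite e; ring.
Qed.

Lemma relative_Frobenius_inj (Q u : {poly R}) : Q \Po 'X^p = f * u ->
  exists V, map_poly sigma f^`() ^+ p.-1 * Q = map_poly sigma f * V.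
Proof.
move=> eQ; have [|w] := dvd_comp_Xp_expn (j := p.-1) eQ; first by rewrite prednK.
rewrite prednK // /d -exprM mulnC exprM => ew.
have /deriv_eq0_comp_Xp[V eV] : w^`() = 0.
  apply: (@f_lreg p); rewrite mulr0 -deriv_exppM -ew.
  by rewrite deriv_exppM deriv_comp_Xp mulr0.
exists V; apply: comp_Xp_inj.
by rewrite /= !comp_polyM -rmorphXn -!expr_pchar_poly ew eV.
Qed.

Lemma exists_deriv_dvd (G : {poly R}) k : (k < p)%N ->
  exists m W H, (d ^+ m * G + f * W)^`() = f ^+ k * H.
Proof.
elim: k => [|k IH] hk; first by exists 0%N, 0, G^`(); rewrite !expr0 !mul1r mulr0 addr0.
have [m [W [H e]]] := IH (ltnW hk).
have [|v ev] := @natr_pchar_inv _ p k.+1 charR; first by rewrite gtnNdvd.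
have ev' : (k.+1%:R : {poly R}) * v%:P = 1 by rewrite -polyC_natr -polyCM ev.
exists m.+1, (d * W - v%:P * f^`() ^+ p.-1 * f ^+ k * H).
exists (- v%:P * (f^`() ^+ p.-1 * H)^`()).
have -> : d ^+ m.+1 * G + f * (d * W - v%:P * f^`() ^+ p.-1 * f ^+ k * H) =
   d * (d ^+ m * G + f * W) - v%:P * (f ^+ k.+1 * (f^`() ^+ p.-1 * H)).
  by rewrite !exprS; ring.
rewrite derivB deriv_exppM e -/d [(v%:P * _)^`()]derivM derivC mul0r add0r.
rewrite [(f ^+ k.+1 * _)^`()]derivM [(f ^+ k.+1)^`()]deriv_exp -mulr_natr /= dE.
transitivity ((1 - k.+1%:R * v%:P) * (f^`() * f^`() ^+ p.-1 * f ^+ k * H) +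
   f ^+ k.+1 * (- v%:P * (f^`() ^+ p.-1 * H)^`())); first by ring.
by rewrite ev' subrr mul0r add0r.
Qed.

Lemma deriv_dvd_expp (G H : {poly R}) : G^`() = f ^+ p.-1 * H ->
  exists H1, (d * G)^`() = f ^+ p * H1.
Proof.
move=> dG; have [S eS] := derivn_exprM p.-1 f H.
have [|v ev] := @natr_pchar_inv _ p (p.-1)`! charRX.
  by rewrite -ffactnn -[X in (X ^_ _)%N]addn0 -(mul0n p) prime_ndvd_ffact.
exists (f^`() * (- S * v)); rewrite deriv_exppM dG -/d dE.
have {1}-> : f^`() ^+ p.-1 = f^`() ^+ p.-1 * ((p.-1)`!%:R * v) by rewrite ev mulr1.
have fH : (p.-1)`!%:R * f^`() ^+ p.-1 * H = - (f * S).
  by apply/eqP; rewrite -addr_eq0 -eS -dG -derivSn prednK // derivn_pchar.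
transitivity (f ^+ p.-1 * f^`() * v * ((p.-1)`!%:R * f^`() ^+ p.-1 * H)); first by ring.
by rewrite fH -[in RHS](prednK p_gt0) exprS; ring.
Qed.

Lemma deriv_dvd_comp_Xp (G H : {poly R}) : G^`() = f ^+ p * H ->
  exists U W, G = U \Po 'X^p + f ^+ p * W.
Proof.
move=> dG; have [|W eW] := @exists_primitive H.
  apply: (@f_lreg p); rewrite mulr0 -derivn_exppM -dG -derivSn prednK //.
  exact: derivn_pchar.
have [|U eU] := @deriv_eq0_comp_Xp (G - f ^+ p * W).
  by rewrite derivB deriv_exppM dG -eW subrr.
by exists U, W; rewrite -eU subrK.
Qed.

Lemma relative_Frobenius_surj (G : {poly R}) :
  exists k U W, G * f^`() ^+ (p * k) = U \Po 'X^p + f * W.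
Proof.
have [|m [W [H e]]] := @exists_deriv_dvd G p.-1; first by rewrite prednK.
have [H1 /deriv_dvd_comp_Xp[U [V eV]]] := deriv_dvd_expp e.
exists m.+1, U, (f ^+ p.-1 * V - d * W); rewrite exprM -/d.
have -> : G * d ^+ m.+1 = d * (d ^+ m * G + f * W) - f * (d * W).
  by rewrite exprS; ring.
have fpE : f ^+ p = f * f ^+ p.-1 by rewrite -exprS prednK.
by rewrite eV fpE; ring.
Qed.

Lemma Frobenius_descent (a : R) (g P G H u qg qP : {poly R}) :
  a%:P * g ^+ p - P ^+ p = f * u ->
  f^`() ^+ p.-1 * g = qg * f + G -> (size G < size f)%N ->
  f^`() ^+ p.-1 * P = qP * f + H -> (size H < size f)%N ->
  forall i, a * G`_i ^+ p = H`_i ^+ p.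
Proof.
move=> e eG sG eH sH i; pose fs := map_poly sigma f.
have [|V eV] := @relative_Frobenius_inj (a%:P * map_poly sigma g - map_poly sigma P) u.
  by rewrite comp_polyB comp_polyM comp_polyC -!expr_pchar_poly.
have sigma_eq (Q q T : {poly R}) : f^`() ^+ p.-1 * Q = q * f + T ->
    map_poly sigma f^`() ^+ p.-1 * map_poly sigma Q = map_poly sigma q * fs + map_poly sigma T.
  by move/(congr1 (map_poly sigma)); rewrite rmorphM rmorphXn rmorphD rmorphM.
pose D := a%:P * map_poly sigma G - map_poly sigma H.
pose W := V - a%:P * map_poly sigma qg + map_poly sigma qP.
have eD : D = fs * W.
  transitivity (map_poly sigma f^`() ^+ p.-1 * (a%:P * map_poly sigma g - map_poly sigma P) -
      fs * (a%:P * map_poly sigma qg - map_poly sigma qP)); last by rewrite eV /W /fs; ring.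
  rewrite [in RHS]mulrBr mulrCA (sigma_eq _ _ _ eG) (sigma_eq _ _ _ eH) /D; ring.
have fs_monic : fs \is monic by exact: monic_map.
have size_fs : size fs = size f.
  by apply: size_map_poly_id0; rewrite (monicP f_monic) /sigma pFrobenius_autE expr1n oner_neq0.
have sD : (size D < size fs)%N.
  have map_lt (T : {poly R}) : (size T < size f)%N -> (size (map_poly sigma T) < size f)%N.
    exact: leq_ltn_trans (size_poly _ _).
  rewrite size_fs (leq_ltn_trans (size_polyD _ _)) // size_polyN gtn_max mul_polyC.
  by rewrite (leq_ltn_trans (size_scale_leq _ _)) map_lt.
have W0 : W = 0.
  apply/eqP; apply: contraLR sD => W0; rewrite eD size_monicM // -leqNgt.
  by rewrite -(prednK (n := size W)) ?size_poly_gt0 // addnS leq_addr.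
have := congr1 (fun Q : {poly R} => Q`_i) eD; rewrite W0 mulr0 coef0 coefB coefCM !coef_map.
by move/eqP; rewrite subr_eq0 => /eqP.
Qed.

End RelativeFrobenius.

Section FrobeniusDescentModulo.
Variables (A R : comNzRingType) (red : {rmorphism A -> R}) (p : nat).
Hypothesis charR : p \in [pchar R].
Variable f : {poly A}.
Hypothesis f_monic : f \is monic.

Definition Frobenius_mod (g : {poly A}) := Pdiv.Ring.rmodp (f^`() ^+ p.-1 * g) f.

Lemma Frobenius_modE (g : {poly A}) :
  f^`() ^+ p.-1 * g = Pdiv.Ring.rdivp (f^`() ^+ p.-1 * g) f * f + Frobenius_mod g.
Proof. exact: Pdiv.RingMonic.rdivp_eq. Qed.

Lemma Frobenius_descent_mod (a s : A) (g P Q U : {poly A}) : red s = 0 ->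
  a%:P * g ^+ p - P ^+ p - s%:P * U = Q * f ->
  forall i, red (a * (Frobenius_mod g)`_i ^+ p - (Frobenius_mod P)`_i ^+ p) = 0.
Proof.
move=> s0 e i; rewrite rmorphB rmorphM !rmorphXn -!(coef_map red); apply/eqP.
have size_red_f : size (map_poly red f) = size f.
  by apply: size_map_poly_id0; rewrite (monicP f_monic) rmorph1 oner_neq0.
have size_red_mod T : (size (map_poly red (Frobenius_mod T)) < size (map_poly red f))%N.
  rewrite size_red_f (leq_ltn_trans (size_poly _ _)) //.
  by rewrite Pdiv.Ring.ltn_rmodpN0 ?monic_neq0.
have red_mod T : (map_poly red f)^`() ^+ p.-1 * map_poly red T =
    map_poly red (Pdiv.Ring.rdivp (f^`() ^+ p.-1 * T) f) * map_poly red f +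
    map_poly red (Frobenius_mod T).
  by rewrite deriv_map -rmorphXn -!rmorphM -rmorphD -Frobenius_modE.
rewrite subr_eq0; apply/eqP; apply: (Frobenius_descent charR (monic_map red f_monic)
  (u := map_poly red Q) _ (red_mod g) (size_red_mod g) (red_mod P) (size_red_mod P)).
have := congr1 (map_poly red) e; rewrite !rmorphB !rmorphM !rmorphXn /= !map_polyC /=.
by rewrite s0 polyC0 mul0r subr0 => ->; exact: mulrC.
Qed.

End FrobeniusDescentModulo.

(** * Completion of a valued field *)

Definition nonzero (F : fieldType) := {c : F | c != 0}.
HB.instance Definition _ (F : fieldType) := SubChoice.on (nonzero F).
HB.instance Definition _ (F : fieldType) :=
  isPointed.Build (nonzero F) (exist _ 1 (oner_neq0 F)).

(* The completion is the quotient of the ring of Cauchy nets, indexed by the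
   nonzero elements of F ordered by value, by the ideal of null nets. *)
Section Completion.
Local Open Scope quotient_scope.
Variables (F : fieldType) (O : vring F).
Local Notation "x <=v y" := (lev O x y).
Local Notation "x <v y" := (ltv O x y).
Local Notation "x =v y" := (eqv O x y).
Implicit Types P Q : nonzero F -> Prop.

Definition eventually P := exists d : nonzero F, forall e : nonzero F, val d <=v val e -> P e.

Lemma eventually_sub P Q : (forall e, P e -> Q e) -> eventually P -> eventually Q.
Proof. by move=> h [d hd]; exists d => e /hd/h. Qed.
Lemma eventually_and P Q : eventually P -> eventually Q -> eventually (fun e => P e /\ Q e).
Proof.
move=> [d hd] [d' hd'].
exists (exist _ (maxv O (val d) (val d')) (maxv_neq0 O (valP d) (valP d'))) => e he.
by split; [apply: hd | apply: hd']; apply: lev_trans he; [exact: lev_maxl | exact: lev_maxr].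
Qed.
Lemma eventually_ex P : eventually P -> exists e, P e.
Proof. by move=> [d hd]; exists d; apply: hd. Qed.
Lemma eventuallyT P : (forall e, P e) -> eventually P.
Proof. by move=> h; exists point. Qed.

Definition cauchy_net (f : nonzero F -> F) := forall c, c != 0 ->
  exists a, eventually (fun e => c <v f e - a).
Definition null_net (f : nonzero F -> F) := forall c, c != 0 -> eventually (fun e => c <v f e).

Lemma cauchy_net_bounded f :
  cauchy_net f -> exists2 b, b != 0 & eventually (fun e => b <=v f e).
Proof.
move=> /(_ 1 (oner_neq0 F))[a ha].
have [h|h] := orP (lev_total O 1 a).
  exists 1; first exact: oner_neq0.
  by apply: eventually_sub ha => e /ltvW h'; rewrite -(subrK a (f e)) levD.
exists a; first by apply: contraTneq h => ->; rewrite lev0r oner_neq0.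
by apply: eventually_sub ha => e /ltvW /(lev_trans h) h'; rewrite -(subrK a (f e)) levD.
Qed.

Lemma cauchy_net_cst a : cauchy_net (fun _ => a).
Proof. by move=> c c0; exists a; apply: eventuallyT => e; rewrite subrr ltvr0. Qed.

Lemma cauchy_netB f g : cauchy_net f -> cauchy_net g -> cauchy_net (f - g).
Proof.
move=> hf hg c c0; have [a ha] := hf c c0; have [b hb] := hg c c0; exists (a - b).
apply: eventually_sub (eventually_and ha hb) => e [fa gb].
have -> : (f - g) e - (a - b) = (f e - a) - (g e - b) by rewrite -[(f - g) e]/(f e - g e); ring.
exact: ltvB.
Qed.

Lemma cauchy_netM f g : cauchy_net f -> cauchy_net g -> cauchy_net (f * g).
Proof.
move=> hf hg c c0.
have [bf bf0 hbf] := cauchy_net_bounded hf; have [bg bg0 hbg] := cauchy_net_bounded hg.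
have [a ha] := hf (c / bg) (mulf_neq0 c0 (invr_neq0 bg0)).
have [b hb] := hg (c / bf) (mulf_neq0 c0 (invr_neq0 bf0)).
have near := eventually_and (eventually_and ha hb) (eventually_and hbf hbg).
have [e0 [[fa0 gb0] [f0 g0]]] := eventually_ex near.
exists (f e0 * g e0); apply: eventually_sub near => e [[fa gb] [_ ge]].
have -> : (f * g) e - f e0 * g e0 =
    ((f e - a) - (f e0 - a)) * g e + ((g e - b) - (g e0 - b)) * f e0.
  by rewrite -[(f * g) e]/(f e * g e); ring.
apply: ltvD; [rewrite -(divfK bg0 c)|rewrite -(divfK bf0 c)];
  by apply: ltv_leM => //; apply: ltvB.
Qed.

Lemma null_net0 : null_net 0.
Proof. by move=> c c0; apply: eventuallyT => e; rewrite ltvr0. Qed.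
Lemma null_netB f g : null_net f -> null_net g -> null_net (f - g).
Proof.
move=> hf hg c c0; apply: eventually_sub (eventually_and (hf c c0) (hg c c0)) => e [? ?].
exact: ltvB.
Qed.
Lemma null_netM f g : cauchy_net f -> null_net g -> null_net (f * g).
Proof.
move=> hf hg c c0; have [b b0 hb] := cauchy_net_bounded hf.
have {}hg := hg (c / b) (mulf_neq0 c0 (invr_neq0 b0)).
apply: eventually_sub (eventually_and hb hg) => e [fe ge].
by rewrite -(divfK b0 c) mulrC -[(f * g) e]/(f e * g e); exact: lev_ltM.
Qed.

Lemma nonnull_net_value f : cauchy_net f -> ~ null_net f ->
  exists2 a, a != 0 & eventually (fun e => a <v f e - a).
Proof.
move=> cf nf; have [c [c0 hc]] : exists c, c != 0 /\ ~ eventually (fun e => c <v f e).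
  apply: contrapT => h; apply: nf => c c0; apply: contrapT => hc; apply: h.
  by exists c.
have [a ha] := cf c c0; have ac : a <=v c.
  rewrite levNgt; apply/negP => h; apply: hc; apply: eventually_sub ha => e h'.
  by rewrite -(subrK a (f e)) ltvD.
exists a; first by apply: contraTneq ac => ->; rewrite lev0r.
by apply: eventually_sub ha => e; apply: lev_lt_trans.
Qed.

Definition net_pred : {pred nonzero F -> F} := fun f => `[< cauchy_net f >].
Fact net_closed : subring_closed net_pred.
Proof.
split=> [|f g|f g]; first exact/asboolP/cauchy_net_cst.
  by move=> /asboolP ? /asboolP ?; apply/asboolP/cauchy_netB.
by move=> /asboolP ? /asboolP ?; apply/asboolP/cauchy_netM.
Qed.
HB.instance Definition _ := GRing.isSubringClosed.Build (nonzero F -> F) net_pred net_closed.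
Definition net := {f : nonzero F -> F | f \in net_pred}.
HB.instance Definition _ := SubChoice.on net.
HB.instance Definition _ := [SubChoice_isSubComNzRing of net by <:].

Lemma netP (f : net) : cauchy_net (val f). Proof. exact/asboolP/(valP f). Qed.
Definition mk_net f (cf : cauchy_net f) : net := exist _ f (asboolT cf).

Definition null_ideal : {pred net} := fun f => `[< null_net (val f) >].
Fact null_ideal_closed : idealr_closed null_ideal.
Proof.
split.
- by apply/asboolP; rewrite rmorph0; exact: null_net0.
- apply/asboolPn => /(_ 1 (oner_neq0 F))/eventually_ex[e].
  by rewrite rmorph1 -[(1 : nonzero F -> F) e]/1 ltvv.
move=> a u v /asboolP hu /asboolP hv; apply/asboolP; rewrite rmorphD rmorphM /=.
rewrite -[val v]opprK; apply: null_netB; first exact: null_netM (netP a) hu.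
by rewrite -sub0r; apply: null_netB => //; exact: null_net0.
Qed.
HB.instance Definition _ := isIdealr.Build net null_ideal null_ideal_closed.

Definition completion := {ideal_quot null_ideal}.
HB.instance Definition _ := GRing.ComNzRing.on completion.

Definition net_lim : {rmorphism net -> completion} := \pi_{ideal_quot null_ideal}.

Lemma net_limP x : exists f, x = net_lim f.
Proof. by exists (repr x); rewrite /net_lim /= reprK. Qed.
Lemma net_lim_eq f g : net_lim f = net_lim g <-> null_net (val (f - g)).
Proof.
split=> [/eqP|h]; first by rewrite -Quotient.idealrBE => /asboolP.
by apply/eqP; rewrite -Quotient.idealrBE; apply/asboolP.
Qed.
Lemma net_lim_value f : net_lim f != 0 ->
  exists2 a, a != 0 & eventually (fun e => a <v val f e - a).
Proof.
move=> f0; apply: nonnull_net_value (netP f) _; apply: contra_neq_not f0 => nf.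
by rewrite -(rmorph0 net_lim); apply/net_lim_eq; rewrite subr0.
Qed.

Lemma net_lim_inv f : net_lim f != 0 ->
  exists2 g : net, (forall e, val g e = (val f e)^-1) & net_lim g * net_lim f = 1.
Proof.
case/net_lim_value => a a0 ha; pose g e := (val f e)^-1.
have {}ha : eventually (fun e => a =v val f e) by apply: eventually_sub ha => e /eqv_subr.
have cg : cauchy_net g.
  move=> c c0; have [b hb] := netP f (mulf_neq0 c0 (mulf_neq0 a0 a0)).
  have near := eventually_and ha hb; have [e0 [ae0 be0]] := eventually_ex near.
  exists (g e0); apply: eventually_sub near => e [ae be].
  have fe_neq0 : val f e != 0 by rewrite -(eqv_eq0 ae).
  have fe0_neq0 : val f e0 != 0 by rewrite -(eqv_eq0 ae0).
  have -> : g e - g e0 = ((val f e0 - b) - (val f e - b)) / (val f e * val f e0).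
    by rewrite /g; field; rewrite fe_neq0 fe0_neq0.
  rewrite -(mulfK (mulf_neq0 a0 a0) c); apply: ltv_leM; last by apply/eqv_le/eqvV/eqvM.
    by rewrite invr_eq0 mulf_neq0.
  exact: ltvB.
exists (mk_net cg) => //; rewrite -rmorphM -(rmorph1 net_lim); apply/net_lim_eq => c c0.
apply: eventually_sub ha => e ae; have fe_neq0 : val f e != 0 by rewrite -(eqv_eq0 ae).
have -> : val (mk_net cg * f - 1) e = g e * val f e - 1 by [].
by rewrite mulVf // subrr ltvr0.
Qed.

Lemma completion_inv_ex (x : completion) :
  exists y : completion, (x != 0 -> y * x = 1) /\ (x = 0 -> y = 0).
Proof.
have [->|x0] := eqVneq x 0; first by exists 0; split.
have [f ef] := net_limP x; have [|g _ gf] := @net_lim_inv f; first by rewrite -ef.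
by exists (net_lim g); split=> [_|e]; [rewrite ef | rewrite e eqxx in x0].
Qed.

Definition completion_inv (x : completion) : completion := sval (cid (completion_inv_ex x)).
Fact completion_mulVf x : x != 0 -> completion_inv x * x = 1.
Proof. by move=> x0; case: (svalP (cid (completion_inv_ex x))) => + _; apply. Qed.
Fact completion_inv0 : completion_inv 0 = 0.
Proof. by case: (svalP (cid (completion_inv_ex 0))) => _; apply. Qed.
HB.instance Definition _ :=
  GRing.ComNzRing_isField.Build completion completion_mulVf completion_inv0.

Definition to_completion (a : F) : completion := net_lim (mk_net (cauchy_net_cst a)).
Fact to_completion_zmod : zmod_morphism to_completion.
Proof. by move=> a b; rewrite /to_completion -rmorphB; congr (net_lim _); apply/val_inj/funext. Qed.
Fact to_completion_monoid : monoid_morphism to_completion.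
Proof.
split; first by rewrite -(rmorph1 net_lim); congr (net_lim _); apply/val_inj/funext.
by move=> a b; rewrite /to_completion -rmorphM; congr (net_lim _); apply/val_inj/funext.
Qed.
HB.instance Definition _ :=
  GRing.isZmodMorphism.Build F completion to_completion to_completion_zmod.
HB.instance Definition _ :=
  GRing.isMonoidMorphism.Build F completion to_completion to_completion_monoid.

Definition completion_ring (x : completion) :=
  exists2 f, x = net_lim f & eventually (fun e => 1 <=v val f e).

Lemma completion_ring_lim f :
  completion_ring (net_lim f) <-> eventually (fun e => 1 <=v val f e).
Proof.
split=> [[g /net_lim_eq fg hg]|]; last by exists f.
apply: eventually_sub (eventually_and hg (fg 1 (oner_neq0 F))) => e [ge /ltvW fge].
have -> : val f e = (val (f - g) e) + val g e.
  by rewrite -[val (f - g) e]/(val f e - val g e) subrK.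
exact: levD.
Qed.

Fact completion_valuation_ring : valuation_ring completion_ring.
Proof.
split.
- by rewrite -(rmorph0 net_lim); apply/completion_ring_lim/eventuallyT => e; exact: levr0.
- by rewrite -(rmorph1 net_lim); apply/completion_ring_lim/eventuallyT => e; exact: lev_refl.
- move=> _ _ [f -> hf] [g -> hg]; rewrite -rmorphB; apply/completion_ring_lim.
  by apply: eventually_sub (eventually_and hf hg) => e [? ?]; exact: levB.
- move=> _ _ [f -> hf] [g -> hg]; rewrite -rmorphM; apply/completion_ring_lim.
  by apply: eventually_sub (eventually_and hf hg) => e [? ?]; exact: lev1M.
move=> x; have [f ->] := net_limP x => f0; have [a a0 ha] := net_lim_value f0.
have {}ha : eventually (fun e => a =v val f e) by apply: eventually_sub ha => e /eqv_subr.
have [h|h] := orP (lev_total O 1 a); [left | right].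
  by apply/completion_ring_lim; apply: eventually_sub ha => e /eqv_le; apply: lev_trans.
have [g gE gf] := net_lim_inv f0.
have -> : (net_lim f)^-1 = net_lim g by apply: (mulIf f0); rewrite mulVf.
apply/completion_ring_lim; apply: eventually_sub ha => e ae; rewrite gE.
have fe_neq0 : val f e != 0 by rewrite -(eqv_eq0 ae).
by rewrite -[1]invr1 lev_pV2 ?oner_neq0 // -(eqv_lel _ ae).
Qed.
Definition completion_vring : vring completion := VRing completion_valuation_ring.

Lemma completion_ring_val a : completion_ring (to_completion a) <-> O a.
Proof.
by rewrite completion_ring_lim -lev1; split=> [/eventually_ex[]//|h]; exact: eventuallyT.
Qed.

Lemma lev_to_completion a b :
  lev completion_vring (to_completion a) (to_completion b) = (a <=v b).
Proof. exact: (lev_morph (i := to_completion) (OE := completion_vring) completion_ring_val). Qed.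

Lemma ltv_to_completion_lim a f : a != 0 -> eventually (fun e => a <v val f e) ->
  ltv completion_vring (to_completion a) (net_lim f).
Proof.
move=> a0 hf; apply/negP => /levP[_ [g -> hg]]; rewrite -rmorphM => /net_lim_eq/(_ a a0) h.
have [e [[fe ge] afge]] := eventually_ex (eventually_and (eventually_and hf hg) h).
have : a <v val f e * val g e by apply: ltvMr.
rewrite -[val _ e]/(a - val f e * val g e) in afge.
by rewrite -(eqv_ltr _ (eqv_subl afge)) ltvv.
Qed.

Lemma completion_value (x : completion) : x != 0 ->
  exists2 a, a != 0 & eqv completion_vring (to_completion a) x.
Proof.
have [f ->] := net_limP x => /net_lim_value[a a0 ha]; exists a => //; apply: eqv_subr.
by rewrite -rmorphB; exact: ltv_to_completion_lim.
Qed.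

Lemma completion_dense (x c : completion) : c != 0 ->
  exists s, ltv completion_vring c (x - to_completion s).
Proof.
move=> c0; have [a a0 ha] := completion_value c0; have [f ef] := net_limP x.
have [s hs] := netP f a0; exists s; rewrite -(eqv_ltl _ ha) ef -rmorphB.
exact: ltv_to_completion_lim.
Qed.

Lemma completion_complete : vcomplete completion_ring.
Proof.
move=> Fl [FT F0 FI FS] Fc; have inhabited A : Fl A -> exists y, A y.
  by move=> FA; apply: contrapT => h; apply: F0; apply: FS FA => y Ay; apply: h; exists y.
have approx (a : nonzero F) :
    exists s, Fl (fun y => ltv completion_vring (to_completion (val a)) (y - to_completion s)).
  have a0 : to_completion (val a) != 0 by rewrite fmorph_eq0; exact: (valP a).
  have [A [FA hA]] := Fc _ a0; have [x Ax] := inhabited A FA.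
  have [s hs] := completion_dense x a0; exists s; apply: FS FA => y Ay.
  have -> : y - to_completion s = (y - x) + (x - to_completion s) by ring.
  by apply: ltvD => //; apply/(vltP completion_vring)/hA.
have [s hs] := choice approx.
have s_near (c e : nonzero F) : val c <=v val e -> val c <v s e - s c.
  move=> ce; have [y [yc ye]] := inhabited _ (FI _ _ (hs c) (hs e)).
  rewrite /ltv -lev_to_completion -/(ltv _ _ _) rmorphB.
  have -> : to_completion (s e) - to_completion (s c) =
      (y - to_completion (s c)) - (y - to_completion (s e)) by ring.
  by apply: ltvB => //; apply: lev_lt_trans ye; rewrite lev_to_completion.
have cs : cauchy_net s.
  by move=> c c0; exists (s (exist _ c c0)); exists (exist _ c c0) => e; apply: s_near.
exists (net_lim (mk_net cs)) => c c0; have [a a0 ha] := completion_value c0.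
pose a' : nonzero F := exist _ a a0.
apply: FS (hs a') => y hy; apply/(vltP completion_vring); rewrite -(eqv_ltl _ ha).
set l := net_lim _.
have -> : y - l = (y - to_completion (s a')) - (l - to_completion (s a')) by ring.
apply: ltvB => //; rewrite -rmorphB; apply: ltv_to_completion_lim => //.
by exists a' => e; apply: s_near.
Qed.

End Completion.

(** * Conditions on a valued subfield *)

Section NearPowers.
Variables (F : fieldType) (O : vring F) (p : nat).
Local Notation "x <=v y" := (lev O x y).
Local Notation "x <v y" := (ltv O x y).
Local Notation "x =v y" := (eqv O x y).
Implicit Types x y c : F.

(* Membership in the ideal p O + c M, where M is the maximal ideal of O. For
   p = 0 in F, these ideals form a base of neighbourhoods of 0. *)
Definition negligible c x := (p%:R <=v x) || (c <v x).

Lemma negligible_le c x y : x <=v y -> negligible c x -> negligible c y.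
Proof.
move=> xy /orP[h|h]; first by rewrite /negligible (lev_trans h xy).
by rewrite /negligible (ltv_le_trans h xy) orbT.
Qed.
Lemma negligible_lel c c' x : c <=v c' -> negligible c' x -> negligible c x.
Proof. by move=> cc' /orP[h|h]; rewrite /negligible ?h // (lev_lt_trans cc' h) orbT. Qed.
Lemma negligible0 c : negligible c 0. Proof. by rewrite /negligible levr0. Qed.
Lemma negligible_lep c x : p%:R <=v x -> negligible c x.
Proof. by rewrite /negligible => ->. Qed.
Lemma negligible_ltv c x : c <v x -> negligible c x.
Proof. by rewrite /negligible => ->; rewrite orbT. Qed.
Lemma negligibleD c x y : negligible c x -> negligible c y -> negligible c (x + y).
Proof.
move=> hx hy; have [h|h] := orP (lev_total O x y).
  by apply: negligible_le hx; apply: levD.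
by apply: negligible_le hy; apply: levD.
Qed.
Lemma negligibleN c x : negligible c (- x) = negligible c x.
Proof. by rewrite /negligible levN ltvN. Qed.
Lemma negligibleB c x y : negligible c x -> negligible c y -> negligible c (x - y).
Proof. by move=> hx hy; apply: negligibleD; rewrite ?negligibleN. Qed.
Lemma negligibleMr c x y : 1 <=v y -> negligible c x -> negligible c (x * y).
Proof. by move=> h; apply: negligible_le; apply: levMr. Qed.
Lemma negligible_sum c (I : Type) (r : seq I) (P : pred I) (G : I -> F) :
  (forall i, P i -> negligible c (G i)) -> negligible c (\sum_(i <- r | P i) G i).
Proof.
by move=> h; elim/big_ind: _ => // [|x y]; [exact: negligible0 | exact: negligibleD].
Qed.
Lemma negligible_lev1 c x : 1 <=v c -> negligible c x -> 1 <=v x.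
Proof.
by move=> c1 /orP[|/ltvW]; [exact/lev_trans/lev1_nat | exact: lev_trans].
Qed.

Definition near_pth (T : {pred F}) c x := exists2 y, y \in T & negligible c (x - y ^+ p).

(* For p the residue characteristic, this is the surjectivity of the p-th power
   map modulo p on the completion of S. *)
Definition frob_surj (S : {pred F}) := forall c a,
  c \in S -> c != 0 -> 1 <=v c -> a \in S -> 1 <=v a -> near_pth S c a.

Definition vgroup_pdiv (S : {pred F}) :=
  forall x, x \in S -> x != 0 -> exists2 y, y \in S & x =v y ^+ p.

Definition vp_not_min (S : {pred F}) :=
  p%:R = 0 :> F \/ exists2 x, x \in S & (1 <v x) && (x <v p%:R).

Section NearPowersField.
Variables (T : subfieldOf F) (c : F).
Hypotheses (p_prime : prime p) (c1 : 1 <=v c).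
Let p_gt0 := prime_gt0 p_prime.
Local Notation near := (near_pth T c).

Lemma near_pth_lev1 x y : 1 <=v x -> negligible c (x - y ^+ p) -> 1 <=v y.
Proof.
move=> hx /(negligible_lev1 c1) h.
by rewrite -(lev_pX2r _ _ _ p_gt0) expr1n -[y ^+ p](subKr x) levB.
Qed.

Lemma near_pth_exp y : y \in T -> near (y ^+ p).
Proof. by move=> yT; exists y => //; rewrite subrr negligible0. Qed.
Lemma near_pth_close x x' : negligible c (x - x') -> near x -> near x'.
Proof.
move=> h [y yT hy]; exists y => //.
have -> : x' - y ^+ p = (x - y ^+ p) - (x - x') by ring.
exact: negligibleB.
Qed.
Lemma near_pth0 : near 0.
Proof. by exists 0; rewrite ?rpred0 // expr0n gtn_eqF // subrr negligible0. Qed.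
Lemma near_pthD x x' : 1 <=v x -> 1 <=v x' -> near x -> near x' -> near (x + x').
Proof.
move=> hx hx' [y yT hy] [y' yT' hy']; exists (y + y'); first exact: rpredD.
have -> : x + x' - (y + y') ^+ p = (x - y ^+ p) + (x' - y' ^+ p) -
   ((y + y') ^+ p - (y ^+ p + y' ^+ p)) by ring.
apply: negligibleB; first exact: negligibleD.
by apply/negligible_lep/lev_exprDp; [|exact: near_pth_lev1 hy|exact: near_pth_lev1 hy'].
Qed.
Lemma near_pthM x x' : 1 <=v x -> 1 <=v x' -> near x -> near x' -> near (x * x').
Proof.
move=> hx hx' [y yT hy] [y' yT' hy']; exists (y * y'); first exact: rpredM.
have -> : x * x' - (y * y') ^+ p = (x - y ^+ p) * x' + (x' - y' ^+ p) * y ^+ p.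
  by rewrite exprMn; ring.
apply: negligibleD; apply: negligibleMr => //.
by apply: lev1X; exact: near_pth_lev1 hy.
Qed.
Lemma near_pth_div_exp x u : u \in T -> 1 =v u -> near x -> near (x / u ^+ p).
Proof.
move=> uT hu [y yT hy]; exists (y / u); first by rewrite rpred_div.
have -> : x / u ^+ p - (y / u) ^+ p = (x - y ^+ p) * (u ^- p) by rewrite expr_div_n; ring.
by apply: negligibleMr => //; exact/eqv_le/eqv1V/eqv1X.
Qed.
Lemma near_pth_sum (J : Type) (r : seq J) (G : J -> F) : (forall i, 1 <=v G i) ->
  (forall i, near (G i)) -> near (\sum_(i <- r) G i).
Proof.
move=> G1 nearG; suff : 1 <=v \sum_(i <- r) G i /\ near (\sum_(i <- r) G i) by case.
elim/big_ind: _ => // [|x y [hx px] [hy py]]; first by split; [exact: levr0 | exact: near_pth0].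
by split; [exact: levD | exact: near_pthD].
Qed.
Lemma near_pthX n x : 1 <=v x -> near x -> near (x ^+ n).
Proof.
move=> hx px; elim: n => [|n IH]; last by rewrite exprS; apply: near_pthM => //; exact: lev1X.
by rewrite expr0 -(expr1n _ p); apply: near_pth_exp; exact: rpred1.
Qed.

End NearPowersField.
End NearPowers.

Section ValuedMorphismConditions.
Variables (F E : fieldType) (O : vring F) (OE : vring E) (i : {rmorphism F -> E}) (p : nat).
Hypothesis ringE : forall a, OE (i a) <-> O a.
Variable S : {pred E}.
Hypothesis imE : forall x, x \in S <-> exists a, x = i a.
Let lev_i := lev_morph ringE.
Let ltv_i := ltv_morph ringE.
Let eqv_i := eqv_morph ringE.
Let iS a : i a \in S. Proof. by apply/imE; exists a. Qed.

Lemma negligible_morph c x : negligible OE p (i c) (i x) = negligible O p c x.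
Proof. by rewrite /negligible -(rmorph_nat i) lev_i ltv_i. Qed.

Lemma frob_surj_morph : frob_surj OE p S <-> frob_surj O p predT.
Proof.
split=> h c a.
  move=> _ c0 c1 _ a1; have [||| b /imE[b' ->] hb] := h (i c) (i a) (iS c) _ _ (iS a).
  - by rewrite fmorph_eq0.
  - by rewrite -(rmorph1 i) lev_i.
  - by rewrite -(rmorph1 i) lev_i.
  by exists b' => //; rewrite -negligible_morph rmorphB rmorphXn.
move=> /imE[c' ->] + + /imE[a' ->]; rewrite fmorph_eq0 -(rmorph1 i) !lev_i => c0 c1 a1.
have [b _ hb] := h c' a' isT c0 c1 isT a1.
by exists (i b) => //; rewrite -rmorphXn -rmorphB negligible_morph.
Qed.

Lemma vp_not_min_morph : vp_not_min OE p S <-> vp_not_min O p predT.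
Proof.
split=> -[e|[x xS hx]].
- by left; apply/eqP; rewrite -(fmorph_eq0 i) rmorph_nat e.
- move: xS hx => /imE[a ->]; rewrite -(rmorph_nat i) -(rmorph1 i) !ltv_i.
  by right; exists a.
- by left; rewrite -(rmorph_nat i) e rmorph0.
by right; exists (i x) => //; rewrite -(rmorph_nat i) -(rmorph1 i) !ltv_i.
Qed.

Lemma vgroup_pdiv_morph : vgroup_pdiv OE p S <-> vgroup_pdiv O p predT.
Proof.
split=> h x.
  move=> _ x0; have [|y /imE[b ->]] := h (i x) (iS x); first by rewrite fmorph_eq0.
  by rewrite -rmorphXn eqv_i; exists b.
move=> /imE[a ->]; rewrite fmorph_eq0 => a0; have [b _ hb] := h a isT a0.
by exists (i b) => //; rewrite -rmorphXn eqv_i.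
Qed.

End ValuedMorphismConditions.

Lemma complete_pth_root (E : fieldType) (OE : vring E) (p : nat) (a : E) :
  p \in [pchar E] -> vcomplete OE ->
  (forall c, c != 0 -> exists b, ltv OE c (a - b ^+ p)) -> exists l, a = l ^+ p.
Proof.
move=> charE complete near; have p_gt0 := prime_gt0 (pcharf_prime charE).
have expB (x y : E) : (x - y) ^+ p = x ^+ p - y ^+ p.
  by rewrite -!(pFrobenius_autE charE) rmorphB.
pose Fl (A : E -> Prop) := exists2 c, c != 0 & forall b, ltv OE c (a - b ^+ p) -> A b.
have Fl_filter : is_filter Fl.
  split.
  - by exists 1 => //; exact: oner_neq0.
  - by case=> c /near[b hb] /(_ b hb).
  - move=> A B [c c0 hA] [d d0 hB]; exists (maxv OE c d); first exact: maxv_neq0.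
    move=> b hb; split; [apply: hA | apply: hB]; apply: lev_lt_trans hb.
      exact: lev_maxl.
    exact: lev_maxr.
  - by move=> A B AB [c c0 hA]; exists c => // b /hA/AB.
have Fl_cauchy : vcauchy OE Fl.
  move=> c c0; exists (fun b => ltv OE (c ^+ p) (a - b ^+ p)); split.
    by exists (c ^+ p) => //; rewrite expf_neq0.
  move=> x y hx hy; apply/vltP; rewrite -(ltv_pX2r _ _ _ p_gt0) expB.
  have -> : x ^+ p - y ^+ p = (a - y ^+ p) - (a - x ^+ p) by ring.
  exact: ltvB.
have [l hl] := complete Fl Fl_filter Fl_cauchy; exists l.
apply/eqP; rewrite -subr_eq0; apply: contraT => c0; set c := a - _ in c0.
have [d d0 near_l] := hl (maxv OE 1 c) (maxv_neq0 OE (oner_neq0 E) c0).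
have [b hb] := near (maxv OE c d) (maxv_neq0 OE c0 d0).
have /vltP hbl := near_l b (lev_lt_trans (lev_maxr OE c d) hb).
suff : ltv OE c c by rewrite ltvv.
have {2}-> : c = (a - b ^+ p) + (b - l) ^+ p by rewrite /c expB; ring.
apply: ltvD; first exact: lev_lt_trans (lev_maxl OE c d) hb.
apply: lev_lt_trans (lev_maxr OE 1 c) _; apply: lev_lt_trans (ltvX p_gt0 hbl).
by rewrite -(prednK p_gt0); apply: lev_exprS; exact: lev_maxl.
Qed.

Definition exp_surj_modp (E : fieldType) (OE : E -> Prop) (p : nat) :=
  forall a, OE a -> exists b, OE b /\ exists d, OE d /\ a - b ^+ p = p%:R * d.

Section DenseSubfield.
Variables (F E : fieldType) (O : vring F) (OE : vring E) (i : {rmorphism F -> E}).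
Hypothesis ringE : forall a, OE (i a) <-> O a.
Hypothesis dense : forall e c : E, c != 0 -> exists s, ltv OE c (e - i s).
Local Notation "x <=v y" := (lev OE x y).
Local Notation "x <v y" := (ltv OE x y).
Let lev_i := lev_morph ringE.

Lemma dense_lev1 (e c : E) : 1 <=v e -> c != 0 -> exists2 s, lev O 1 s & c <v e - i s.
Proof.
move=> he c0; have [s hs] := dense e (maxv_neq0 OE (oner_neq0 E) c0); exists s.
  rewrite -lev_i rmorph1 -[i s](subKr e); apply: levB => //.
  exact: lev_trans (lev_maxl OE 1 c) (ltvW hs).
exact: lev_lt_trans (lev_maxr OE 1 c) hs.
Qed.

Variable p : nat.
Hypothesis p_prime : prime p.
Let p_gt0 := prime_gt0 p_prime.

Lemma frob_surj_of_completion :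
  exp_surj_modp OE p -> frob_surj O p predT.
Proof.
move=> surjE c a _ c0 _ _ a1.
have [|b [/lev1 b1 [d [/lev1 d1 e]]]] := surjE (i a).
  by apply/lev1; rewrite -(rmorph1 i) lev_i.
have [|s s1 hs] := @dense_lev1 b (i c) b1; first by rewrite fmorph_eq0.
exists s => //; rewrite -(negligible_morph p ringE) rmorphB rmorphXn.
have -> : i a - i s ^+ p = (i a - b ^+ p) + (b ^+ p - i s ^+ p) by ring.
apply: negligibleD; first by apply: negligible_lep; rewrite e levMr.
apply/negligible_ltv/(ltv_le_trans hs)/lev_subXX => //.
by rewrite -(rmorph1 i) lev_i.
Qed.

Lemma near_pth_completion (c a : E) : frob_surj O p predT -> c != 0 -> 1 <=v a ->
  exists2 b, 1 <=v b & negligible OE p c (a - b ^+ p).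
Proof.
move=> surjF c0 a1; have [s0 /eqv_subl es0] := dense c c0.
have s0_neq0 : s0 != 0 by rewrite -(fmorph_eq0 i) -(eqv_eq0 es0).
have [s s1 hs] := dense_lev1 a1 c0; pose d := maxv O 1 s0.
have [b _ hb] := surjF d s isT (maxv_neq0 O (oner_neq0 F) s0_neq0) (lev_maxl O 1 s0) isT s1.
exists (i b).
  by rewrite -(rmorph1 i) lev_i; exact: (near_pth_lev1 p_prime (lev_maxl O 1 s0) s1 hb).
have -> : a - i b ^+ p = (a - i s) + (i s - i b ^+ p) by ring.
apply: negligibleD; first exact: negligible_ltv.
apply: (@negligible_lel _ _ _ _ (i d)).
  by rewrite (eqv_lel _ es0) lev_i lev_maxr.
by rewrite -rmorphXn -rmorphB (negligible_morph p ringE).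
Qed.

Lemma frob_surj_completion :
  vcomplete OE -> frob_surj O p predT -> exp_surj_modp OE p.
Proof.
move=> complete surjF a /lev1 a1; have near c c0 := near_pth_completion surjF c0 a1 (c := c).
have [pE0|pE0] := eqVneq (p%:R : E) 0; last first.
  have [b b1 hb] := near _ pE0; exists b; split; first exact/lev1.
  have /levP[d Od ed] : p%:R <=v a - b ^+ p by case/orP: hb => // /ltvW.
  by exists d.
have [||l el] := @complete_pth_root E OE p a _ complete; first by rewrite inE p_prime pE0 eqxx.
  move=> c c0; have [b _ /orP[|hb]] := near c c0; last by exists b.
  by rewrite pE0 lev0r => /eqP e; exists b; rewrite e ltvr0.
exists l; split; first by apply/lev1; rewrite -(lev_pX2r _ _ _ p_gt0) expr1n -el.
by exists 0; split; [exact: vring0 | rewrite el subrr mulr0].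
Qed.

End DenseSubfield.

Section SubfieldCompletion.
Variables (L : fieldType) (O : vring L) (S : subfieldOf L).

Fact subfield_valuation_ring : valuation_ring (fun x : subfield_type S => O (val x)).
Proof.
split.
- by rewrite rmorph0; exact: vring0.
- by rewrite rmorph1; exact: vring1.
- by move=> x y; rewrite rmorphB; exact: vringB.
- by move=> x y; rewrite rmorphM; exact: vringM.
move=> x x0; rewrite (fmorphV (subfield_val S)); apply: vringV.
by rewrite (fmorph_eq0 (subfield_val S)).
Qed.
Definition subfield_vring := VRing subfield_valuation_ring.

Variable SP : L -> Prop.
Hypothesis SPE : forall x, SP x <-> x \in S.

Definition embed_completion (x : L) : completion subfield_vring :=
  if insub x is Some u then to_completion subfield_vring u else 0.

Lemma embed_completionE (x : subfield_type S) :
  embed_completion (val x) = to_completion subfield_vring x.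
Proof. by rewrite /embed_completion valK. Qed.

Lemma embed_completion_is_completion :
  is_completion O SP (completion_ring (O := subfield_vring)) embed_completion.
Proof.
have lift x : SP x -> exists u : subfield_type S, x = val u.
  by move=> /SPE xS; exists (Sub x xS).
split; first exact: completion_valuation_ring.
split; first by have := embed_completionE 1; rewrite !rmorph1.
split; first by move=> _ _ /lift[x ->] /lift[y ->]; rewrite -rmorphD !embed_completionE rmorphD.
split; first by move=> _ _ /lift[x ->] /lift[y ->]; rewrite -rmorphM !embed_completionE rmorphM.
split; first by move=> _ /lift[x ->]; rewrite embed_completionE completion_ring_val.
split; last exact: completion_complete.
move=> e c c0; have [s hs] := completion_dense e c0; exists (val s).
split; first by apply/SPE; exact: (valP s).
by rewrite embed_completionE; exact/(vltP (completion_vring subfield_vring)).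
Qed.

Lemma is_completion_morphism (E : fieldType) (OE : E -> Prop) (j : L -> E) :
  is_completion O SP OE j ->
  exists i : {rmorphism subfield_type S -> E}, forall x, i x = j (val x).
Proof.
move=> [_ [j1 [jD [jM _]]]]; pose i (x : subfield_type S) := j (val x).
have iS (x : subfield_type S) : SP (val x) by apply/SPE; exact: (valP x).
have i_zmod : zmod_morphism i.
  by move=> x y; apply: (addIr (i y)); rewrite /i -jD // -rmorphD !subrK.
have i_monoid : monoid_morphism i.
  by split=> [|x y]; rewrite /i ?rmorph1 // -jM ?rmorphM //; exact: iS.
by exists (HB.pack_for {rmorphism subfield_type S -> E} i
  (GRing.isZmodMorphism.Build _ _ i i_zmod) (GRing.isMonoidMorphism.Build _ _ i i_monoid)).
Qed.

Lemma frob_surj_iff_completion p (E : fieldType) (OE : E -> Prop) (j : L -> E) : prime p ->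
  is_completion O SP OE j ->
  exp_surj_modp OE p <-> frob_surj O p S.
Proof.
move=> p_prime hj; have [i iE] := is_completion_morphism hj.
have [hOE [_ [_ [_ [j_ring [j_dense complete]]]]]] := hj.
have ringE (x : subfield_type S) : VRing hOE (i x) <-> subfield_vring x.
  by rewrite iE /=; apply: j_ring; apply/SPE; exact: (valP x).
have dense e c : c != 0 -> exists s, ltv (VRing hOE) c (e - i s).
  move=> c0; have [s [/SPE sS hs]] := j_dense e c c0.
  by exists (Sub s sS); rewrite iE; exact/vltP.
have imE x : x \in S <-> exists u, x = subfield_val S u.
  by split=> [xS|[u ->]]; [exists (Sub x xS) | exact: (valP u)].
have ring_val (x : subfield_type S) : O (subfield_val S x) <-> subfield_vring x by [].
rewrite (frob_surj_morph p ring_val imE); split=> h.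
  exact: (frob_surj_of_completion ringE dense h).
exact: (frob_surj_completion ringE dense p_prime complete h).
Qed.

Lemma DRvrE : DRvr O SP <-> forall p, residue_char O p -> frob_surj O p S.
Proof.
split=> h p hp; have p_prime : prime p by case: hp.
  apply/(frob_surj_iff_completion p_prime embed_completion_is_completion).
  exact: h embed_completion_is_completion.
by move=> E OE j hj; apply/(frob_surj_iff_completion p_prime hj); exact: h.
Qed.

Lemma DRvpE : DRvp O SP <-> forall p, residue_char O p -> vp_not_min O p S.
Proof.
split=> h p hp; have [e|[x hx]] := h p hp; try by left.
  by case: hx => /SPE xS [/vltP x1 /vltP xp]; right; exists x => //; rewrite x1.
by move=> /andP[/vltP x1 /vltP xp]; right; exists x; split=> //; exact/SPE.
Qed.

Lemma DRstE : DRst O SP <-> forall p, residue_char O p -> vgroup_pdiv O p S.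
Proof.
split=> h p hp x; have p_gt0 : (0 < p)%N by case: hp => /prime_gt0.
  move=> /SPE xS x0; have [y [/SPE yS y0 xy yx]] := h p hp x xS x0; exists y => //.
  have yp0 := expf_neq0 p y0.
  by apply/andP; split; rewrite -lev1_div //; apply/lev1.
move=> /SPE xS x0; have [y yS xy] := h p hp x xS x0; exists y.
have y0 := eqvX_neq0 p_gt0 x0 xy; have yp0 := expf_neq0 p y0; case/andP: xy => xy yx.
by split=> //; [exact/SPE | |]; apply/lev1; rewrite lev1_div.
Qed.

Lemma gdr_inE : gdr_in O SP <->
  forall p, residue_char O p -> frob_surj O p S /\ vp_not_min O p S.
Proof.
rewrite /gdr_in DRvrE DRvpE; split=> [[hvr hvp] p hp|h].
  by split; [exact: hvr | exact: hvp].
by split=> p /h[].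
Qed.

Lemma semitame_inE : semitame_in O SP <->
  forall p, residue_char O p -> frob_surj O p S /\ vgroup_pdiv O p S.
Proof.
rewrite /semitame_in DRvrE DRstE; split=> [[hvr hst] p hp|h].
  by split; [exact: hvr | exact: hst].
by split=> p /h[].
Qed.

End SubfieldCompletion.

(** * Conjugates and values *)

Section ConjugateProducts.
Variables (F : fieldType) (O : vring F) (s : {rmorphism F -> F}) (rs : seq F) (T : pred F).
Local Notation "x <v y" := (ltv O x y).
Hypotheses (rs_uniq : uniq rs) (s_rs : {in rs, forall r, s r \in rs}) (rs0 : 0 \notin rs).
Let A := filter T rs.
Let sA := map s A.
Let y := \prod_(r <- rs | T r) r.

Let A_uniq : uniq A. Proof. by rewrite filter_uniq. Qed.
Let sA_uniq : uniq sA. Proof. by rewrite (map_inj_uniq (fmorph_inj s)). Qed.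
Let yE : y = \prod_(r <- A) r. Proof. by rewrite big_filter. Qed.
Let syE : s y = \prod_(r <- sA) r. Proof. by rewrite yE rmorph_prod big_map. Qed.
Let sA_rs : {subset sA <= rs}.
Proof. by move=> _ /mapP[r + ->]; rewrite mem_filter => /andP[_ /s_rs]. Qed.

Lemma conj_prod_stable : {in rs, forall r, T r -> T (s r)} -> s y = y.
Proof.
move=> Ts; rewrite syE yE; apply: perm_big; have sA_A : {subset sA <= A}.
  move=> _ /mapP[r + ->]; rewrite !mem_filter => /andP[Tr rrs].
  by rewrite Ts ?s_rs.
by apply: uniq_perm => //; case: (uniq_min_size sA_uniq sA_A) => //; rewrite size_map.
Qed.

Lemma conj_prod_ltv r0 : {in rs &, forall r w, T r -> ~~ T w -> r <v w} ->
  r0 \in rs -> T r0 -> ~~ T (s r0) -> y <v s y.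
Proof.
move=> lowT r0_rs Tr0 nTsr0.
have common : perm_eq (filter (mem sA) A) (filter (mem A) sA).
  by apply: uniq_perm; rewrite ?filter_uniq // => x; rewrite [LHS]mem_filter [RHS]mem_filter andbC.
have size_eq : size (filter (predC (mem sA)) A) = size (filter (predC (mem A)) sA).
  apply/eqP; rewrite -(eqn_add2l (size (filter (mem sA) A))).
  by rewrite {2}(perm_size common) !size_filter !count_predC size_map.
have yA := perm_big _ (permEl (perm_filterC (mem sA) A)) : _ = \prod_(i <- A) i.
have ysA := perm_big _ (permEl (perm_filterC (mem A) sA)) : _ = \prod_(i <- sA) i.
rewrite syE yE -yA -ysA !big_cat /= -(perm_big _ common) /= ltvM2l; last first.
  rewrite big_filter prodf_seq_neq0; apply/allP => x; rewrite mem_filter => /andP[_ x_rs].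
  by apply/implyP => _; apply: contraNneq rs0 => <-.
apply: ltv_prod => //.
  rewrite -size_eq0 size_eq size_eq0 -has_filter; apply/hasP; exists (s r0) => /=.
    by rewrite map_f // mem_filter Tr0.
  by rewrite mem_filter negb_and nTsr0.
move=> u w; rewrite !mem_filter /= => /andP[_ /andP[Tu u_rs]] /andP[+ w_sA].
by rewrite mem_filter (sA_rs w_sA) andbT; apply: lowT => //; exact: sA_rs.
Qed.

Lemma conj_prod_dominant : {in rs &, forall r w, T r -> ~~ T w -> r <v w} ->
  s y = y \/ y <v s y.
Proof.
move=> lowT; have [/allP Ts|/allPn[r r_rs]] := boolP (all (fun r => T r ==> T (s r)) rs).
  by left; apply: conj_prod_stable => r /Ts/implyP.
by rewrite negb_imply => /andP[Tr nTsr]; right; exact: conj_prod_ltv Tr nTsr.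
Qed.

End ConjugateProducts.

Section Conjugates.
Variables (L : closedFieldType) (O : vring L) (S : subfieldOf L).
Hypothesis algS : forall x, algebraicOver (subfield_val S) x.
Local Notation "x <=v y" := (lev O x y).
Local Notation "x <v y" := (ltv O x y).
Local Notation "x =v y" := (eqv O x y).
Local Notation sepS := (sep_field (subfield_val S)).
Implicit Types s : {rmorphism L -> L}.

Definition conj_seq x (rs : seq L) :=
  [/\ uniq rs, x \in rs, is_minpoly S x (\prod_(r <- rs) ('X - r%:P)) &
   forall r1 r2, r1 \in rs ->
     (r2 \in rs <-> exists2 s : {rmorphism L -> L}, {in S, s =1 id} & s r1 = r2)].

Lemma is_minpoly_root x h r : is_minpoly S x h -> root h r -> is_minpoly S r h.
Proof.
move=> hP rr; have [hm hS _ hmin] := hP; split=> // P PS.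
have [s [sS <-]] := extend_aut algS hP rr.
by rewrite (root_fixed sS _ PS); exact: hmin.
Qed.

Lemma exists_conj_seq x : x \in sepS -> exists rs, conj_seq x rs.
Proof.
move=> /sep_fieldP[P [P0 sP rP]]; have [h hP] := exists_minpoly (algS x).
have [hm hS rh hmin] := hP; have [rs] := closed_field_poly_normal h.
rewrite (monicP hm) scale1r => ers; rewrite ers in hm hS rh hmin hP; exists rs; split=> //.
- rewrite -separable_prod_XsubC; apply: dvdp_separable (hmin _ (polyOver_val _) rP) _.
  by rewrite separable_map.
- by rewrite -root_prod_XsubC.
move=> r1 r2; rewrite -!root_prod_XsubC => rr1; split=> [rr2|[s sS <-]].
  by have [s [sS sr1]] := extend_aut algS (is_minpoly_root hP rr1) rr2; exists s.
by rewrite (root_fixed sS).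
Qed.

Lemma conj_seq_stable x rs s : conj_seq x rs -> {in S, s =1 id} ->
  {in rs, forall r, s r \in rs}.
Proof. by move=> [_ _ _ conj] sS r r_rs; apply/(conj r) => //; exists s. Qed.

Lemma sep_field_fixed s x : {in S, s =1 id} -> x \in sepS -> s x \in sepS.
Proof.
move=> sS /sep_fieldP[P [P0 sP rP]]; apply/sep_fieldP; exists P; split=> //.
by rewrite (root_fixed sS) //; exact: polyOver_val.
Qed.

Lemma conj_seq_sep x rs r : x \in sepS -> conj_seq x rs -> r \in rs -> r \in sepS.
Proof.
by move=> sx [_ xrs _ conj] /(conj x _ xrs)[s sS <-]; exact: sep_field_fixed.
Qed.

Lemma conj_seq_neq0 x rs : x != 0 -> conj_seq x rs -> 0 \notin rs.
Proof.
move=> x0 [_ xrs _ conj]; apply/negP => /(conj x _ xrs)[s _ /eqP].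
by rewrite fmorph_eq0 (negbTE x0).
Qed.

Lemma fixed_mem x : x \in sepS -> (forall s, {in S, s =1 id} -> s x = x) -> x \in S.
Proof.
move=> /exists_conj_seq[rs [rs_uniq xrs [hm hS _ _] conj]] fx.
have all_x : {subset rs <= [:: x]}.
  by move=> r /(conj x _ xrs)[s /fx -> <-]; rewrite mem_head.
have rs_x : rs = [:: x].
  have := uniq_leq_size rs_uniq all_x; case: rs xrs {rs_uniq hm hS conj all_x} => [|r [|//]] //.
  by rewrite inE => /eqP ->.
move: hS; rewrite rs_x big_seq1 => /polyOverP/(_ 0%N).
by rewrite coefB coefX coefC sub0r rpredN.
Qed.

(* The trace of z over S is the sum of z and of conjugates of larger value. *)
Lemma dominant_trace z : z \in sepS -> z != 0 ->
  (forall s, {in S, s =1 id} -> s z = z \/ z <v s z) -> exists2 a, a \in S & z <v a - z.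
Proof.
move=> sz z0 hz; have [rs [rs_uniq zrs [_ hS _ _] conj]] := exists_conj_seq sz.
exists (\sum_(r <- rs) r).
  have := polyOverP hS (size rs).-1; rewrite coefPn_prod_XsubC ?rpredN //.
  by case: (rs) zrs.
rewrite (bigD1_seq _ zrs rs_uniq) /= addrAC subrr add0r -big_filter big_seq.
apply: ltv_sum => // r; rewrite mem_filter => /andP[r_neq_z /(conj z _ zrs)[s sS er]].
by case: (hz s sS) => [|]; rewrite er => // e; rewrite e eqxx in r_neq_z.
Qed.

Section LowerProducts.
Variables (x : L) (rs : seq L) (T : pred L).
Hypotheses (x_sep : x \in sepS) (x0 : x != 0) (rsP : conj_seq x rs).
Hypothesis lowT : {in rs &, forall r w, T r -> ~~ T w -> r <v w}.
Let y := \prod_(r <- rs | T r) r.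

Lemma lower_prod_neq0 : y != 0.
Proof.
rewrite prodf_seq_neq0; apply/allP => r r_rs; apply/implyP => _.
by apply: contraNneq (conj_seq_neq0 x0 rsP) => <-.
Qed.

Lemma lower_prod_sep : y \in sepS.
Proof.
rewrite /y big_seq_cond; apply: rpred_prod => r /andP[r_rs _].
exact: conj_seq_sep x_sep rsP r_rs.
Qed.

Lemma lower_prod_conj s : {in S, s =1 id} -> s y = y \/ y <v s y.
Proof.
move=> sS; case: (rsP) => rs_uniq _ _ _; apply: conj_prod_dominant => //.
  exact: conj_seq_stable rsP sS.
exact: conj_seq_neq0 rsP.
Qed.

Lemma lower_prod_approx : exists2 a, a \in S & y <v a - y.
Proof. exact: dominant_trace lower_prod_sep lower_prod_neq0 lower_prod_conj. Qed.

End LowerProducts.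

(* The value of z is a quotient of the values of the products of the conjugates of
   value at most, resp. less than, that of z. *)
Lemma isolated_value z : z \in sepS -> z != 0 ->
  (forall s, {in S, s =1 id} -> s z = z \/ ~~ (s z =v z)) ->
  exists2 a, a \in S & a =v z.
Proof.
move=> z_sep z0 hz; have [zs zsP] := exists_conj_seq z_sep; have [zs_uniq zzs _ conj] := zsP.
pose y (T : pred L) := \prod_(r <- zs | T r) r.
have [|a a_S /eqv_subr ha] := @lower_prod_approx z zs (fun r => r <=v z) z_sep z0 zsP.
  by move=> r w _ _ /= rz; exact: lev_lt_trans.
have [|b b_S /eqv_subr hb] := @lower_prod_approx z zs (fun r => r <v z) z_sep z0 zsP.
  by move=> r w _ _ /= rz; rewrite -levNgt; exact: ltv_le_trans.
exists (a / b); first exact: rpred_div.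
suff e : y (fun r => r <=v z) = z * y (fun r => r <v z).
  rewrite eqv_sym -[z](mulfK (lower_prod_neq0 (fun r => r <v z) z0 zsP)) -e.
  exact: eqvM ha (eqvV hb).
transitivity (\prod_(r <- z :: filter (fun r => r <v z) zs) r); last first.
  by rewrite big_cons big_filter.
rewrite /y -big_filter; apply: perm_big; apply: uniq_perm; first by rewrite filter_uniq.
  by rewrite /= mem_filter ltvv filter_uniq.
move=> r; rewrite inE !mem_filter; have [r_zs|r_zs] := boolP (r \in zs); last first.
  by rewrite !andbF orbF; apply/esym; apply: contraNF r_zs => /eqP ->.
rewrite !andbT; have /(conj z _ zzs)[s sS <-] := r_zs.
have [->|h] := hz s sS; first by rewrite eqxx lev_refl.
have /negbTE -> : s z != z by apply: contraNneq h => ->; exact: eqv_refl.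
apply/idP/idP => [le_sz|/ltvW//]; rewrite ltvNge; apply: contra h => le_z.
by rewrite /eqv le_sz.
Qed.

End Conjugates.

(** * Integral polynomials and etale generators *)

Fact full_closed (L : fieldType) : divring_closed (predT : {pred L}). Proof. by []. Qed.
Definition full_subfield (L : fieldType) : subfieldOf L := subfieldOf_field (@full_closed L).

Definition int_pred (L : fieldType) (O : vring L) (S : subfieldOf L) : {pred L} :=
  fun x => (x \in S) && lev O 1 x.
Fact int_pred_closed (L : fieldType) (O : vring L) (S : subfieldOf L) :
  subring_closed (int_pred O S).
Proof.
split=> [|x y /andP[xS hx] /andP[yS hy]|x y /andP[xS hx] /andP[yS hy]]; apply/andP.
- by rewrite rpred1.
- by rewrite rpredB ?levB.
- by rewrite rpredM ?lev1M.
Qed.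
HB.instance Definition _ (L : fieldType) (O : vring L) (S : subfieldOf L) :=
  GRing.isSubringClosed.Build L (int_pred O S) (@int_pred_closed L O S).
Definition int_type (L : fieldType) (O : vring L) (S : subfieldOf L) :=
  {x : L | x \in int_pred O S}.
HB.instance Definition _ (L : fieldType) (O : vring L) (S : subfieldOf L) :=
  SubChoice.on (int_type O S).
HB.instance Definition _ (L : fieldType) (O : vring L) (S : subfieldOf L) :=
  [SubChoice_isSubComNzRing of int_type O S by <:].
Definition int_val (L : fieldType) (O : vring L) (S : subfieldOf L) :
  {rmorphism int_type O S -> L} := val.

Lemma int_predP (L : fieldType) (O : vring L) (S : subfieldOf L) x :
  reflect (x \in S /\ lev O 1 x) (x \in int_pred O S).
Proof. exact: andP. Qed.

Section IntegralPolynomials.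
Variables (L : fieldType) (O : vring L) (S : subfieldOf L).
Local Notation "x <=v y" := (lev O x y).
Local Notation "x <v y" := (ltv O x y).
Local Notation "x =v y" := (eqv O x y).
Local Notation intS := (int_pred O S).

Lemma polyOver_int_sub (P : {poly L}) : P \is a polyOver intS -> P \is a polyOver S.
Proof. by apply: polyOverS => x /int_predP[]. Qed.

Lemma polyOver_int_full (P : {poly L}) :
  P \is a polyOver intS -> P \is a polyOver (int_pred O (full_subfield L)).
Proof. by apply: polyOverS => x /int_predP[_ hx]; apply/int_predP. Qed.

Lemma polyOver_intI (P : {poly L}) : P \is a polyOver S ->
  P \is a polyOver (int_pred O (full_subfield L)) -> P \is a polyOver intS.
Proof.
move=> /polyOverP PS /polyOverP Pint; apply/polyOverP => i; apply/int_predP.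
by have /int_predP[] := Pint i.
Qed.

Lemma polyOver_int_lev1 (P : {poly L}) i : P \is a polyOver intS -> 1 <=v P`_i.
Proof. by move=> /polyOverP/(_ i)/int_predP[]. Qed.

Lemma lev1_horner (P : {poly L}) x : P \is a polyOver intS -> 1 <=v x -> 1 <=v P.[x].
Proof.
move=> PA hx; rewrite horner_coef; apply: lev_sum => i _.
by apply: lev1M; [exact: polyOver_int_lev1 | exact: lev1X].
Qed.

Lemma lev_hornerB (P : {poly L}) x y :
  P \is a polyOver intS -> 1 <=v x -> 1 <=v y -> x - y <=v P.[x] - P.[y].
Proof.
move=> PA hx hy; rewrite !horner_coef -sumrB; apply: lev_sum => i _.
by rewrite -mulrBr; apply: levMl; [exact: polyOver_int_lev1 | exact: lev_subXX].
Qed.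

Lemma ltv1_horner (P : {poly L}) x : (forall i, 1 <v P`_i) -> 1 <=v x -> 1 <v P.[x].
Proof.
move=> PM hx; rewrite horner_coef; apply: ltv_sum => [|i _]; first exact: oner_neq0.
by apply: ltvMr; [exact: lev1X | exact: PM].
Qed.

Lemma unit_coef_horner (P : {poly L}) x :
  P \is a polyOver intS -> 1 <=v x -> 1 =v P.[x] -> exists i, 1 =v P`_i.
Proof.
move=> PA hx hP; apply: contrapT => nonunit; suff : 1 <v P.[x] by rewrite -(eqv_ltr _ hP) ltvv.
apply: ltv1_horner hx => i; apply: contraPT nonunit => h; case; exists i.
exact: eqv1_ltvN (polyOver_int_lev1 i PA) h.
Qed.

Lemma eqv1_horner_close (P : {poly L}) x y : P \is a polyOver intS -> 1 <=v x -> 1 <=v y ->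
  1 <v x - y -> 1 =v P.[x] -> 1 =v P.[y].
Proof.
move=> PA hx hy xy hP; apply: eqv1_close hP _.
by apply: ltv_le_trans xy _; exact: lev_hornerB.
Qed.

End IntegralPolynomials.

Lemma simple_root_isolated (L : fieldType) (O : vring L) (f : {poly L}) b c :
  f \is a polyOver (int_pred O (full_subfield L)) -> lev O 1 b -> lev O 1 c ->
  root f b -> root f c -> eqv O 1 f^`().[b] -> ltv O 1 (c - b) -> c = b.
Proof.
move=> fA hb hc rb rc fb cb; apply/eqP; rewrite -subr_eq0; apply: contraT => c_neq_b.
have XA : 'X - b%:P \is a polyOver (int_pred O (full_subfield L)).
  by rewrite polyOverXsubC; apply/int_predP.
have [q [r [qA _ ef]]] := polyOver_division (int_type O (full_subfield L)) (monicXsubC b) XA fA.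
rewrite size_XsubC ltnS => /size1_polyC er.
have r0 : r = 0.
  move: rb; rewrite ef er rootE hornerD hornerM hornerXsubC subrr mulr0 add0r hornerC.
  by move/eqP ->.
rewrite r0 addr0 in ef.
have qb : q.[b] = f^`().[b].
  by rewrite ef derivM derivXsubC hornerD !hornerM hornerXsubC subrr mulr0 add0r hornerC mulr1.
have qc : q.[c] = 0.
  by move: rc; rewrite ef rootE hornerM hornerXsubC mulf_eq0 (negbTE c_neq_b) orbF => /eqP.
have := lev_hornerB qA hc hb; rewrite qc sub0r levN qb => /(ltv_le_trans cb).
by rewrite -(eqv_ltr _ fb) ltvv.
Qed.

Section SimpleExtensions.
Variables (L : closedFieldType) (S : subfieldOf L).
Hypothesis algS : forall x, algebraicOver (subfield_val S) x.

Definition simple_ext (b : L) : subfieldOf L := adjoin (exists_irreducible (algS b)).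

Lemma simple_extP b x :
  reflect (exists2 P, P \is a polyOver S & x = P.[b]) (x \in simple_ext b).
Proof.
apply: (iffP (adjoin_predP _ _ _)) => [[P ->]|[P PS ->]].
  by exists (map_poly (subfield_val S) P) => //; exact: polyOver_val.
by have [Q <-] := polyOver_lift (subfield_type S) PS; exists Q.
Qed.

Lemma simple_ext_sub b : {subset S <= simple_ext b}.
Proof. by move=> x xS; apply/simple_extP; exists x%:P; rewrite ?polyOverC ?hornerC. Qed.
Lemma mem_simple_ext b : b \in simple_ext b.
Proof. exact: mem_adjoin. Qed.

Lemma simple_ext_min b (T : subfieldOf L) :
  {subset S <= T} -> b \in T -> {subset simple_ext b <= T}.
Proof.
move=> ST bT x /simple_extP[P PS ->]; apply: rpred_horner => //.
exact: (polyOverS ST).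
Qed.

Lemma simple_ext_fixed b (s : {rmorphism L -> L}) x :
  {in S, s =1 id} -> s b = b -> x \in simple_ext b -> s x = x.
Proof. by move=> sS sb /simple_extP[P PS ->]; rewrite -horner_map sb (polyOver_fixed sS PS). Qed.

Lemma simple_ext_span b f x : f \is monic -> f \is a polyOver S -> root f b ->
  x \in simple_ext b -> exists P, [/\ P \is a polyOver S, (size P < size f)%N & x = P.[b]].
Proof.
move=> fm fS rf /simple_extP[P PS ->].
have [q [r [qS rS -> sr]]] := polyOver_division (subfield_type S) fm fS PS.
by exists r; rewrite hornerD hornerM (rootP rf) mulr0 add0r.
Qed.

End SimpleExtensions.

Definition int_horner (L : fieldType) (O : vring L) (S : subfieldOf L) (b : L) :
  {rmorphism {poly int_type O S} -> L} := horner_eval b \o map_poly (int_val O S).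

Lemma int_hornerE (L : fieldType) (O : vring L) (S : subfieldOf L) (b : L) P :
  int_horner O S b P = (map_poly (int_val O S) P).[b].
Proof. by []. Qed.

(* An etale O_S-algebra O_S[X]_g / (f) whose image at X = b is all of the valuation
   ring of S(b), where moreover S(b) and S have the same values. *)
Record etale_generator (L : closedFieldType) (O : vring L) (S : subfieldOf L)
    (algS : forall x, algebraicOver (subfield_val S) x) (b : L)
    (f : {poly int_type O S}) : Prop := EtaleGenerator {
  etale_monic : f \is monic;
  etale_lev1 : lev O 1 b;
  etale_root : int_horner O S b f = 0;
  etale_dvd : forall P, int_horner O S b P = 0 -> exists Q, P = Q * f;
  etale_deriv : eqv O 1 (int_horner O S b f^`());
  etale_frac : forall x, x \in simple_ext algS b -> lev O 1 x ->
    exists P g, eqv O 1 (int_horner O S b g) /\ x = int_horner O S b P / int_horner O S b g;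
  etale_value : forall x, x \in simple_ext algS b -> x != 0 -> exists2 a, a \in S & eqv O a x }.

Lemma etale_generator_intro (L : closedFieldType) (O : vring L) (S : subfieldOf L)
    (algS : forall x, algebraicOver (subfield_val S) x) (b : L) (f : {poly L}) :
  let intS := int_pred O S in
  is_minpoly S b f -> f \is a polyOver intS -> lev O 1 b -> eqv O 1 f^`().[b] ->
  (forall x, x \in simple_ext algS b -> lev O 1 x -> exists P g,
    [/\ P \is a polyOver intS, g \is a polyOver intS, eqv O 1 g.[b] & x = P.[b] / g.[b]]) ->
  (forall x, x \in simple_ext algS b -> x != 0 -> exists2 a, a \in S & eqv O a x) ->
  exists2 f0, map_poly (int_val O S) f0 = f & etale_generator algS b f0.
Proof.
move=> intS [fm fS rf fmin] fA b1 fb frac value.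
have val_inj_poly : injective (map_poly (int_val O S)).
  move=> P Q e; apply/polyP => i; apply: val_inj; have := congr1 (fun R : {poly L} => R`_i) e.
  by rewrite !coef_map.
have [f0 ef] := polyOver_lift (int_type O S) fA; exists f0 => //; split=> //.
- apply/eqP/val_inj; rewrite rmorph1 -(monicP fm) -ef !lead_coefE.
  by rewrite size_map_inj_poly ?coef_map ?rmorph0 //; exact: val_inj.
- by rewrite /= ef; exact/rootP.
- move=> P /= /rootP rP; have [q [r [qA rA e sr]]] :=
    polyOver_division (int_type O S) fm fA (polyOver_val P).
  have r0 : r = 0.
    apply: contraTeq sr => r0; rewrite -leqNgt; apply: dvdp_leq => //; apply: fmin.
      exact: polyOver_int_sub rA.
    move: rP; rewrite rootE -[map_poly _ P]/(map_poly val P) e hornerD hornerM.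
    by rewrite (rootP rf) mulr0 add0r.
  have [q0 eq] := polyOver_lift (int_type O S) qA; exists q0; apply: val_inj_poly.
  by rewrite rmorphM /= ef eq -[LHS]/(map_poly val P) e r0 addr0.
- by move: fb; rewrite -ef deriv_map.
move=> x xSb x1; have [P [g [PA gA gb ex]]] := frac x xSb x1.
have [P0 eP] := polyOver_lift (int_type O S) PA; have [g0 eg] := polyOver_lift (int_type O S) gA.
by exists P0, g0; rewrite /= eP eg.
Qed.

Section EtaleStep.
Variables (L : closedFieldType) (O : vring L) (S : subfieldOf L).
Hypothesis algS : forall x, algebraicOver (subfield_val S) x.
Local Notation "x <=v y" := (lev O x y).
Local Notation "x <v y" := (ltv O x y).
Local Notation "x =v y" := (eqv O x y).
Variables (p : nat) (c : L).
Hypotheses (p_prime : prime p) (p_residue : 1 <v p%:R) (c1 : 1 <=v c).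
Let p_gt0 := prime_gt0 p_prime.
Let intS := int_type O S.

Definition negligible_ideal : {pred intS} := fun a => negligible O p c (val a).
Fact negligible_ideal_closed : idealr_closed negligible_ideal.
Proof.
split.
- by rewrite unfold_in /negligible_ideal rmorph0 negligible0.
- by rewrite unfold_in /negligible_ideal rmorph1 /negligible negb_or -ltvNge p_residue -levNgt.
move=> a u v hu hv; rewrite unfold_in /negligible_ideal rmorphD rmorphM; apply: negligibleD => //.
by rewrite mulrC; apply: negligibleMr => //; case/int_predP: (valP a).
Qed.
HB.instance Definition _ := isIdealr.Build intS negligible_ideal negligible_ideal_closed.
Let residue_ring := {ideal_quot negligible_ideal}.
Let red : {rmorphism intS -> residue_ring} := (\pi_{ideal_quot negligible_ideal})%qT.

Let red_eq0 x : red x = 0 <-> negligible O p c (val x).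
Proof.
split=> [|h].
  by rewrite -(rmorph0 red) => /eqP; rewrite -Quotient.idealrBE subr0.
by rewrite -(rmorph0 red); apply/eqP; rewrite -Quotient.idealrBE subr0.
Qed.

Let red_char : p \in [pchar residue_ring].
Proof.
rewrite inE p_prime /=; apply/eqP; rewrite -(rmorph_nat red); apply/red_eq0.
by rewrite rmorph_nat; exact: negligible_lep.
Qed.

Let red_poly_lift (P : {poly residue_ring}) : exists Q : {poly intS}, map_poly red Q = P.
Proof.
exists (\poly_(i < size P) (repr P`_i)); apply/polyP => i; rewrite coef_map coef_poly.
by case: ltnP => h; [exact: reprK | rewrite nth_default //; exact: rmorph0].
Qed.

Variables (b : L) (f : {poly intS}).
Hypothesis f_etale : etale_generator algS b f.
Local Notation Sb := (simple_ext algS b).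
Local Notation ev := (int_horner O S b).
Let b1 : 1 <=v b := etale_lev1 f_etale.
Let f_monic : f \is monic := etale_monic f_etale.

Lemma int_horner_mem P : ev P \in Sb.
Proof.
by apply/simple_extP; exists (map_poly (int_val O S) P) => //; exact/polyOver_int_sub/polyOver_val.
Qed.

Lemma int_hornerC a : ev a%:P = val a.
Proof. by rewrite int_hornerE map_polyC hornerC. Qed.

Lemma int_horner_negligible Z : map_poly red Z = 0 -> negligible O p c (ev Z).
Proof.
move=> redZ; rewrite int_hornerE horner_coef; apply: negligible_sum => i _.
apply: negligibleMr; first exact: lev1X.
by rewrite coef_map; apply/red_eq0; rewrite -(coef_map red) redZ coef0.
Qed.

Section Ascent.
Hypothesis surjS : forall a, a \in S -> 1 <=v a -> near_pth O p S c a.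
Local Notation near := (near_pth O p Sb c).

Lemma near_pth_int_horner (P : {poly intS}) z :
  1 <=v z -> near z -> near (map_poly (int_val O S) P).[z].
Proof.
move=> hz nz; rewrite horner_coef.
have Pint i : (map_poly (int_val O S) P)`_i \in S /\ 1 <=v (map_poly (int_val O S) P)`_i.
  by rewrite coef_map; apply/int_predP; exact: (valP P`_i).
apply: near_pth_sum => // i; first by apply: lev1M; [case: (Pint i) | exact: lev1X].
have [PS P1] := Pint i; apply: near_pthM => //; [exact: lev1X | | exact: near_pthX].
by have [y yS hy] := surjS PS P1; exists y => //; exact: simple_ext_sub.
Qed.

Lemma near_pth_etale_generator : near b.
Proof.
have [k [U' [W' e']]] := relative_Frobenius_surj red_char (monic_map red f_monic) 'X.
have [[U eU] [W eW]] := (red_poly_lift U', red_poly_lift W').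
have d1 := eqv1X k (etale_deriv f_etale); set d := ev f^`() in d1.
pose Z := 'X * f^`() ^+ (p * k) - (U \Po 'X^p) - f * W.
have redZ : map_poly red Z = 0.
  rewrite /Z !rmorphB !rmorphM rmorphXn /= map_comp_poly -deriv_map map_polyX map_polyXn.
  by rewrite eU eW e' [X in X - _ - _]addrC addrK subrr.
have evX : ev 'X = b by rewrite int_hornerE map_polyX hornerX.
have evU : ev (U \Po 'X^p) = (map_poly (int_val O S) U).[b ^+ p].
  by rewrite int_hornerE map_comp_poly map_polyXn horner_comp hornerXn.
have := int_horner_negligible redZ.
rewrite /Z !rmorphB !rmorphM rmorphXn evX evU (etale_root f_etale) mul0r subr0 -/d => hU.
have d_neq0 : d ^+ k ^+ p != 0 by rewrite expf_neq0 // (eqv1_neq0 d1).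
rewrite -[X in near X](mulfK d_neq0 b); apply: near_pth_div_exp => //.
  by rewrite rpredX ?int_horner_mem.
apply: (@near_pth_close _ _ _ _ _ (map_poly (int_val O S) U).[b ^+ p]).
  by rewrite -negligibleN opprB -exprM mulnC.
by apply: near_pth_int_horner; [exact: lev1X | apply: near_pth_exp; exact: mem_simple_ext].
Qed.

Lemma etale_near_pth x : x \in Sb -> 1 <=v x -> near x.
Proof.
move=> xSb x1; have [P [g [gb ->]]] := etale_frac f_etale xSb x1.
have -> : ev P / ev g = ev (P * g ^+ p.-1) / ev g ^+ p.
  rewrite rmorphM rmorphXn -[in RHS](prednK p_gt0) exprS /=.
  by have g0 := eqv1_neq0 gb; field; rewrite g0 expf_neq0.
apply: near_pth_div_exp => //; first exact: int_horner_mem.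
exact: near_pth_int_horner b1 near_pth_etale_generator.
Qed.

End Ascent.

Section Descent.
Variables (a : intS) (x : L).
Hypotheses (xSb : x \in Sb) (hx : negligible O p c (val a - x ^+ p)).
Let a1 : 1 <=v val a. Proof. by case/int_predP: (valP a). Qed.

Lemma etale_clear_denominators : exists (g P R : {poly intS}) (s : intS),
  [/\ 1 =v ev g, negligible O p c (val s) & ev (a%:P * g ^+ p - P ^+ p - s%:P * R) = 0].
Proof.
have x1 := near_pth_lev1 p_prime c1 a1 hx; have [P [g [gb ex]]] := etale_frac f_etale xSb x1.
have g0 := eqv1_neq0 gb; pose y := val a * ev g ^+ p - ev P ^+ p.
have ey : y = (val a - x ^+ p) * ev g ^+ p by rewrite /y ex mulrBl expr_div_n divfK ?expf_neq0.
have y_negl : negligible O p c y by rewrite ey; apply: negligibleMr => //; exact/eqv_le/eqv1X.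
have [y0|y0] := eqVneq y 0.
  exists g, P, 0, 0; rewrite rmorph0 negligible0; split=> //.
  by rewrite mulr0 subr0 rmorphB rmorphM !rmorphXn int_hornerC.
have ySb : y \in Sb.
  rewrite rpredB ?rpredM ?rpredX ?int_horner_mem //; apply: simple_ext_sub.
  by case/int_predP: (valP a).
have [s sS sy] := etale_value f_etale ySb y0.
have s_negl : negligible O p c s by apply: negligible_le y_negl; exact: eqv_ge.
have s_int : s \in int_pred O S by apply/int_predP; rewrite (negligible_lev1 c1 s_negl).
have s0 : s != 0 by rewrite (eqv_eq0 sy).
have [||R [g2 [g2b eR]]] := etale_frac f_etale (x := y / s).
- by rewrite rpred_div //; exact: simple_ext_sub.
- by rewrite lev1_div // eqv_le.
have g20 := eqv1_neq0 g2b; exists (g * g2), (P * g2), (R * g2 ^+ p.-1), (Sub s s_int).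
split=> //; first by rewrite rmorphM eqv1M.
have sRy : s * ev R = y * ev g2 by rewrite -[ev R](divfK g20) -eR mulrA [s * _]mulrC divfK.
rewrite !(rmorphB, rmorphM, rmorphXn) !int_hornerC /= mulrA sRy.
rewrite -mulrA -exprS prednK // !exprMn mulrA -mulrBl -/y; exact: subrr.
Qed.

Lemma etale_near_pth_descent : near_pth O p S c (val a).
Proof.
have [g [P [R [s [gb s_negl evZ]]]]] := etale_clear_denominators.
have [Q eQ] := etale_dvd f_etale evZ; have s0 : red s = 0 by apply/red_eq0.
pose G := Frobenius_mod p f g; pose H := Frobenius_mod p f P.
have descent i : negligible O p c (val a * val G`_i ^+ p - val H`_i ^+ p).
  have /red_eq0 := Frobenius_descent_mod red_char f_monic s0 eQ i.
  by rewrite rmorphB rmorphM !rmorphXn.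
have evG : ev G = ev f^`() ^+ p.-1 * ev g.
  rewrite -rmorphXn -rmorphM (Frobenius_modE p f_monic) rmorphD rmorphM.
  by rewrite (etale_root f_etale) mulr0 add0r.
have evG1 : 1 =v ev G by rewrite evG eqv1M ?eqv1X ?(etale_deriv f_etale).
have [i] := unit_coef_horner (polyOver_val G) b1 evG1; rewrite coef_map /= => Gi.
have Gi0 := eqv1_neq0 Gi; have intS_S (z : intS) : val z \in S by case/int_predP: (valP z).
exists (val H`_i / val G`_i); first by rewrite rpred_div.
have -> : val a - (val H`_i / val G`_i) ^+ p =
    (val a * val G`_i ^+ p - val H`_i ^+ p) * (val G`_i ^- p).
  by rewrite mulrBl mulfK ?expf_neq0 // expr_div_n.
by apply: negligibleMr => //; exact/eqv_le/eqv1V/eqv1X.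
Qed.

End Descent.
End EtaleStep.

(** * Henselian elements *)

Lemma exists_common_index (T : eqType) (rs : seq T) (Q : nat -> T -> Prop) :
  {in rs, forall r, exists k0, forall k, (k0 <= k)%N -> Q k r} ->
  exists k, {in rs, forall r, Q k r}.
Proof.
move=> ev; suff [k0 h0] : exists k0, forall k, (k0 <= k)%N -> {in rs, forall r, Q k r}.
  by exists k0; exact: h0.
elim: rs ev => [|r rs IH] ev; first by exists 0%N.
have [|k0 h0] := IH; first by move=> u u_rs; apply: ev; rewrite inE u_rs orbT.
have [k1 h1] := ev r (mem_head _ _); exists (maxn k0 k1) => k; rewrite geq_max => /andP[hk0 hk1] u.
by rewrite inE => /predU1P[->|]; [exact: h1 | exact: h0].
Qed.

Section Cofactors.
Variables (F : fieldType) (rs : seq F).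
Hypothesis rs_uniq : uniq rs.
Let f := \prod_(r <- rs) ('X - r%:P).

Definition cofactor_poly (r : F) : {poly F} := \prod_(t <- rem r rs) ('X - t%:P).

Lemma deriv_prod_XsubC r : r \in rs -> f^`().[r] = (cofactor_poly r).[r].
Proof.
move=> r_rs; rewrite /f (perm_big _ (perm_to_rem r_rs)) big_cons derivM derivXsubC mul1r.
by rewrite hornerD hornerM hornerXsubC subrr mul0r addr0.
Qed.

Lemma cofactor_poly_root r t : r \in rs -> t \in rs -> r != t -> (cofactor_poly r).[t] = 0.
Proof.
move=> r_rs t_rs neq; apply/rootP; rewrite /cofactor_poly root_prod_XsubC.
by rewrite mem_rem_uniq // inE eq_sym neq.
Qed.

Lemma interpolation_cofactor (Q : {poly F}) (c : F -> F) : (size Q <= size rs)%N ->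
  {in rs, forall r, Q.[r] = c r * f^`().[r]} ->
  Q = \sum_(r <- rs) c r *: cofactor_poly r.
Proof.
move=> sQ Qr; apply/eqP; rewrite -subr_eq0; apply/eqP; apply: (roots_geq_poly_eq0 _ rs_uniq).
  apply/allP => r r_rs; rewrite rootE hornerD hornerN horner_sum (bigD1_seq r) //=.
  rewrite hornerZ -deriv_prod_XsubC // -Qr // big_seq_cond big1 ?addr0 ?subrr // => t.
  by case/andP => t_rs t_neq; rewrite hornerZ cofactor_poly_root ?mulr0.
apply: leq_trans (size_polyD _ _) _; rewrite size_polyN geq_max sQ /=.
rewrite big_seq; elim/big_ind: _ => [|u v hu hv|r r_rs]; first by rewrite size_poly0.
  by apply: leq_trans (size_polyD _ _) _; rewrite geq_max hu.
apply: leq_trans (size_scale_leq _ _) _; rewrite size_prod_XsubC size_rem //.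
by rewrite prednK //; case: (rs) r_rs.
Qed.

End Cofactors.

Section HenselElement.
Variables (L : closedFieldType) (O : vring L) (S : subfieldOf L).
Hypothesis algS : forall x, algebraicOver (subfield_val S) x.
Local Notation "x <=v y" := (lev O x y).
Local Notation "x <v y" := (ltv O x y).
Local Notation "x =v y" := (eqv O x y).
Local Notation sepS := (sep_field (subfield_val S)).
Local Notation intS := (int_pred O S).
Implicit Types (s : {rmorphism L -> L}) (x : L).

Lemma exists_pow_value_neq b x (xs : seq L) : x != 0 -> b != 0 -> 1 <v b ->
  exists m, {in xs, forall r, ~~ (b ^+ m * x =v r)}.
Proof.
move=> x0 b0 hb; apply: (exists_common_index (Q := fun m r => ~~ (b ^+ m * x =v r))) => r _.
have [[m1 e1]|ne] := lem (exists m1, b ^+ m1 * x =v r); last first.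
  by exists 0%N => m _; apply/negP => e; apply: ne; exists m.
exists m1.+1 => m hm; apply/negP => e2; have : b ^+ m1 * x =v b ^+ m * x.
  by apply: eqv_trans e1 _; rewrite eqv_sym.
rewrite eqvM2r // ltv_eqF // -(subnKC hm) addSnnS exprD -{1}[b ^+ m1]mulr1.
by rewrite ltvM2l ?expf_neq0 // -(expr1n _ (m - m1.+1).+1) ltvX.
Qed.

Definition quad_iter k x := iter k (fun y => y ^+ 2 + y) x.

Lemma quad_iter_morph s k x : s (quad_iter k x) = quad_iter k (s x).
Proof. by elim: k => //= k IH; rewrite rmorphD rmorphXn IH. Qed.
Lemma quad_iter_mem (T : subfieldOf L) k x : x \in T -> quad_iter k x \in T.
Proof. by move=> xT; elim: k => //= k IH; rewrite rpredD ?rpredX. Qed.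
Lemma quad_iter_lev1 k x : 1 <=v x -> 1 <=v quad_iter k x.
Proof. by move=> h; elim: k => //= k IH; rewrite levD ?lev1X. Qed.
Lemma quad_iter_le k x : x <v 1 -> quad_iter k x <=v x.
Proof.
move=> h; elim: k => [|k IH] /=; first exact: lev_refl.
have lt1 : quad_iter k x <v 1 := lev_lt_trans IH h.
have sq_lt : quad_iter k x ^+ 2 <v quad_iter k x.
  by rewrite expr2 -[X in _ <v X]mulr1 ltvM2l ?(ltv_neq0 lt1).
by apply: lev_trans IH; rewrite -(eqv_lel _ (eqv_addr sq_lt)) ltvW.
Qed.

(* If 1 + y is in the maximal ideal, so is y^2 + y, as well as all its iterates. *)
Lemma exists_quad_iter_unit (rs : seq L) :
  exists k, {in rs, forall r, 1 <=v r -> 1 =v 1 + quad_iter k r}.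
Proof.
apply: (exists_common_index (Q := fun k r => 1 <=v r -> 1 =v 1 + quad_iter k r)) => r _.
have [[k1 h1]|ne] := lem (exists k1, 1 <v 1 + quad_iter k1 r); last first.
  exists 0%N => k _ hr; apply: eqv1_ltvN; first by rewrite levD ?quad_iter_lev1.
  by apply/negP => h; apply: ne; exists k.
exists k1.+1 => k hk hr; apply: eqv_addr; rewrite -(subnKC hk).
elim: (k - k1.+1)%N => [|j IH].
  rewrite addn0 /=; have -> : quad_iter k1 r ^+ 2 + quad_iter k1 r =
    (1 + quad_iter k1 r) * quad_iter k1 r by ring.
  by apply: ltvMr => //; exact: quad_iter_lev1.
by rewrite addnS; apply: ltvD => //; rewrite expr2 ltvMr // ltvW.
Qed.

Variable b : L.
Hypotheses (b_sep : b \in sepS) (b_max : 1 <v b).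
Hypothesis b_conj : forall s, {in S, s =1 id} -> s b = b \/ 1 =v s b.
Local Notation Sb := (simple_ext algS b).

Lemma simple_ext_sep : {subset Sb <= sepS}.
Proof.
apply: simple_ext_min b_sep => x xS.
exact: (sep_field_im (subfield_val S) (Sub x xS)).
Qed.

Lemma hensel_value x : x \in Sb -> x != 0 -> exists2 a, a \in S & a =v x.
Proof.
move=> xSb x0; have [b0|b0] := eqVneq b 0.
  exists x => //; have /simple_extP[P PS ->] := xSb.
  by rewrite b0 horner_coef0 (polyOverP PS).
have [|a aS ha] := isolated_value algS b_sep b0 (O := O).
  move=> s /b_conj[|h]; first by left.
  by right; apply/negP => /(eqv_trans h); rewrite ltv_eqF.
have x_sep := simple_ext_sep xSb; have [xs [_ xxs _ xs_conj]] := exists_conj_seq algS x_sep.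
have [m hm] := exists_pow_value_neq xs x0 b0 b_max.
have zSb : b ^+ m * x \in Sb by rewrite rpredM ?rpredX ?mem_simple_ext.
have z0 : b ^+ m * x != 0 by rewrite mulf_neq0 ?expf_neq0.
have [|a' a'S ha'] := isolated_value algS (simple_ext_sep zSb) z0 (O := O).
  move=> s sS; have [sb|sb] := b_conj sS; first by left; exact: simple_ext_fixed sb zSb.
  right; rewrite rmorphM rmorphXn; have sx_xs : s x \in xs by apply/(xs_conj x) => //; exists s.
  apply: contra (hm _ sx_xs) => h; rewrite eqv_sym; apply: eqv_trans h.
  by rewrite -{1}[s x]mul1r eqvM // eqv1X.
exists (a' / a ^+ m); first by rewrite rpred_div ?rpredX.
rewrite -[x](mulKf (expf_neq0 m b0)) mulrC; apply: eqvM => //.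
by apply/eqvV/eqvX.
Qed.

Section Conjugates.
Variable rs : seq L.
Hypothesis rsP : conj_seq S b rs.
Let f := \prod_(r <- rs) ('X - r%:P).
Let rs_uniq : uniq rs. Proof. by case: rsP. Qed.
Let b_rs : b \in rs. Proof. by case: rsP. Qed.
Let f_minpoly : is_minpoly S b f. Proof. by case: rsP. Qed.

Lemma hensel_conj_lev1 r : r \in rs -> r = b \/ 1 =v r.
Proof.
case: rsP => _ _ _ conj /(conj b _ b_rs)[s /b_conj[->|h] <-]; [by left | by right].
Qed.

Let rs_lev1 r : r \in rs -> 1 <=v r.
Proof. by case/hensel_conj_lev1 => [->|/eqv_le//]; exact: ltvW. Qed.

Lemma polyOver_int_prod (ts : seq L) : {in ts, forall r, 1 <=v r} ->
  \prod_(r <- ts) ('X - r%:P) \is a polyOver (int_pred O (full_subfield L)).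
Proof.
move=> h; rewrite big_seq; apply: rpred_prod => r /h hr.
by rewrite polyOverXsubC; apply/int_predP.
Qed.

Lemma hensel_minpoly_int : f \is a polyOver intS.
Proof.
by case: f_minpoly => _ fS _ _; apply: polyOver_intI fS _; exact: polyOver_int_prod.
Qed.

Lemma hensel_deriv : 1 =v f^`().[b].
Proof.
rewrite deriv_prod_XsubC // horner_prod; apply: eqv1_prod => r.
rewrite mem_rem_uniq // inE => /andP[r_neq_b /hensel_conj_lev1[e|h]].
  by rewrite e eqxx in r_neq_b.
rewrite hornerXsubC; apply: (eqv_trans h); rewrite -eqvN opprB.
by apply: eqv_addr; rewrite ltvN -(eqv_ltl _ h).
Qed.

(* Euler's formula: f' (b) maps the elements with integral conjugates into O_S[b]. *)
Lemma hensel_codifferent w : w \in Sb -> (forall s, {in S, s =1 id} -> 1 <=v s w) ->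
  exists2 P, P \is a polyOver intS & P.[b] = w * f^`().[b].
Proof.
move=> /simple_extP[W WS eW] w_int; have [fm fS rf _] := f_minpoly.
have dS : f^`() \is a polyOver S by exact: polyOver_deriv.
have [q [P [_ PS eP sP]]] :=
  polyOver_division (subfield_type S) fm fS (rpredM WS dS).
have Pr r : r \in rs -> P.[r] = W.[r] * f^`().[r].
  move=> r_rs; rewrite -hornerM eP hornerD hornerM.
  have /rootP -> : root f r by rewrite root_prod_XsubC.
  by rewrite mulr0 add0r.
exists P; last by rewrite Pr // eW.
apply: polyOver_intI PS _.
rewrite (interpolation_cofactor rs_uniq (c := fun r => W.[r]) _ Pr); last first.
  by rewrite -ltnS -(size_prod_XsubC rs id).
rewrite big_seq; apply: rpred_sum => r r_rs; rewrite -mul_polyC; apply: rpredM.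
  rewrite polyOverC; apply/int_predP; split=> //.
  case: (rsP) => _ _ _ conj; have /(conj b _ b_rs)[s sS <-] := r_rs.
  have -> : W.[s b] = s w by rewrite eW -horner_map (polyOver_fixed sS WS).
  exact: w_int.
by apply: polyOver_int_prod => t /mem_rem/rs_lev1.
Qed.

Lemma hensel_denominator x : x \in Sb -> 1 <=v x -> exists q,
  [/\ q \in Sb, 1 =v q, (forall s, {in S, s =1 id} -> 1 <=v s q^-1) &
      forall s, {in S, s =1 id} -> 1 <=v s (x / q)].
Proof.
move=> xSb x1; have [xs [_ xxs _ xs_conj]] := exists_conj_seq algS (simple_ext_sep xSb).
have [k xs_unit] := exists_quad_iter_unit xs; exists (1 + quad_iter k x).
set q := 1 + _; have q1 : 1 =v q by exact: xs_unit.
have sq0 s : s q != 0 by rewrite fmorph_eq0 (eqv1_neq0 q1).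
have sq s : {in S, s =1 id} -> (1 =v s q /\ 1 <=v s x) \/ (s q <=v s x /\ s q <v 1).
  move=> sS; have sx_xs : s x \in xs by apply/(xs_conj x) => //; exists s.
  have -> : s q = 1 + quad_iter k (s x) by rewrite rmorphD rmorph1 quad_iter_morph.
  have [h|h] := boolP (1 <=v s x); [by left; rewrite xs_unit | right].
  have lex := quad_iter_le k h; have lt1 := lev_lt_trans lex h.
  by rewrite addrC -(eqv_lel _ (eqv_addr lt1)) -(eqv_ltl _ (eqv_addr lt1)) lex lt1.
split=> // [|s sS|s sS]; first by rewrite rpredD ?rpred1 ?quad_iter_mem.
  rewrite fmorphV -[1]invr1 lev_pV2 ?oner_neq0 ?sq0 //.
  by case: (sq s sS) => [[/eqv_ge]|[_ /ltvW]].
by rewrite fmorph_div lev1_div ?sq0 //; case: (sq s sS) => [[/eqv_ge h /(lev_trans h)]|[]].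
Qed.

Lemma hensel_frac x : x \in Sb -> 1 <=v x -> exists P g,
  [/\ P \is a polyOver intS, g \is a polyOver intS, 1 =v g.[b] & x = P.[b] / g.[b]].
Proof.
move=> xSb x1; have [q [qSb q1 invq_int xq_int]] := hensel_denominator xSb x1.
have [|g gA eg] := hensel_codifferent _ invq_int; first by rewrite rpredV.
have [|P PA eP] := hensel_codifferent _ xq_int; first by rewrite rpred_div.
have d1 := hensel_deriv; exists P, g; split=> //; first by rewrite eg eqv1M ?eqv1V.
by rewrite eP eg; field; rewrite (eqv1_neq0 d1) (eqv1_neq0 q1).
Qed.

End Conjugates.

Lemma hensel_etale_generator : exists f : {poly int_type O S}, etale_generator algS b f.
Proof.
have [rs rsP] := exists_conj_seq algS b_sep; have [_ _ f_minpoly _] := rsP.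
have [f _ hf] := etale_generator_intro f_minpoly (hensel_minpoly_int rsP)
  (ltvW b_max) (hensel_deriv rsP) (hensel_frac rsP) hensel_value.
by exists f.
Qed.

End HenselElement.

(** * Radical generators *)

Section ValueGroupConditions.
Variables (F : fieldType) (O : vring F) (p : nat).
Hypothesis p_prime : prime p.
Local Notation "x <=v y" := (lev O x y).
Local Notation "x <v y" := (ltv O x y).
Local Notation "x =v y" := (eqv O x y).
Let p_gt0 := prime_gt0 p_prime.

(* p-divisibility of the convex subgroup generated by v p, or of the whole value
   group if p = 0, since then every nonzero x satisfies x <v p ^ 1. *)
Definition vp_pdiv (S : {pred F}) := forall x, x \in S -> x != 0 -> 1 <=v x ->
  (exists n, x <v p%:R ^+ n) -> exists2 y, y \in S & x =v y ^+ p.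

Lemma vgroup_pdiv_vp_pdiv S : vgroup_pdiv O p S -> vp_pdiv S.
Proof. by move=> h x xS x0 _ _; exact: h. Qed.

Lemma coprime_value_root (S : subfieldOf F) m x y : (0 < m)%N -> coprime m p ->
  x \in S -> x != 0 -> y \in S -> x ^+ m =v y ^+ p ->
  exists2 z, z \in S & x =v z ^+ p.
Proof.
move=> m0 cop xS x0 yS h; have [u v e _] := egcdnP p m0.
exists (y ^+ u / x ^+ v); first by rewrite rpred_div ?rpredX.
have ex : x = x ^+ (u * m) / x ^+ (v * p).
  by rewrite e (eqP cop) exprD expr1 mulrC mulKf ?expf_neq0.
rewrite {1}ex expr_div_n -!exprM; apply: eqvM; last exact: eqv_refl.
by rewrite mulnC exprM [(u * p)%N]mulnC [y ^+ _]exprM; exact: eqvX.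
Qed.

Section FrobeniusSurjective.
Variable S : subfieldOf F.
Hypothesis surjS : frob_surj O p S.

Lemma frob_surj_value_root x : x \in S -> x != 0 -> 1 <=v x -> x <v p%:R ->
  exists2 y, y \in S & x =v y ^+ p.
Proof.
move=> xS x0 x1 xp; have [y yS hy] := surjS xS x0 x1 xS x1; exists y => //.
by apply: eqv_subl; case/orP: hy => [|//]; exact: ltv_le_trans.
Qed.

(* Neither x0 nor p / x0 has value at least v p, so that both values are divisible
   by p, as well as their sum v p. *)
Lemma frob_surj_p_root : vp_not_min O p S -> p%:R != 0 :> F ->
  exists2 y, y \in S & p%:R =v y ^+ p.
Proof.
move=> [e|[x0 x0S /andP[x0_max x0p]]] p0; first by rewrite e eqxx in p0.
have x0_neq0 := ltv_neq0 x0p.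
have [y0 y0S hy0] := frob_surj_value_root x0S x0_neq0 (ltvW x0_max) x0p.
have [||||y1 y1S hy1] := @frob_surj_value_root (p%:R / x0).
- by rewrite rpred_div ?rpred_nat.
- by rewrite mulf_neq0 ?invr_eq0.
- by rewrite lev1_div // ltvW.
- by rewrite -(ltvM2r _ _ _ x0_neq0) divfK // -{1}[p%:R]mulr1 ltvM2l.
exists (y0 * y1); first exact: rpredM.
by rewrite exprMn -[p%:R](divfK x0_neq0) mulrC; exact: eqvM.
Qed.

Lemma frob_surj_vp_pdiv : vp_not_min O p S -> vp_pdiv S.
Proof.
move=> not_min x xS x0 x1 [n hn]; have [p0|p0] := eqVneq (p%:R : F) 0.
  by apply: frob_surj_value_root => //; rewrite p0 ltvr0.
have [z zS hz] := frob_surj_p_root not_min p0.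
elim: n x xS x0 x1 hn => [|n IH] x xS x0 x1 hn.
  by move: hn; rewrite expr0 ltvNge x1.
have [lt|] := boolP (x <v p%:R); first exact: frob_surj_value_root.
rewrite -levNgt => le; have [||||y yS hy] := IH (x / p%:R).
- by rewrite rpred_div ?rpred_nat.
- by rewrite mulf_neq0 ?invr_eq0.
- by rewrite lev1_div.
- by rewrite -(ltvM2r _ _ _ p0) divfK // -exprSr.
exists (y * z); first exact: rpredM.
by rewrite exprMn -[x](divfK p0); exact: eqvM.
Qed.

End FrobeniusSurjective.

Lemma vp_pdiv_not_min (S : subfieldOf F) : 1 <v p%:R -> vp_pdiv S -> vp_not_min O p S.
Proof.
move=> p_max pdiv; have [e|p0] := eqVneq (p%:R : F) 0; [by left | right].
have [||||y yS hy] := pdiv p%:R.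
- exact: rpred_nat.
- exact: p0.
- exact: ltvW.
- by exists 2; rewrite expr2 -{1}[p%:R]mulr1 ltvM2l.
have y_max : 1 <v y by rewrite -(ltv_pX2r _ _ _ p_gt0) expr1n -(eqv_ltr _ hy).
have y0 := eqvX_neq0 p_gt0 p0 hy.
exists y => //; rewrite y_max (eqv_ltr _ hy) -(prednK p_gt0) exprS -{1}[y]mulr1 ltvM2l //.
by rewrite -(expr1n _ p.-1) ltvX // -ltnS prednK // prime_gt1.
Qed.

End ValueGroupConditions.

Lemma lev_sum_distinct_values (F : fieldType) (O : vring F) (S : subfieldOf F)
    (g s : nat -> F) n :
  (forall i j a, (i < j < n)%N -> a \in S -> ~~ eqv O (g i * a) (g j)) ->
  (forall i, s i \in S) -> forall i, (i < n)%N -> lev O (\sum_(j < n) s j * g j) (s i * g i).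
Proof.
move=> hg sS i hi; have n0 : (0 < n)%N by case: (n) hi.
have [k hk kmin] := ex_minv O (fun j => s j * g j) n0.
have [e|t0] := eqVneq (s k * g k) 0.
  by move: (kmin _ hi); rewrite e lev0r => /eqP ->; exact: levr0.
have sep j : (j < n)%N -> j != k -> ltv O (s k * g k) (s j * g j).
  move=> hj jk; rewrite ltvNge; apply/negP => h.
  have e : eqv O (s j * g j) (s k * g k) by rewrite /eqv h kmin.
  have sj0 : s j != 0.
    by apply: contraNneq t0 => e0; rewrite -(eqv_eq0 e) e0 mul0r.
  have sk0 : s k != 0 by apply: contraNneq t0 => ->; rewrite mul0r.
  case: (ltngtP j k) => [lt|lt|ejk]; last by rewrite ejk eqxx in jk.
    suff : eqv O (g j * (s j / s k)) (g k).
      by apply/negP; apply: hg; [rewrite lt hk | rewrite rpred_div].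
    by rewrite -(eqvM2l _ _ _ sk0) mulrCA (mulrC (s k)) divfK // mulrC.
  suff : eqv O (g k * (s k / s j)) (g j).
    by apply/negP; apply: hg; [rewrite lt hj | rewrite rpred_div].
  by rewrite -(eqvM2l _ _ _ sj0) mulrCA (mulrC (s j)) divfK // mulrC eqv_sym.
apply: lev_trans (kmin _ hi); rewrite (bigD1 (Ordinal hk)) //=.
by apply/eqv_ge/eqv_addr; apply: ltv_sum => // j jk; exact: sep.
Qed.

Definition radical_generator (L : fieldType) (O : vring L) (S : subfieldOf L) (p : nat)
    (b : L) (n : nat) :=
  [/\ (0 < n)%N, coprime n p, b != 0, b ^+ n \in S &
      forall i a, (0 < i < n)%N -> a \in S -> ~~ eqv O (b ^+ i) a].

Section RadicalStep.
Variables (L : closedFieldType) (O : vring L) (S : subfieldOf L).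
Hypothesis algS : forall x, algebraicOver (subfield_val S) x.
Local Notation "x <=v y" := (lev O x y).
Local Notation "x <v y" := (ltv O x y).
Local Notation "x =v y" := (eqv O x y).
Variables (p : nat) (b : L) (n : nat).
Hypotheses (p_prime : prime p) (b_radical : radical_generator O S p b n).
Local Notation Sb := (simple_ext algS b).
Let n_gt0 : (0 < n)%N. Proof. by case: b_radical. Qed.
Let np_coprime : coprime n p. Proof. by case: b_radical. Qed.
Let b0 : b != 0. Proof. by case: b_radical. Qed.
Let bnS : b ^+ n \in S. Proof. by case: b_radical. Qed.
Let b_indep i a : (0 < i < n)%N -> a \in S -> ~~ (b ^+ i =v a).
Proof. by case: b_radical => _ _ _ _; apply. Qed.

Lemma radical_horner_le k P : coprime k n -> P \is a polyOver S -> (size P <= n)%N ->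
  forall i, P.[b ^+ k] <=v P`_i * b ^+ (k * i).
Proof.
move=> kn PS sP i; have [hin|hin] := ltnP i n; last first.
  by rewrite nth_default ?(leq_trans sP) // mul0r levr0.
rewrite (horner_coef_wide _ sP); under eq_bigr do rewrite -exprM.
apply: (lev_sum_distinct_values (S := S) (g := fun i => b ^+ (k * i)) (s := fun i => P`_i)) => //;
  last by move=> j; exact: (polyOverP PS).
move=> i1 j1 a /andP[lt jn] aS; rewrite -(subnKC (ltnW lt)) mulnDr exprD eqvM2l ?expf_neq0 //.
set d := (k * (j1 - i1))%N; have r_gt0 : (0 < d %% n)%N.
  rewrite lt0n; apply/negP => /eqP hd; have : (n %| d)%N by rewrite /dvdn hd.
  rewrite /d Gauss_dvdr; last by rewrite coprime_sym.
  by rewrite gtnNdvd ?subn_gt0 //; exact: leq_ltn_trans (leq_subr _ _) jn.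
have qS : a / (b ^+ n) ^+ (d %/ n) \in S by apply: rpred_div => //; exact: rpredX.
have := b_indep (i := (d %% n)%N) _ qS; rewrite r_gt0 ltn_mod n_gt0 => /(_ isT); apply: contra => e.
rewrite -(eqvM2r _ _ _ (expf_neq0 (d %/ n) (expf_neq0 n b0))) divfK ?expf_neq0 //.
by rewrite -exprM -exprD addnC mulnC -divn_eq eqv_sym.
Qed.

Lemma radical_span k x : x \in simple_ext algS (b ^+ k) ->
  exists P, [/\ P \is a polyOver S, (size P <= n)%N & x = P.[b ^+ k]].
Proof.
pose f := 'X^n - (b ^+ (n * k))%:P.
have fS : f \is a polyOver S by rewrite rpredB ?rpredX ?polyOverX ?polyOverC // exprM rpredX.
have rf : root f (b ^+ k) by rewrite rootE hornerD hornerN hornerXn hornerC -exprM mulnC subrr.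
move/(simple_ext_span (monicXnsubC _ n_gt0) fS rf) => [P []].
by rewrite size_XnsubC // ltnS; exists P.
Qed.

Lemma radical_basis x : x \in Sb -> exists P, [/\ P \is a polyOver S, (size P <= n)%N,
  x = P.[b] & forall i, x <=v P`_i * b ^+ i].
Proof.
move=> xSb; have [|P [PS sP ->]] := @radical_span 1 x; rewrite expr1 //.
exists P; split=> // i.
by have := radical_horner_le (coprime1n n) PS sP i; rewrite expr1 mul1n.
Qed.

Lemma radical_ext_exp : {subset Sb <= simple_ext algS (b ^+ p)}.
Proof.
apply: simple_ext_min => [|]; first exact: simple_ext_sub.
have [u v e _] := egcdnP n (prime_gt0 p_prime).
have eb : b = (b ^+ p) ^+ u / (b ^+ n) ^+ v.
  have gcd1 : gcdn p n = 1%N by rewrite gcdnC; exact/eqP.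
  by rewrite -!exprM mulnC e gcd1 exprD expr1 [(n * v)%N]mulnC mulrC mulKf ?expf_neq0.
rewrite [X in X \in _]eb; apply: rpred_div; apply: rpredX; first exact: mem_simple_ext.
exact: simple_ext_sub.
Qed.

Lemma radical_value x : x \in Sb -> x != 0 -> exists2 a, a \in S & a =v x ^+ n.
Proof.
move=> /radical_basis[P [PS sP ex le_term]] x0; have [i hi] : exists i, P`_i * b ^+ i <=v x.
  apply: contrapT => h; suff : x <v x by rewrite ltvv.
  rewrite {2}ex horner_coef; apply: ltv_sum => // i _.
  by rewrite ltvNge; apply/negP => hi; apply: h; exists i.
have e : P`_i * b ^+ i =v x by rewrite /eqv hi le_term.
exists (P`_i ^+ n * (b ^+ n) ^+ i).
  by apply: rpredM; apply: rpredX => //; exact: (polyOverP PS).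
by rewrite exprAC -exprMn; exact: eqvX.
Qed.

Section NearPthRoots.
Variable c : L.
Hypothesis c1 : 1 <=v c.

Lemma radical_near_pth_descent a :
  a \in S -> 1 <=v a -> near_pth O p Sb c a -> near_pth O p S c a.
Proof.
move=> aS a1 [x /radical_basis[P [PS sP ex le_term]] hx].
have term i := lev_trans (near_pth_lev1 p_prime c1 a1 hx) (le_term i).
pose Q := a%:P - \poly_(i < n) (P`_i ^+ p).
have QS : Q \is a polyOver S.
  rewrite rpredB ?polyOverC //; apply/polyOverP => i; rewrite coef_poly.
  by case: ifP => _; rewrite ?rpred0 ?rpredX // (polyOverP PS).
have sQ : (size Q <= n)%N.
  apply: leq_trans (size_polyD _ _) _; rewrite size_polyN geq_max size_poly andbT.
  exact: leq_trans (size_polyC_leq1 _) n_gt0.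
have eQ : Q.[b ^+ p] = a - \sum_(i < n) (P`_i * b ^+ i) ^+ p.
  rewrite hornerD hornerN hornerC horner_poly; congr (_ - _); apply: eq_bigr => i _.
  by rewrite exprMn exprAC.
have Q0 : Q`_0 * b ^+ (p * 0) = a - P`_0 ^+ p.
  by rewrite muln0 expr0 mulr1 coefB coefC coef_poly n_gt0.
exists P`_0; first exact: (polyOverP PS).
have pn : coprime p n by rewrite coprime_sym.
rewrite -Q0; apply: negligible_le (radical_horner_le pn QS sQ 0) _; rewrite eQ.
have -> : a - \sum_(i < n) (P`_i * b ^+ i) ^+ p = (a - x ^+ p) +
   (x ^+ p - \sum_(i < n) (P`_i * b ^+ i) ^+ p) by ring.
apply: negligibleD => //; apply: negligible_lep; rewrite ex (horner_coef_wide _ sP).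
exact: (lev_exprp_sum p_prime n term).
Qed.

Hypothesis surjS : forall a, a \in S -> 1 <=v a -> near_pth O p S c a.
Hypothesis pdivS : vp_pdiv O p S.

Lemma radical_near_pth_monomial s i : s \in S -> 1 <=v s * b ^+ (p * i) ->
  near_pth O p Sb c (s * b ^+ (p * i)).
Proof.
set t := _ * _ => sS t1; have p_gt0 := prime_gt0 p_prime.
have [t_negl|] := boolP (negligible O p c t).
  by exists 0; rewrite ?rpred0 // expr0n gtn_eqF // subr0.
rewrite /negligible negb_or => /andP[tp _].
have t0 : t != 0 by apply: contraNneq tp => ->; exact: levr0.
have s0 : s != 0 by apply: contraNneq t0 => e; rewrite /t e mul0r.
have tnE : t ^+ n = s ^+ n * ((b ^+ n) ^+ i) ^+ p.
  by rewrite /t exprMn [in LHS]exprAC [(p * i)%N]mulnC exprM.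
have tnS : t ^+ n \in S by rewrite tnE; apply: rpredM; [exact: rpredX | exact/rpredX/rpredX].
have [||y yS hy] := pdivS tnS (expf_neq0 n t0); first exact: lev1X.
  by exists n; rewrite ltvX.
have bn0 : b ^+ n != 0 by rewrite expf_neq0.
have [||z zS hz] := @coprime_value_root _ O p S n s (y / (b ^+ n) ^+ i) n_gt0 np_coprime sS s0.
- by apply: rpred_div => //; exact: rpredX.
- by rewrite expr_div_n -(eqvM2r _ _ _ (expf_neq0 p (expf_neq0 i bn0))) divfK ?expf_neq0 // -tnE.
have z0 := eqvX_neq0 p_gt0 s0 hz; have zp0 := expf_neq0 p z0.
have [||a aS ha] := @surjS (s / z ^+ p).
- by rewrite rpred_div ?rpredX.
- by rewrite lev1_div // eqv_ge.
exists (z * a * b ^+ i); first by rewrite !rpredM ?rpredX ?mem_simple_ext ?simple_ext_sub.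
have -> : t - (z * a * b ^+ i) ^+ p = (s / z ^+ p - a ^+ p) * (z ^+ p * b ^+ (p * i)).
  rewrite /t !exprMn -exprM [(i * p)%N]mulnC; field.
  by rewrite zp0.
apply: negligibleMr ha; apply: lev_trans t1 _; apply: levM; last exact: lev_refl.
exact: eqv_le.
Qed.

Lemma radical_near_pth x : x \in Sb -> 1 <=v x -> near_pth O p Sb c x.
Proof.
move=> /radical_ext_exp/radical_span[P [PS sP ex]] x1.
have pn : coprime p n by rewrite coprime_sym.
have term i : 1 <=v P`_i * b ^+ (p * i).
  by apply: lev_trans x1 _; rewrite ex radical_horner_le.
rewrite ex horner_coef; apply: near_pth_sum => // i; rewrite -exprM //.
by apply: radical_near_pth_monomial (term i); exact: (polyOverP PS).
Qed.

End NearPthRoots.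
End RadicalStep.

(** * Transfer of the conditions *)

Section TameTransfer.
Variables (L : closedFieldType) (O : vring L) (p : nat).
Local Notation "x <=v y" := (lev O x y).
Local Notation "x <v y" := (ltv O x y).
Local Notation "x =v y" := (eqv O x y).
Hypotheses (p_prime : prime p) (p_residue : 1 <v p%:R).
Implicit Types K S T : subfieldOf L.
Let p_gt0 := prime_gt0 p_prime.

Definition value_torsion K S := forall x, x \in S -> x != 0 ->
  exists m, [/\ (0 < m)%N, coprime m p & exists2 a, a \in K & a =v x ^+ m].

Record tame_transfer K S : Prop := TameTransfer {
  transfer_sub : {subset K <= S};
  transfer_torsion : value_torsion K S;
  transfer_descent : forall c a, c \in K -> 1 <=v c -> a \in K -> 1 <=v a ->
    near_pth O p S c a -> near_pth O p K c a;
  transfer_ascent : vp_pdiv O p K -> frob_surj O p K -> frob_surj O p S }.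

Lemma frob_surj_cofinal K S : value_torsion K S ->
  (forall c a, c \in K -> c != 0 -> 1 <=v c -> a \in S -> 1 <=v a -> near_pth O p S c a) ->
  frob_surj O p S.
Proof.
move=> torsion surj c a cS c0 c1 aS a1.
have [m [m_gt0 _ [d dK hd]]] := torsion c cS c0.
have [||y yS hy] := surj d a dK _ _ aS a1.
- by rewrite (eqv_eq0 hd) expf_neq0.
- by rewrite (eqv_ler _ hd) lev1X.
exists y => //; apply: negligible_lel hy.
by rewrite (eqv_ler _ hd) -(prednK m_gt0) lev_exprS.
Qed.

Section Consequences.
Variables (K S : subfieldOf L).
Hypothesis transfer : tame_transfer K S.
Let KS := transfer_sub transfer.

Lemma value_root_ascent x m a y : (0 < m)%N -> coprime m p -> x \in S -> x != 0 ->
  a =v x ^+ m -> y \in K -> a =v y ^+ p -> exists2 z, z \in S & x =v z ^+ p.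
Proof.
move=> m_gt0 cop xS x0 ax yK ay; apply: (coprime_value_root m_gt0 cop xS x0 (KS yK)).
by apply: eqv_trans ay; rewrite eqv_sym.
Qed.

Lemma value_root_descent x y : x \in K -> x != 0 -> y \in S -> x =v y ^+ p ->
  exists2 z, z \in K & x =v z ^+ p.
Proof.
move=> xK x0 yS xy; have y0 := eqvX_neq0 p_gt0 x0 xy.
have [m [m_gt0 cop [a aK ay]]] := transfer_torsion transfer yS y0.
apply: (coprime_value_root m_gt0 cop xK x0 aK); apply: eqv_trans (eqvX m xy) _.
by rewrite exprAC eqv_sym; exact: eqvX.
Qed.

Lemma tame_transfer_vp_pdiv : vp_pdiv O p S <-> vp_pdiv O p K.
Proof.
split=> pdiv x.
  move=> xK x0 x1 hn; have [y yS xy] := pdiv x (KS xK) x0 x1 hn.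
  exact: value_root_descent yS xy.
move=> xS x0 x1 [n hn]; have [m [m_gt0 cop [a aK ax]]] := transfer_torsion transfer xS x0.
have [|||y yK ay] := pdiv a aK.
- by rewrite (eqv_eq0 ax) expf_neq0.
- by rewrite (eqv_ler _ ax) lev1X.
- by exists (n * m)%N; rewrite (eqv_ltl _ ax) exprM ltvX.
exact: value_root_ascent ax yK ay.
Qed.

Lemma tame_transfer_vgroup_pdiv : vgroup_pdiv O p S <-> vgroup_pdiv O p K.
Proof.
split=> pdiv x.
  move=> xK x0; have [y yS xy] := pdiv x (KS xK) x0.
  exact: value_root_descent yS xy.
move=> xS x0; have [m [m_gt0 cop [a aK ax]]] := transfer_torsion transfer xS x0.
have [|y yK ay] := pdiv a aK; first by rewrite (eqv_eq0 ax) expf_neq0.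
exact: value_root_ascent ax yK ay.
Qed.

Lemma tame_transfer_frob_surj_descent : frob_surj O p S -> frob_surj O p K.
Proof.
move=> surj c a cK c0 c1 aK a1; apply: (transfer_descent transfer) => //.
by apply: surj => //; exact: KS.
Qed.

Lemma tame_transfer_gdr : (frob_surj O p S /\ vp_not_min O p S) <->
  (frob_surj O p K /\ vp_not_min O p K).
Proof.
split=> -[surj /(frob_surj_vp_pdiv surj) pdiv].
  split; first exact: tame_transfer_frob_surj_descent.
  by apply: vp_pdiv_not_min => //; exact/tame_transfer_vp_pdiv.
split; first exact: (transfer_ascent transfer).
by apply: vp_pdiv_not_min => //; exact/tame_transfer_vp_pdiv.
Qed.

Lemma tame_transfer_semitame : (frob_surj O p S /\ vgroup_pdiv O p S) <->
  (frob_surj O p K /\ vgroup_pdiv O p K).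
Proof.
split=> -[surj pdiv].
  by split; [exact: tame_transfer_frob_surj_descent | exact/tame_transfer_vgroup_pdiv].
split; last exact/tame_transfer_vgroup_pdiv.
exact: (transfer_ascent transfer) (vgroup_pdiv_vp_pdiv pdiv) surj.
Qed.

End Consequences.

Lemma tame_transfer_refl K : tame_transfer K K.
Proof.
split=> // x xK x0; exists 1%N; rewrite coprime1n; split=> //.
by exists x => //; exact: eqv_refl.
Qed.

Lemma value_torsion_trans K S T : value_torsion K S -> value_torsion S T -> value_torsion K T.
Proof.
move=> KS ST x xT x0; have [m [m_gt0 cop [a aS ax]]] := ST x xT x0.
have [|n [n_gt0 cop' [d dK da]]] := KS a aS; first by rewrite (eqv_eq0 ax) expf_neq0.
exists (m * n)%N; rewrite muln_gt0 m_gt0 coprimeMl cop; split=> //; exists d => //.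
by apply: eqv_trans da _; rewrite exprM; exact: eqvX.
Qed.

Lemma tame_transfer_trans K S T :
  tame_transfer K S -> tame_transfer S T -> tame_transfer K T.
Proof.
move=> KS ST; have subKS := transfer_sub KS; split.
- by move=> x /subKS/(transfer_sub ST).
- exact: value_torsion_trans (transfer_torsion KS) (transfer_torsion ST).
- move=> c a cK c1 aK a1 /(transfer_descent ST (subKS _ cK) c1 (subKS _ aK) a1).
  exact: (transfer_descent KS).
move=> pdiv surj; apply: (transfer_ascent ST).
  exact/(tame_transfer_vp_pdiv KS).
exact: (transfer_ascent KS).
Qed.

Section Steps.
Variable S : subfieldOf L.
Hypothesis algS : forall x, algebraicOver (subfield_val S) x.

Lemma tame_transfer_etale b (f : {poly int_type O S}) :
  etale_generator algS b f -> tame_transfer S (simple_ext algS b).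
Proof.
move=> f_etale; have torsion : value_torsion S (simple_ext algS b).
  move=> x xSb x0; exists 1%N; rewrite coprime1n; split=> //.
  exact: etale_value f_etale x xSb x0.
split=> //; first exact: simple_ext_sub.
  move=> c a _ c1 aS a1 [x xSb hx]; have a_int : a \in int_pred O S by apply/int_predP.
  exact: (etale_near_pth_descent p_prime p_residue c1 f_etale (a := Sub a a_int) xSb hx).
move=> _ surj; apply: (frob_surj_cofinal torsion) => c x cS c0 c1 xSb.
by apply: (etale_near_pth p_prime p_residue c1 f_etale _ xSb) => a aS; exact: surj cS c0 c1 aS.
Qed.

Lemma tame_transfer_radical b n :
  radical_generator O S p b n -> tame_transfer S (simple_ext algS b).
Proof.
move=> b_radical; have [n_gt0 cop _ _ _] := b_radical.
have torsion : value_torsion S (simple_ext algS b).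
  by move=> x xSb x0; exists n; split=> //; exact: radical_value b_radical x xSb x0.
split=> //; first exact: simple_ext_sub.
  by move=> c a _ c1 aS a1; exact: (radical_near_pth_descent p_prime b_radical c1 aS a1).
move=> pdiv surj; apply: (frob_surj_cofinal torsion) => c x cS c0 c1 xSb.
by apply: (radical_near_pth p_prime b_radical c1 _ _ xSb) => // a aS; exact: surj cS c0 c1 aS.
Qed.

End Steps.

Lemma tame_transfer_union K (C : subfieldOf L -> Prop) U : is_chain C -> is_union C U ->
  (forall S, C S -> tame_transfer K S) -> tame_transfer K U.
Proof.
move=> chC unionU CK; have [[S0 CS0] _] := chC.
have subU S : C S -> {subset S <= U} by exact: is_union_sub.
split.
- by move=> x xK; apply: (subU S0) => //; exact: (transfer_sub (CK S0 CS0)).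
- by move=> x /unionU[S CS xS]; exact: (transfer_torsion (CK S CS)).
- move=> c a cK c1 aK a1 [y /unionU[S CS yS] hy].
  by apply: (transfer_descent (CK S CS)) => //; exists y.
move=> pdiv surj c a /unionU cU c0 c1 /unionU aU a1.
have [S [CS cS aS]] := is_chain_common chC cU aU.
have [y yS hy] := transfer_ascent (CK S CS) pdiv surj cS c0 c1 aS a1.
by exists y => //; exact: subU yS.
Qed.

End TameTransfer.

(** * Tamely closed subfields *)

Section ResiduePolynomials.
Variables (L : fieldType) (O : vring L) (S : subfieldOf L).
Local Notation "x <=v y" := (lev O x y).
Local Notation "x <v y" := (ltv O x y).
Local Notation "x =v y" := (eqv O x y).
Local Notation intS := (int_pred O S).

Lemma exists_content (P : {poly L}) : P \is a polyOver S -> P != 0 -> exists a,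
  [/\ a \in S, a != 0, a^-1 *: P \is a polyOver intS & exists i, 1 =v (a^-1 *: P)`_i].
Proof.
move=> PS P0; have P_gt0 : (0 < size P)%N by rewrite size_poly_gt0.
have [k hk kmin] := ex_minv O (fun i => P`_i) P_gt0.
have k0 : P`_k != 0.
  apply: contraNneq P0 => e; rewrite -lead_coef_eq0 lead_coefE.
  by have := kmin (size P).-1; rewrite e prednK // leqnn lev0r; apply.
exists P`_k; split=> //; first exact: (polyOverP PS).
  apply/polyOverP => j; rewrite coefZ mulrC; apply/int_predP.
  rewrite rpred_div ?(polyOverP PS) // lev1_div //; split=> //.
  have [hj|hj] := ltnP j (size P); first exact: kmin.
  by rewrite [P`_j]nth_default // levr0.
by exists k; rewrite coefZ mulVf // eqv_refl.
Qed.

(* The residue of x is a root of a monic polynomial of degree less than n over the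
   residue field of S. *)
Definition residue_root n x := exists g : {poly L},
  [/\ g \is monic, g \is a polyOver intS, (size g <= n)%N & 1 <v g.[x]].

Lemma primitive_residue_root n (P : {poly L}) x : 1 <=v x -> P \is a polyOver intS ->
  (size P <= n)%N -> (exists i, 1 =v P`_i) -> 1 <v P.[x] -> residue_root n x.
Proof.
move=> hx; elim: n P => [|n IH] P PA sP [i hi] hP.
  by move: sP hi; rewrite leqn0 size_poly_eq0 => /eqP ->; rewrite coef0 => /eqv1_neq0; rewrite eqxx.
have /int_predP[PnS Pn1] := polyOverP PA n.
have [u|nu] := boolP (1 =v P`_n).
  have un := eqv1_neq0 u; have sz : size P = n.+1.
    apply/eqP; rewrite eqn_leq sP /= ltnNge; apply: contra un.
    by move/leq_sizeP/(_ n (leqnn n)) ->.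
  exists ((P`_n)^-1 *: P); split.
  - by rewrite monicE lead_coefZ lead_coefE sz mulVf.
  - apply/polyOverP => j; rewrite coefZ; have /int_predP[PjS Pj1] := polyOverP PA j.
    by apply/int_predP; rewrite rpredM ?rpredV // lev1M // eqv_le // eqv1V.
  - by rewrite size_scale ?invr_eq0 // sz.
  - by rewrite hornerZ ltvMl // eqv_le // eqv1V.
have hn : 1 <v P`_n by apply: contraNT nu; exact: eqv1_ltvN.
pose Q := \poly_(j < n) P`_j.
have eP : P = Q + P`_n *: 'X^n.
  apply/polyP => j; rewrite coefD coef_poly coefZ coefXn; case: (ltngtP j n) => hj.
  - by rewrite mulr0 addr0.
  - by rewrite mulr0 addr0 nth_default // (leq_trans sP).
  - by rewrite hj mulr1 add0r.
have [||||g [gm gA sg hg]] := IH Q; last by exists g; split=> //; exact: leqW.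
- apply/polyOverP => j; rewrite coef_poly; case: ifP => _; last exact: rpred0.
  exact: (polyOverP PA).
- exact: size_poly.
- exists i; rewrite coef_poly; case: ltnP => //; rewrite leq_eqVlt => /predU1P[e|h].
    by rewrite e hi in nu.
  by move: hi; rewrite nth_default ?(leq_trans sP) // => /eqv1_neq0; rewrite eqxx.
have -> : Q.[x] = P.[x] - P`_n * x ^+ n.
  have := congr1 (fun R : {poly L} => R.[x]) eP.
  by rewrite /= hornerD hornerZ hornerXn => ->; rewrite addrK.
by apply: ltvB => //; apply: ltvMr => //; exact: lev1X.
Qed.

Lemma horner_unit n x (P : {poly L}) : ~ residue_root n x -> 1 <=v x ->
  P \is a polyOver intS -> (size P <= n)%N -> (exists i, 1 =v P`_i) -> 1 =v P.[x].
Proof.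
move=> nroot hx PA sP hP; apply: eqv1_ltvN; first exact: lev1_horner PA hx.
by apply/negP => h; apply: nroot; exact: primitive_residue_root hP h.
Qed.

Lemma horner_content n x (P : {poly L}) : ~ residue_root n x -> 1 <=v x ->
  P \is a polyOver S -> (size P <= n)%N -> P != 0 -> exists a,
  [/\ a \in S, a != 0, a =v P.[x] & a^-1 *: P \is a polyOver intS].
Proof.
move=> nroot hx PS sP P0; have [a [aS a0 aP unit_coef]] := exists_content PS P0.
exists a; split=> //; have sQ : (size (a^-1 *: P) <= n)%N by rewrite size_scale ?invr_eq0.
have := horner_unit nroot hx aP sQ unit_coef.
by rewrite hornerZ mulrC eqv1_div // eqv_sym.
Qed.

Lemma residue_root_close n x y : 1 <=v x -> 1 <=v y -> 1 <v x - y ->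
  residue_root n x -> residue_root n y.
Proof.
move=> hx hy xy [g [gm gA sg gx]]; exists g; split=> //.
rewrite -[g.[y]](subKr g.[x]); apply: ltvB => //; apply: ltv_le_trans xy _.
exact: lev_hornerB gA hx hy.
Qed.

Variable p : nat.
Hypotheses (p_prime : prime p) (p_residue : 1 <v p%:R).

Lemma deriv_residue_coef n x (f : {poly L}) i : (forall m, (m < n)%N -> ~ residue_root m x) ->
  1 <=v x -> f \is monic -> f \is a polyOver intS -> size f = n -> 1 <v f^`().[x] ->
  ~~ (p %| i)%N -> 1 <v f`_i.
Proof.
move=> nroot hx fm fA sf dfx; have dA : f^`() \is a polyOver intS by exact: polyOver_deriv.
have f_gt0 : (0 < size f)%N by rewrite size_poly_gt0 monic_neq0.
case: i => [|i] pi; first by rewrite dvdn0 in pi.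
have df_i : 1 <v (f^`())`_i.
  apply: contraT => h; have : 1 =v f^`().[x].
    apply: (@horner_unit n.-1) => //; first by apply: (nroot n.-1); rewrite -sf ltn_predL.
      by rewrite -ltnS -sf prednK // lt_size_deriv // monic_neq0.
    by exists i; apply: eqv1_ltvN h; exact: polyOver_int_lev1 dA.
  by rewrite ltv_eqF.
have unit_i : 1 =v i.+1%:R.
  by apply: (coprime_eqv1 p_prime p_residue); rewrite coprime_sym prime_coprime.
by move: df_i; rewrite coef_deriv -mulr_natr -(eqv_ltr _ (eqvM (eqv_refl O _) unit_i)) mulr1.
Qed.

(* If the residue of f' vanishes at x, so that f is modulo the maximal ideal a
   polynomial g in X^p, then g is an equation of smaller degree for x^p. *)
Lemma inseparable_residue_root n x (f : {poly L}) :
  (forall m, (m < n)%N -> ~ residue_root m x) ->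
  1 <=v x -> f \is monic -> f \is a polyOver intS -> size f = n -> (1 < n)%N ->
  1 <v f.[x] -> 1 <v f^`().[x] -> exists2 m, (m < n)%N & residue_root m (x ^+ p).
Proof.
move=> nroot hx fm fA sf n_gt1 fx dfx.
have fM i := deriv_residue_coef nroot hx fm fA sf dfx (i := i).
have f_lead : f`_n.-1 = 1 by rewrite -sf -lead_coefE (monicP fm).
have [d ed] : exists d, n.-1 = (d * p)%N.
  apply/dvdnP; apply: contraT => /fM; rewrite f_lead ltvv //.
have d_gt0 : (0 < d)%N by move: n_gt1; rewrite -ltn_predRL ed muln_gt0 => /andP[].
pose g := \poly_(i < d.+1) f`_(i * p).
have gd : g`_d = 1 by rewrite coef_poly ltnSn -ed.
have sg : size g = d.+1.
  apply/eqP; rewrite eqn_leq size_poly ltnNge; apply/negP => /leq_sizeP/(_ d (leqnn d)) e.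
  by move: gd; rewrite e => /esym/eqP; rewrite oner_eq0.
exists d.+1; first by rewrite -ltn_predRL ed ltn_Pmulr ?prime_gt1.
exists g; split; rewrite ?sg //.
- by rewrite monicE lead_coefE sg gd.
- apply/polyOverP => i; rewrite coef_poly; case: ifP => _; last exact: rpred0.
  exact: (polyOverP fA).
have -> : g.[x ^+ p] = f.[x] - (f - (g \Po 'X^p)).[x].
  by rewrite hornerD hornerN horner_comp hornerXn opprB addrC subrK.
apply: ltvB => //; apply: ltv1_horner hx => i; rewrite coefB coef_comp_poly_Xn ?prime_gt0 //.
case: ifP => [/dvdnP[k ek]|/negbT/fM]; last by rewrite subr0.
suff -> : f`_i - g`_(i %/ p) = 0 by rewrite ltvr0 oner_neq0.
rewrite ek mulnK ?prime_gt0 // coef_poly; case: ltnP => hk; first by rewrite subrr.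
rewrite nth_default ?subrr // sf -(prednK (ltnW n_gt1)) ed.
by rewrite ltn_pmul2r ?prime_gt0.
Qed.

End ResiduePolynomials.

Lemma exists_root_close (L : closedFieldType) (O : vring L) (f : {poly L}) x :
  f \is monic -> ltv O 1 f.[x] -> exists2 b, root f b & ltv O 1 (x - b).
Proof.
move=> fm fx; have [rs ers] := closed_field_poly_normal f.
rewrite (monicP fm) scale1r in ers; apply: contrapT => far.
suff : lev O f.[x] 1 by rewrite levNgt fx.
rewrite ers horner_prod big_seq; elim/big_ind: _ => [|u v hu hv|r r_rs].
- exact: lev_refl.
- by rewrite -[X in lev O _ X]mulr1 levM.
rewrite hornerXsubC levNgt; apply/negP => hr; apply: far.
by exists r; rewrite // ers root_prod_XsubC.
Qed.

Section TameClosed.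
Variables (L : closedFieldType) (O : vring L) (T : subfieldOf L).
Hypothesis algT : forall x, algebraicOver (subfield_val T) x.
Local Notation "x <=v y" := (lev O x y).
Local Notation "x <v y" := (ltv O x y).
Local Notation "x =v y" := (eqv O x y).
Local Notation sepT := (sep_field (subfield_val T)).
Local Notation intT := (int_pred O T).
Implicit Types s : {rmorphism L -> L}.

Hypothesis etale_closed :
  forall b (f : {poly int_type O T}), etale_generator algT b f -> b \in T.

Lemma hensel_closed b : b \in sepT -> 1 <v b ->
  (forall s, {in T, s =1 id} -> s b = b \/ 1 =v s b) -> b \in T.
Proof.
by move=> b_sep b_max /(hensel_etale_generator algT b_sep b_max)[f]; exact: etale_closed.
Qed.

Lemma subfield_sep : {subset T <= sepT}.
Proof. by move=> x xT; exact: (sep_field_im (subfield_val T) (Sub x xT)). Qed.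

(* With a in T of the same value as y, 1 - y / a is a Hensel element. *)
Lemma lower_prod_mem x rs (P : pred L) : x \in sepT -> x != 0 -> conj_seq T x rs ->
  {in rs &, forall r w, P r -> ~~ P w -> r <v w} -> \prod_(r <- rs | P r) r \in T.
Proof.
move=> x_sep x0 rsP lowP; set y := \prod_(r <- rs | P r) r.
have [a aT ya] := lower_prod_approx algT x_sep x0 rsP lowP.
have y_sep : y \in sepT := lower_prod_sep P x_sep rsP.
have ay := eqv_subr ya; have a0 : a != 0 by rewrite -(eqv_eq0 ay) (lower_prod_neq0 P x0 rsP).
suff bT : 1 - y / a \in T.
  have -> : y = a * (1 - (1 - y / a)) by rewrite subKr mulrC divfK.
  by rewrite rpredM // rpredB // rpred1.
apply: hensel_closed.
- by rewrite rpredB ?rpred1 // rpred_div // subfield_sep.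
- have -> : 1 - y / a = (a - y) / a by rewrite mulrBl mulfV.
  by rewrite ltv1_div // -(eqv_ltl _ ay).
move=> s sT; rewrite rmorphB rmorph1 fmorph_div (sT a aT).
have [->|y_sy] := lower_prod_conj x0 rsP lowP sT; [by left | right].
by apply: eqv_addr; rewrite ltvN ltv1_div // -(eqv_ltl _ ay).
Qed.

Lemma lev_fixed x s : x \in sepT -> {in T, s =1 id} -> s x <=v x.
Proof.
move=> x_sep sT; have [->|x0] := eqVneq x 0; first by rewrite levr0.
have [rs rsP] := exists_conj_seq algT x_sep; have [rs_uniq x_rs _ _] := rsP.
have lowP : {in rs &, forall r w, r <=v x -> ~~ (w <=v x) -> r <v w}.
  by move=> r w _ _ rx; exact: lev_lt_trans.
apply: contraT => nle; have := conj_prod_ltv rs_uniq (conj_seq_stable rsP sT)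
  (conj_seq_neq0 x0 rsP) lowP x_rs (lev_refl O x) nle.
by rewrite sT ?ltvv // (lower_prod_mem x_sep x0 rsP lowP).
Qed.

Lemma eqv_fixed x s : x \in sepT -> {in T, s =1 id} -> s x =v x.
Proof.
move=> x_sep sT; rewrite /eqv lev_fixed //=.
have [rs rsP] := exists_conj_seq algT x_sep; have [_ x_rs _ conj] := rsP.
have sx_rs := conj_seq_stable rsP sT x_rs.
have [t tT tsx] := (conj (s x) x sx_rs).1 x_rs; rewrite -{1}tsx.
by apply: lev_fixed tT; exact: sep_field_fixed.
Qed.

Lemma unramified_closed b (f : {poly L}) : 1 <=v b -> f \is monic -> f \is a polyOver intT ->
  root f b -> 1 =v f^`().[b] -> ~ residue_root O T (size f).-1 b -> b \in T.
Proof.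
move=> b1 fm fA rf fb nroot; have fT := polyOver_int_sub fA.
have size_lt (P : {poly L}) : (size P < size f)%N -> (size P <= (size f).-1)%N.
  by move=> sP; rewrite -ltnS prednK // (leq_ltn_trans _ sP).
have f_minpoly : is_minpoly T b f.
  split=> // P PT rP; have [q [r [_ rT eP /size_lt sr]]] :=
    polyOver_division (subfield_type T) fm fT PT.
  have rb : r.[b] = 0.
    by move: rP; rewrite eP rootE hornerD hornerM (rootP rf) mulr0 add0r => /eqP.
  have [r0|r0] := eqVneq r 0; first by rewrite eP r0 addr0 dvdp_mull.
  have [a [_ a0 ab _]] := horner_content nroot b1 rT sr r0.
  by move: (eqv_eq0 ab); rewrite rb eqxx (negbTE a0).
have content x : x \in simple_ext algT b -> x != 0 -> exists a P,
    [/\ a \in T, a =v x, x = P.[b] & a^-1 *: P \is a polyOver intT].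
  move=> /(simple_ext_span fm fT rf)[P [PT /size_lt sP ex]] x0.
  have P0 : P != 0 by apply: contraNneq x0 => P0; rewrite ex P0 horner0.
  have [a [aT _ ax aP]] := horner_content nroot b1 PT sP P0.
  by exists a, P; rewrite ex.
have [||f0 _ hf] := etale_generator_intro (algS := algT) f_minpoly fA b1 fb.
- move=> x xTb x1; have [->|x0] := eqVneq x 0.
    by exists 0, 1; rewrite rpred0 rpred1 hornerC horner0 mul0r eqv_refl.
  have [a [P [aT ax ex aP]]] := content x xTb x0.
  exists P, 1; rewrite rpred1 !hornerC invr1 mulr1 eqv_refl; split=> //.
  have a0 : a != 0 by rewrite (eqv_eq0 ax).
  rewrite -[P](scalerKV a0) -mul_polyC rpredM // polyOverC; apply/int_predP.
  by rewrite (eqv_ler _ ax).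
- by move=> x xTb x0; have [a [P [aT ax _ _]]] := content x xTb x0; exists a.
exact: etale_closed hf.
Qed.

Variable p : nat.
Hypotheses (p_prime : prime p) (p_residue : 1 <v p%:R).

Lemma residue_pth_power n x : 1 =v x -> residue_root O T n x ->
  exists k t, t \in T /\ 1 <v x ^+ (p ^ k) - t.
Proof.
elim/ltn_ind: n x => n IH x x_unit root_x; have x1 := eqv_le x_unit.
have [[m mn root_m]|no_root] := lem (exists2 m, (m < n)%N & residue_root O T m x).
  exact: IH mn x x_unit root_m.
have {}no_root m : (m < n)%N -> ~ residue_root O T m x.
  by move=> mn root_m; apply: no_root; exists m.
have [f [fm fA sf fx]] := root_x.
have {}sf : size f = n.
  apply/eqP; rewrite eqn_leq sf leqNgt; apply/negP => /no_root; apply.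
  by exists f; split.
have n_gt1 : (1 < n)%N.
  rewrite ltnNge -sf; apply/negP => /size1_polyC ef; move: fm fx.
  by rewrite ef monicE lead_coefC hornerC => /eqP ->; rewrite ltvv.
have [dfx|ndfx] := boolP (1 <v f^`().[x]).
  have [m mn root_xp] :=
    inseparable_residue_root p_prime p_residue no_root x1 fm fA sf n_gt1 fx dfx.
  have [k [t [tT ht]]] := IH m mn (x ^+ p) (eqv1X p x_unit) root_xp.
  by exists k.+1, t; split=> //; rewrite expnS exprM.
have dA : f^`() \is a polyOver intT by exact: polyOver_deriv.
have df_unit : 1 =v f^`().[x] by apply: eqv1_ltvN ndfx; exact: lev1_horner dA x1.
have [b rb xb] := exists_root_close fm fx.
have b1 := eqv_le (eqv1_close x_unit xb).
exists 0%N, b; rewrite expn0 expr1; split=> //; apply: (unramified_closed b1 fm fA rb).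
  exact: eqv1_horner_close dA x1 b1 xb df_unit.
rewrite sf => root_b; apply: (no_root n.-1); first by rewrite prednK // ltnW.
by apply: residue_root_close root_b => //; rewrite -opprB ltvN.
Qed.

Lemma exists_residue_root x : 1 <=v x -> exists n, residue_root O T n x.
Proof.
move=> x1; have [P P0 rP] := algT x; set Q := map_poly _ P in rP.
have Q0 : Q != 0 by rewrite map_poly_eq0.
have [a [_ a0 aQ unit_coef]] := exists_content O (polyOver_val P : Q \is a polyOver T) Q0.
exists (size Q); apply: primitive_residue_root aQ _ unit_coef _ => //.
  by rewrite size_scale ?invr_eq0.
by rewrite hornerZ (rootP rP) mulr0 ltvr0 oner_neq0.
Qed.

Lemma exists_value_power x : x != 0 -> exists2 j, (0 < j)%N & exists2 a, a \in T & x ^+ j =v a.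
Proof.
move=> x0; apply: contrapT => indep; have [P P0 rP] := algT x; set Q := map_poly _ P in rP.
have QT : Q \is a polyOver T by exact: polyOver_val.
suff Q0 : Q = 0 by move: P0; rewrite -(map_poly_eq0 (subfield_val T)) -/Q Q0 eqxx.
apply/polyP => i; rewrite coef0.
have [hi|hi] := ltnP i (size Q); last by rewrite nth_default.
have := @lev_sum_distinct_values _ O T (fun i => x ^+ i) (fun i => Q`_i) (size Q) _ _ i hi.
rewrite -horner_coef (rootP rP) lev0r mulf_eq0 expf_eq0 (negbTE x0) andbF orbF.
move=> h; apply/eqP/h; last by move=> j; exact: (polyOverP QT).
move=> i1 j1 a /andP[lt _] aT; apply/negP => e; apply: indep; exists (j1 - i1)%N.
  by rewrite subn_gt0.
exists a => //; rewrite -(eqvM2l _ _ _ (expf_neq0 i1 x0)) -exprD subnKC ?(ltnW lt) //.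
by rewrite eqv_sym.
Qed.

Hypothesis radical_closed : forall b n, radical_generator O T p b n -> b \in T.

(* An m-th root of a in T has the value of y, and is a radical generator if m is
   the order of the value of y modulo the value group of T. *)
Lemma coprime_value_mem y j a : y != 0 -> (0 < j)%N -> coprime j p -> a \in T ->
  y ^+ j =v a -> exists2 t, t \in T & y =v t.
Proof.
move=> y0 j_gt0 j_cop aT hj; pose Q m := (0 < m)%N && `[< exists2 a, a \in T & y ^+ m =v a >].
have exQ : exists m, Q m by exists j; rewrite /Q j_gt0; apply/asboolP; exists a.
case: (ex_minnP exQ) => m /andP[m_gt0 /asboolP[d dT hd]] m_min.
have d0 : d != 0 by rewrite -(eqv_eq0 hd) expf_neq0.
have m_dvd : (m %| j)%N.
  rewrite /dvdn -leqn0 leqNgt; apply/negP => r_gt0.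
  suff /m_min : Q (j %% m)%N by rewrite leqNgt ltn_mod m_gt0.
  rewrite /Q r_gt0; apply/asboolP; exists (a / d ^+ (j %/ m)); first by rewrite rpred_div ?rpredX.
  have -> : y ^+ (j %% m) = y ^+ j / (y ^+ m) ^+ (j %/ m).
    by rewrite {2}(divn_eq j m) exprD mulnC exprM mulrC mulKf ?expf_neq0.
  by apply: eqvM hj _; apply/eqvV/eqvX.
have [b rb] : exists b, root ('X^m - d%:P) b.
  by apply/closed_rootP; rewrite size_XnsubC // eqSS -lt0n.
have bm : b ^+ m = d.
  by apply/eqP; rewrite -subr_eq0; move: rb; rewrite rootE hornerD hornerN hornerXn hornerC.
have yb : y =v b by rewrite -(eqv_pX2r _ _ _ m_gt0) bm.
exists b => //; apply: (radical_closed (n := m)); split; rewrite ?bm //.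
- exact: coprime_dvdl m_dvd j_cop.
- by rewrite -(eqv_eq0 yb).
move=> i a' /andP[i_gt0 im] a'T; apply/negP => e.
suff /m_min : Q i by rewrite leqNgt im.
by rewrite /Q i_gt0; apply/asboolP; exists a' => //; exact: eqv_trans (eqvX i yb) e.
Qed.

Lemma value_pth_power x : x != 0 -> exists k t, t \in T /\ x ^+ (p ^ k) =v t.
Proof.
move=> x0; have [j j_gt0 [a aT xj]] := exists_value_power x0.
have [j' cop ej] := pfactor_coprime p_prime j_gt0; set k := logn p j in ej.
have j'_gt0 : (0 < j')%N by move: j_gt0; rewrite ej muln_gt0 => /andP[].
have hj' : (x ^+ (p ^ k)) ^+ j' =v a by rewrite -exprM mulnC -ej.
rewrite coprime_sym in cop.
have [t tT xt] := coprime_value_mem (expf_neq0 _ x0) j'_gt0 cop aT hj'.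
by exists k, t.
Qed.

(* With b^(p^k) = t w for t in T and w a unit such that w^(p^k') is close to t' in T,
   the (p^(k + k'))-th power of s b / b is close to 1. *)
Lemma ltv_fixed_sub s b : {in T, s =1 id} -> b \in sepT -> b != 0 -> b <v s b - b.
Proof.
move=> sT b_sep b0; have [k [t [tT bt]]] := value_pth_power b0.
have t0 : t != 0 by rewrite -(eqv_eq0 bt) expf_neq0.
pose w := b ^+ (p ^ k) / t; have w_unit : 1 =v w by rewrite eqv1_div.
have w_sep : w \in sepT by rewrite rpred_div ?rpredX // subfield_sep.
have [n root_w] := exists_residue_root (eqv_le w_unit).
have [k' [t' [t'T wt']]] := residue_pth_power w_unit root_w; set q := (p ^ k')%N in wt'.
have d_sep : w ^+ q - t' \in sepT by rewrite rpredB ?rpredX // subfield_sep.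
have sd := eqv_fixed d_sep sT; rewrite rmorphB rmorphXn (sT _ t'T) in sd.
have sw : 1 <v s w ^+ q - w ^+ q.
  have -> : s w ^+ q - w ^+ q = (s w ^+ q - t') - (w ^+ q - t') by ring.
  by apply: ltvB => //; rewrite (eqv_ltr _ sd).
have sb_unit : 1 =v s b / b by rewrite eqv1_div // eqv_fixed.
suff : 1 <v s b / b - 1 by rewrite -(ltvM2r _ _ _ b0) mul1r mulrBl mul1r divfK.
apply: (@ltv1_exprp_sub1 _ O p p_prime (k + k')) => //; first exact: eqv_le.
have wq_unit := eqv1X q w_unit; have wq0 := eqv1_neq0 wq_unit.
have -> : (s b / b) ^+ (p ^ (k + k')) - 1 = (s w ^+ q - w ^+ q) / w ^+ q.
  rewrite mulrBl mulfV // -expr_div_n expnD exprM; congr (_ ^+ _ - _).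
  rewrite /w fmorph_div rmorphXn (sT _ tT) expr_div_n.
  by field; rewrite t0 expf_neq0.
by apply: ltvMr => //; exact/eqv_le/eqv1V.
Qed.

End TameClosed.

(** * The ramification field *)

Section RamificationField.
Variables (K : fieldType) (L : closedFieldType) (iota : {rmorphism K -> L}) (O : vring L).
Local Notation "x <v y" := (ltv O x y).
Local Notation "x =v y" := (eqv O x y).
Implicit Types (T : subfieldOf L) (s : {rmorphism L -> L}).

Definition im_pred : {pred L} := fun x => `[< exists a, x = iota a >].
Fact im_closed : divring_closed im_pred.
Proof.
split=> [|_ _ /asboolP[a ->] /asboolP[b ->]|_ _ /asboolP[a ->] /asboolP[b ->]]; apply/asboolP.
- by exists 1; rewrite rmorph1.
- by exists (a - b); rewrite rmorphB.
- by exists (a / b); rewrite fmorph_div.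
Qed.
Definition im_subfield : subfieldOf L := subfieldOf_field im_closed.

Lemma im_subfieldP x : x \in im_subfield <-> exists a, x = iota a.
Proof. by split=> [/asboolP//|h]; apply/asboolP. Qed.

Definition ram_pred : {pred L} := fun x => `[< ram_field iota O x >].
Fact ram_closed : divring_closed ram_pred.
Proof.
split=> [|x y /asboolP[sx fx] /asboolP[sy fy]|x y /asboolP[sx fx] /asboolP[sy fy]];
  apply/asboolP; split; try apply/sep_fieldP.
- exact: rpred1.
- by move=> s _; rewrite rmorph1.
- by rewrite rpredB //; exact/sep_fieldP.
- by move=> s hs; rewrite rmorphB fx // fy.
- by rewrite rpred_div //; exact/sep_fieldP.
- by move=> s hs; rewrite fmorph_div fx // fy.
Qed.
Definition ram_subfield : subfieldOf L := subfieldOf_field ram_closed.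

Lemma ram_fieldP x : ram_field iota O x <-> x \in ram_subfield.
Proof. by split=> [h|/asboolP//]; apply/asboolP. Qed.

Lemma im_ram_subfield : {subset im_subfield <= ram_subfield}.
Proof.
move=> _ /im_subfieldP[a ->]; apply/ram_fieldP; split; first exact: separable_over_im.
by move=> s [[_ fix_K] _]; exact: fix_K.
Qed.

Lemma ram_subfield_sep : {subset ram_subfield <= sep_field iota}.
Proof. by move=> x /ram_fieldP[sep_x _]; exact/sep_fieldP. Qed.

Lemma ram_subfield_fixed s : in_ram_group iota O s -> {in ram_subfield, s =1 id}.
Proof. by move=> hs x /ram_fieldP[_]; apply. Qed.

Section IntermediateField.
Variable T : subfieldOf L.
Hypothesis KT : {subset im_subfield <= T}.

Lemma lift_im_poly (P : {poly K}) :
  exists Q : {poly subfield_type T}, map_poly (subfield_val T) Q = map_poly iota P.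
Proof.
apply: polyOver_lift; apply/polyOverP => i; rewrite coef_map.
by apply/KT/im_subfieldP; exists P`_i.
Qed.

Lemma algebraicOver_subfield :
  algebraic_over iota -> forall x, algebraicOver (subfield_val T) x.
Proof.
move=> algK x; have [P [P0 rP]] := algK x; have [Q eQ] := lift_im_poly P.
exists Q; last by rewrite eQ.
by rewrite -(map_poly_eq0 (subfield_val T)) eQ map_poly_eq0.
Qed.

Lemma sep_field_subfield : {subset sep_field iota <= sep_field (subfield_val T)}.
Proof.
move=> x /sep_fieldP[P [P0 sP rP]]; have [Q eQ] := lift_im_poly P.
apply/sep_fieldP; exists Q; rewrite eQ -(map_poly_eq0 (subfield_val T)) eQ map_poly_eq0.
by rewrite -(separable_map (subfield_val T)) eQ separable_map.
Qed.

End IntermediateField.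

Section ResidueCharacteristic.
Variable p : nat.
Hypotheses (p_prime : prime p) (p_residue : 1 <v p%:R).

Section BelowRamification.
Variable T : subfieldOf L.
Hypotheses (algT : forall x, algebraicOver (subfield_val T) x).
Hypothesis T_ram : {subset T <= ram_subfield}.

Lemma etale_generator_ram b (f : {poly int_type O T}) :
  etale_generator algT b f -> b \in ram_subfield.
Proof.
case=> _ b1 fb _ dfb _ _; set g := map_poly (int_val O T) f.
have gA : g \is a polyOver (int_pred O T) by exact: polyOver_val.
have rg : root g b by exact/rootP.
have dg : 1 =v g^`().[b] by rewrite deriv_map.
have b_sep : b \in sep_field iota.
  apply: simple_root_sep_field rg (eqv1_neq0 dg).
  by apply: polyOverS gA => x /int_predP[/T_ram/ram_subfield_sep].
apply/ram_fieldP; split; first exact/sep_fieldP.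
move=> s hs; have [->|b0] := eqVneq b 0; first by rewrite rmorph0.
have /vltP sb_b : vlt O b (s b - b) by apply: hs.2 b0; exact/sep_fieldP.
have {}sb_b := lev_lt_trans b1 sb_b.
apply: (simple_root_isolated (polyOver_int_full gA) b1 _ rg _ dg sb_b).
  by rewrite -(subrK b (s b)) levD // ltvW.
have sT : {in T, s =1 id} by move=> x /T_ram; exact: ram_subfield_fixed.
by rewrite (root_fixed sT) // (polyOver_int_sub gA).
Qed.

Lemma radical_generator_ram b n : radical_generator O T p b n -> b \in ram_subfield.
Proof.
case=> n_gt0 cop b0 bnT _; have n_unit := coprime_eqv1 p_prime p_residue cop.
have b_sep : b \in sep_field iota.
  apply: (@simple_root_sep_field _ _ _ ('X^n - (b ^+ n)%:P)).
  - by rewrite rpredB ?polyOverXn ?polyOverC // ram_subfield_sep ?T_ram.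
  - by rewrite rootE !hornerE subrr.
  - by rewrite derivB derivXn derivC subr0 hornerMn hornerXn -mulr_natl mulf_neq0
      ?(eqv1_neq0 n_unit) ?expf_neq0.
apply/ram_fieldP; split; first exact/sep_fieldP.
move=> s hs; have /vltP sb_b : vlt O b (s b - b) by apply: hs.2 b0; exact/sep_fieldP.
apply: (divIf b0); rewrite mulfV //; apply: (unity_root_eq1 p_prime p_residue cop).
  rewrite expr_div_n -rmorphXn (ram_subfield_fixed hs) ?mulfV ?expf_neq0 //.
  exact: T_ram.
by rewrite -(ltvM2r _ _ _ b0) mul1r mulrBl mul1r divfK.
Qed.

End BelowRamification.

Hypothesis algK : algebraic_over iota.

Lemma ram_subfield_sub_closed T (KT : {subset im_subfield <= T})
    (algT := algebraicOver_subfield KT algK) :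
  (forall b (f : {poly int_type O T}), etale_generator algT b f -> b \in T) ->
  (forall b n, radical_generator O T p b n -> b \in T) ->
  {subset ram_subfield <= T}.
Proof.
move=> etale_closed radical_closed x /ram_fieldP[sep_x fix_x].
have sepT := sep_field_subfield KT.
apply: (fixed_mem algT); first exact/sepT/sep_fieldP.
move=> s sT; apply: fix_x; split; first split.
- exact: fixing_bijective algT _ sT.
- by move=> a; apply/sT/KT/im_subfieldP; exists a.
move=> b sep_b b0; apply/vltP.
apply: (ltv_fixed_sub etale_closed p_prime p_residue radical_closed) => //.
exact/sepT/sep_fieldP.
Qed.

(* A maximal field to which K transfers inside the ramification field is closed
   under etale and radical generators, hence is the ramification field. *)
Lemma tame_transfer_ram : tame_transfer O p im_subfield ram_subfield.
Proof.
pose P T := tame_transfer O p im_subfield T /\ {subset T <= ram_subfield}.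
have [||T [transferT T_ram] T_max] := @subfield_Zorn _ P im_subfield.
- by split; [exact: tame_transfer_refl | exact: im_ram_subfield].
- move=> C U chC CP unionU; split.
    by apply: tame_transfer_union chC unionU _ => // S /CP[].
  by move=> x /unionU[S /CP[_ S_ram] xS]; exact: S_ram.
have KT := transfer_sub transferT.
pose algT := algebraicOver_subfield KT algK.
have step b : b \in ram_subfield -> tame_transfer O p T (simple_ext algT b) -> b \in T.
  move=> b_ram transfer; apply: (T_max (simple_ext algT b)); last exact: mem_simple_ext.
    split; first exact: tame_transfer_trans transferT transfer.
    exact: simple_ext_min.
  exact: simple_ext_sub.
suff -> : ram_subfield = T by [].
apply: eq_subfieldOf => x; apply/idP/idP; last exact: T_ram.
apply: (@ram_subfield_sub_closed T KT) => [b f f_etale|b n b_radical]; apply: step.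
- exact: etale_generator_ram f_etale.
- exact: tame_transfer_etale f_etale.
- exact: radical_generator_ram b_radical.
- exact: tame_transfer_radical b_radical.
Qed.

End ResidueCharacteristic.

Variable OK : vring K.
Hypotheses (algK : algebraic_over iota) (ringE : forall a, O (iota a) <-> OK a).

Lemma ram_gdr p : residue_char O p ->
  (frob_surj O p ram_subfield /\ vp_not_min O p ram_subfield) <->
  (frob_surj OK p predT /\ vp_not_min OK p predT).
Proof.
case=> p_prime /vltP p_residue.
rewrite (tame_transfer_gdr p_prime p_residue (tame_transfer_ram p_prime p_residue algK)).
by rewrite (frob_surj_morph p ringE im_subfieldP) (vp_not_min_morph p ringE im_subfieldP).
Qed.

Lemma ram_semitame p : residue_char O p ->
  (frob_surj O p ram_subfield /\ vgroup_pdiv O p ram_subfield) <->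
  (frob_surj OK p predT /\ vgroup_pdiv OK p predT).
Proof.
case=> p_prime /vltP p_residue.
rewrite (tame_transfer_semitame p_prime (tame_transfer_ram p_prime p_residue algK)).
by rewrite (frob_surj_morph p ringE im_subfieldP) (vgroup_pdiv_morph p ringE im_subfieldP).
Qed.

End RamificationField.

Theorem theorem1p5 (K : fieldType) (OK : K -> Prop) (hOK : valuation_ring OK)
  (L : closedFieldType) (iota : {rmorphism K -> L})
  (halg : algebraic_over iota)
  (OL : L -> Prop) (hOL : valuation_ring OL)
  (hext : forall a : K, OL (iota a) <-> OK a) :
  (gdr_in OL (ram_field iota OL) <-> gdr_in OK (fun _ => True)) /\
  (semitame_in OL (ram_field iota OL) <-> semitame_in OK (fun _ => True)).
Proof.
pose O := VRing hOL; pose O' := VRing hOK.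
have ringE a : O (iota a) <-> O' a := hext a.
have charE := residue_char_morph ringE.
have fullP (x : K) : True <-> x \in full_subfield K by [].
split.
- rewrite (gdr_inE O (ram_fieldP iota O)) (gdr_inE O' fullP).
  split=> gdr p hp; last exact/(ram_gdr halg ringE hp)/gdr/charE.
  by apply/(ram_gdr halg ringE); [exact/charE | exact/gdr/charE].
rewrite (semitame_inE O (ram_fieldP iota O)) (semitame_inE O' fullP).
split=> semitame p hp; last exact/(ram_semitame halg ringE hp)/semitame/charE.
by apply/(ram_semitame halg ringE); [exact/charE | exact/semitame/charE].
Qed.
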